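(* Suppose that the exact solution $\psi$ of the nonlinear space fractional Klein-Gordon problem (NSFKGE, stated in the context) satisfies, up to the time $T_\varepsilon=T/\varepsilon^2$, $$\|\psi\|_{C^{2}([0,T_{\varepsilon}]; H^{m+\alpha/2})}\lesssim 1,\qquad \|\partial_{t}\psi\|_{C^{2}([0,T_{\varepsilon}]; H^{m})}\lesssim 1,\qquad m>1.$$ Let $0<\tau_0<1$ be small enough and independent of $\varepsilon$, and let $\gamma\in(0,1)$ be a fixed constant. Then, when $$0<\tau<\min\left\{1,\ \gamma\,\frac{\pi(b-a)^{\alpha/2}\tau_0^{\alpha/2}}{2\sqrt{\beta\tau_0^{\alpha}(b-a)^{\alpha}+2^{\alpha}\pi^{\alpha}(1+\tau_0)^{\alpha}}}\right\},$$ the semi-discrete approximations $\psi^{[n]},\eta^{[n]}$ (defined in the context) satisfy the improved uniform error bound $$\|\psi(\cdot,t_n)-\psi^{[n]}\|_{\alpha/2}+\|\partial_t\psi(\cdot,t_n)-\eta^{[n]}\|\lesssim \varepsilon^2\tau^2+\tau_0^{m+\alpha/2},\qquad 0\le n\le T_\varepsilon/\tau.$$ In particular, if the exact solution is sufficiently smooth, the last term $\tau_0^{m+\alpha/2}$ can be ignored for small enough $\tau_0$, and then the improved uniform error bound for sufficiently small $\tau$ is $$\|\psi(\cdot,t_n)-\psi^{[n]}\|_{\alpha/2}+\|\partial_t\psi(\cdot,t_n)-\eta^{[n]}\|\lesssim \varepsilon^2\tau^2,\qquad 0\le n\le T_\varepsilon/\tau.$$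
   Context: Parameters: $\Omega=(a,b)$ is a bounded interval, $1<\alpha\le 2$, $\beta>0$, $T>0$ fixed, $\varepsilon\in(0,1]$, $T_\varepsilon=T/\varepsilon^2$; $\tau>0$ is the time step and $t_n=n\tau$. The notation $A\lesssim B$ means $|A|\le CB$ with a constant $C>0$ independent of the space step $h$, the time step $\tau$ and $\varepsilon$. Fourier notation: $\mu_l=\frac{2\pi l}{b-a}$; for $\phi=\sum_{l\in\mathbb Z}\widehat\phi_l e^{i\mu_l(x-a)}$, $\|\phi\|_s^2=\sum_{l\in\mathbb Z}(1+\mu_l^2)^s|\widehat\phi_l|^2$ is the (periodic) $H^s(\Omega)$-norm, and $\|\cdot\|=\|\cdot\|_0$ is the $L^2$-norm. The operator $(-\Delta)^{\alpha/2}$ multiplies $\widehat\phi_l$ by $|\mu_l|^\alpha$. Put $\delta_l=\sqrt{\beta+|\mu_l|^\alpha}$; the operators $\langle\nabla\rangle_\alpha=\sqrt{\beta+(-\Delta)^{\alpha/2}}$, $\langle\nabla\rangle_\alpha^{-1}$ and $e^{i\tau\langle\nabla\rangle_\alpha}$ multiply $\widehat\phi_l$ by $\delta_l$, $\delta_l^{-1}$ and $e^{i\tau\delta_l}$ respectively. NSFKGE: the real-valued function $\psi(x,t)$ solves $$\partial_{tt}\psi+(-\Delta)^{\alpha/2}\psi+\beta\psi+\varepsilon^2\psi^3=0,\quad x\in\Omega,\ t>0,$$ with periodic boundary conditions $\psi(a,t)=\psi(b,t)$, $\partial_x\psi(a,t)=\partial_x\psi(b,t)$ for $t\ge0$, and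 initial data $\psi(x,0)=\psi_0(x)$, $\partial_t\psi(x,0)=\psi_1(x)$, where $\psi_0,\psi_1$ are real-valued and independent of $\varepsilon$. Semi-discrete (in time) scheme: let $g(\varphi)=\frac18(\varphi+\overline\varphi)^3$ and $G(\varphi)=i\langle\nabla\rangle_\alpha^{-1}g(\varphi)$. Set $\varphi^{[0]}=\psi_0-i\langle\nabla\rangle_\alpha^{-1}\psi_1$ and, for $n\ge0$, $$\varphi^{[n+1]}=e^{i\tau\langle\nabla\rangle_\alpha}\varphi^{[n]}+\frac{\varepsilon^2\tau}{2}\left[G(\varphi^{[n+1]})+e^{i\tau\langle\nabla\rangle_\alpha}G(\varphi^{[n]})\right],$$ $$\psi^{[n+1]}=\tfrac12\left(\varphi^{[n+1]}+\overline{\varphi^{[n+1]}}\right),\qquad \eta^{[n+1]}=\tfrac{i}{2}\langle\nabla\rangle_\alpha\left(\varphi^{[n+1]}-\overline{\varphi^{[n+1]}}\right),$$ with $\psi^{[0]}=\psi_0$ and $\eta^{[0]}=\psi_1$.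
   Formalization: In the ''in particular'' part, ''sufficiently smooth'' is made precise as m ≥ α/2+α/κ (any κ>0) and ''sufficiently small τ'' as τ < τ₁ε^κ; with a threshold for τ independent of ε the bound ε²τ² fails at numerical resonances such as τ(2δ_0+2δ_L)=2π as ε→0. *)

(* Defs.v *)
From HB Require Import structures.
From mathcomp Require Import all_boot all_order all_algebra.
From mathcomp Require Import all_classical all_reals all_analysis.
From mathcomp Require Export complex.
Set Implicit Arguments.
Unset Strict Implicit.
Unset Printing Implicit Defensive.
Import Order.TTheory GRing.Theory Num.Theory.
Import numFieldNormedType.Exports.

Local Open Scope classical_set_scope.
Local Open Scope ring_scope.
Local Open Scope complex_scope.

(* Functions on Omega = (a, b) are total functions R -> R[i] (or R -> R) of
   which only the values on [a, b] matter; curves in time take the time as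
   first argument. *)

Definition expi (R : realType) (theta : R) : R[i] := cos theta +i* sin theta.

Definition toC (R : realType) (f : R -> R) : R -> R[i] := fun x => (f x)%:C.

Definition mu (R : realType) (a b : R) (l : int) : R :=
  2 * pi * l%:~R / (b - a).

Definition delta (R : realType) (a b alpha beta : R) (l : int) : R :=
  Num.sqrt (beta + `|mu a b l| `^ alpha).

Definition inL2 (R : realType) (a b : R) (f : R -> R[i]) : Prop :=
  [/\ measurable_fun `[a, b] (fun x => complex.Re (f x)),
      measurable_fun `[a, b] (fun x => complex.Im (f x)) &
      (\int[lebesgue_measure]_(x in `[a, b])
         ((ComplexField.Normc.normc (f x)) ^+ 2)%:E < +oo)%E].

Definition cintegral (R : realType) (a b : R) (f : R -> R[i]) : R[i] :=
  Rintegral lebesgue_measure `[a, b] (fun x => complex.Re (f x)) +i*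
  Rintegral lebesgue_measure `[a, b] (fun x => complex.Im (f x)).

Definition fcoef (R : realType) (a b : R) (f : R -> R[i]) (l : int) : R[i] :=
  ((b - a)^-1)%:C *
  cintegral a b (fun x => f x * expi (- (mu a b l * (x - a)))).

(* The value +oo is given to functions outside L^2, so that
   [(hnorm a b s f < +oo)%E] is exactly membership in periodic H^s. *)
Definition hnorm (R : realType) (a b s : R) (f : R -> R[i]) : \bar R :=
  if `[< inL2 a b f >] then
    ((\esum_(l in [set: int])
        ((1 + mu a b l ^+ 2) `^ s *
         (ComplexField.Normc.normc (fcoef a b f l)) ^+ 2)%:E) `^ (2^-1))%E
  else +oo%E.

(* Sum of the trigonometric series with coefficients c, as the limit of the
   symmetric partial sums over |l| <= N. *)
Definition fseries (R : realType) (a b : R) (c : int -> R[i]) (x : R) : R[i] :=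
  let S := fun N : nat =>
    \sum_(k < N.*2.+1)
       c (k%:Z - N%:Z) * expi (mu a b (k%:Z - N%:Z) * (x - a)) in
  limn (fun N => complex.Re (S N)) +i* limn (fun N => complex.Im (S N)).

(* Fourier multiplier as an operator on functions.  It is used for the
   time-discrete scheme, where the coefficients are absolutely summable, so
   that the series is the continuous representative. *)
Definition fmult (R : realType) (a b : R) (k : int -> R[i]) (f : R -> R[i]) :
    R -> R[i] :=
  fseries a b (fun l => k l * fcoef a b f l).

(* Fourier multiplier as a relation in L^2; it presupposes nothing about the
   pointwise convergence of the series of k(l) * fcoef f l. *)
Definition is_fmult (R : realType) (a b : R) (k : int -> R[i])
    (f u : R -> R[i]) : Prop :=
  inL2 a b u /\ forall l, fcoef a b u l = k l * fcoef a b f l.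

Definition is_fraclap (R : realType) (a b alpha : R) (f u : R -> R[i]) : Prop :=
  is_fmult a b (fun l => (`|mu a b l| `^ alpha)%:C) f u.

Definition jnabla (R : realType) (a b alpha beta : R) : (R -> R[i]) -> R -> R[i] :=
  fmult a b (fun l => (delta a b alpha beta l)%:C).

Definition jnablaV (R : realType) (a b alpha beta : R) : (R -> R[i]) -> R -> R[i] :=
  fmult a b (fun l => ((delta a b alpha beta l)^-1)%:C).

Definition expjnabla (R : realType) (a b alpha beta tau : R) :
    (R -> R[i]) -> R -> R[i] :=
  fmult a b (fun l => expi (tau * delta a b alpha beta l)).

(* Derivative of f at x relative to D: one-sided at the ends of an interval. *)
Definition has_deriv_in (R : realType) (D : set R) (f : R -> R) (x l : R) : Prop :=
  (fun y => (f y - f x) / (y - x)) @ within D (dnbhs x) --> l.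

Definition is_NSFKGE_solution (R : realType) (a b alpha beta eps Tend : R)
    (psi0 psi1 : R -> R) (psi psit : R -> R -> R) : Prop :=
  [/\ forall t x, 0 <= t <= Tend -> a <= x <= b ->
        has_deriv_in `[0, Tend] (fun r => psi r x) t (psit t x),
      forall t, 0 < t < Tend ->
        exists psitt lap : R -> R,
          [/\ forall x, a < x < b ->
                has_deriv_in `[0, Tend] (fun r => psit r x) t (psitt x),
              is_fraclap a b alpha (toC (psi t)) (toC lap) &
              forall x, a < x < b ->
                psitt x + lap x + beta * psi t x + eps ^+ 2 * psi t x ^+ 3 = 0],
      forall t, 0 <= t <= Tend ->
        psi t a = psi t b /\
        exists psix : R -> R,
          (forall x, a <= x <= b -> has_deriv_in `[a, b] (psi t) x (psix x)) /\
          psix a = psix b &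
      forall x, a <= x <= b -> psi 0 x = psi0 x /\ psit 0 x = psi1 x].

Definition hderiv (R : realType) (a b s Tend : R) (u u' : R -> R -> R[i]) : Prop :=
  forall t, 0 <= t <= Tend ->
    (fun r => hnorm a b s
       (fun x => ((r - t)^-1)%:C * (u r x - u t x) - u' t x))
      @ within `[0, Tend] (dnbhs t) --> 0%E.

Definition hcont (R : realType) (a b s Tend : R) (u : R -> R -> R[i]) : Prop :=
  forall t, 0 <= t <= Tend ->
    (fun r => hnorm a b s (fun x => u r x - u t x))
      @ within `[0, Tend] (nbhs t) --> 0%E.

(* u belongs to C^2([0, Tend]; H^s), with norm (the maximum of the sup norms of
   u, u', u'') at most M. *)
Definition C2_norm_le (R : realType) (a b s Tend : R) (u : R -> R -> R[i]) (M : R) :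
    Prop :=
  exists u1 u2 : R -> R -> R[i],
    [/\ hderiv a b s Tend u u1, hderiv a b s Tend u1 u2, hcont a b s Tend u2 &
        forall t, 0 <= t <= Tend ->
          [/\ (hnorm a b s (u t) <= M%:E)%E,
              (hnorm a b s (u1 t) <= M%:E)%E &
              (hnorm a b s (u2 t) <= M%:E)%E]].

Definition gnl (R : realType) (phi : R -> R[i]) : R -> R[i] :=
  fun x => (8^-1)%:C * (phi x + conjc (phi x)) ^+ 3.

Definition Gnl (R : realType) (a b alpha beta : R) (phi : R -> R[i]) : R -> R[i] :=
  fun x => (0 +i* 1) * jnablaV a b alpha beta (gnl phi) x.

(* The scheme is implicit, hence a predicate on the whole sequence. *)
Definition is_semidiscrete (R : realType) (a b alpha beta eps tau : R)
    (psi0 psi1 : R -> R) (phi : nat -> R -> R[i]) : Prop :=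
  [/\ forall n, (hnorm a b (alpha / 2) (phi n) < +oo)%E,
      forall x, a <= x <= b ->
        phi 0%N x = (psi0 x)%:C - (0 +i* 1) * jnablaV a b alpha beta (toC psi1) x &
      forall n x, a <= x <= b ->
        phi n.+1 x =
          expjnabla a b alpha beta tau (phi n) x +
          (eps ^+ 2 * tau / 2)%:C *
          (Gnl a b alpha beta (phi n.+1) x +
           expjnabla a b alpha beta tau (Gnl a b alpha beta (phi n)) x)].

Definition psi_approx (R : realType) (psi0 : R -> R) (phi : nat -> R -> R[i])
    (n : nat) : R -> R[i] :=
  if n is 0%N then toC psi0
  else fun x => (2^-1)%:C * (phi n x + conjc (phi n x)).

Definition eta_approx (R : realType) (a b alpha beta : R) (psi1 : R -> R)
    (phi : nat -> R -> R[i]) (n : nat) : R -> R[i] :=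
  if n is 0%N then toC psi1
  else fun x => (0 +i* 1) * (2^-1)%:C *
         jnabla a b alpha beta (fun y => phi n y - conjc (phi n y)) x.

Definition scheme_error (R : realType) (a b alpha beta tau : R)
    (psi0 psi1 : R -> R) (psi psit : R -> R -> R) (phi : nat -> R -> R[i])
    (n : nat) : \bar R :=
  (hnorm a b (alpha / 2)%R
     (fun x => (toC (psi (n%:R * tau)) x - psi_approx psi0 phi n x)%R) +
   hnorm a b 0
     (fun x => (toC (psit (n%:R * tau)) x
               - eta_approx a b alpha beta psi1 phi n x)%R))%E.

Definition step_bound (R : realType) (a b alpha beta gamma tau0 : R) : R :=
  Num.min 1
    (gamma * ((pi * (b - a) `^ (alpha / 2) * tau0 `^ (alpha / 2)) /
              (2 * Num.sqrt (beta * tau0 `^ alpha * (b - a) `^ alpha +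
                             2 `^ alpha * pi `^ alpha * (1 + tau0) `^ alpha)))).

(* Main.v *)
Require Import Defs.
From HB Require Import structures.
From mathcomp Require Import all_boot all_order all_algebra.
From mathcomp Require Import all_classical all_reals all_analysis.
From mathcomp Require Import finmap measurable_realfun.
From mathcomp Require Import ring lra zify.
Import Order.TTheory GRing.Theory Num.Theory.
Import numFieldNormedType.Exports.
Set Implicit Arguments.
Unset Strict Implicit.
Unset Printing Implicit Defensive.
Local Open Scope ring_scope.
Local Open Scope complex_scope.

(** The error analysis takes place among absolutely summable Fourier coefficients,
    where products are harmless: [bsum] bounds sums, and [inA] says that a function is
    the sum of the series with given coefficients. Let [c], [d] and [NN] be the
    coefficients of psi, of its time derivative and of the cube of psi, and let
    [delta] be the dispersion relation. The two travelling waves [trav], which are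
    [c - i * d / delta] and [c + i * d / delta], oscillate under the linear flow. In
    the rotating frame they become [chi], which satisfies
    [delta * chi' = + i * eps ^+ 2 * expi (- t * delta) * NN] or its analogue with
    opposite signs. The scheme is the trapezoidal rule for this equation. It is only
    apparently implicit: the nonlinearity depends on the real part of the unknown and
    contributes to its imaginary part, so the real part of the next iterate is
    explicit ([Gnl_Re]).

    Consistency. Over times of order [eps ^- 2] the plain error bound of the
    trapezoidal rule is [tau ^+ 2]; the additional factor [eps ^+ 2] comes from
    oscillation. The right-hand side is a sum over triples of travelling waves with
    phases [La], a signed sum of four values of [delta], and with amplitudes whose
    derivatives are of order [eps ^+ 2]. For frequencies up to [tau0^-1] the step
    restriction gives [`|tau * La| <= 2 * pi * gamma] ([low_frequency_phase]), which
    excludes the nonzero resonances of the rule, in the multiples of [2 * pi]. The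
    local errors of such an oscillation then sum to a bounded quantity of size
    [tau ^+ 2 * `|La|], because their kernel has a primitive [qker] that is carried
    from one step to the next by the factor [expi (La * tau)]. What is left are
    boundary terms of size [eps ^+ 2 * tau ^+ 2], and terms that grow with time but
    contain derivatives of the amplitudes, of size [eps ^+ 4 * tau ^+ 2] per unit of
    time ([oscillatory_trapezoid], [exact_trapezoid]).

    High frequencies. Beyond [tau0^-1] nothing is gained from oscillation. Their part
    of [NN] is of size [tau0 `^ (m + alpha / 2)] in the norm of absolute sums
    ([cube_truncation]). For this the second time derivative is used: through the
    equation it provides [alpha] more space derivatives than are assumed of psi,
    which is more than the passage from square sums to absolute sums costs
    ([exact_coefs]).

    Stability. The difference of the exact and the numerical nonlinearity is Lipschitz
    in the sum of [|c|], and enters with the factor [eps ^+ 2], which is compensated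
    by the length of the time interval. In the position error the newest of these
    differences cancels between the two travelling waves, so a discrete Gronwall
    argument applies ([position_stability], [velocity_stability]). The bound on
    [tau0] serves to keep the iterates in a fixed ball. Sobolev norms of the error are
    at most its weighted absolute sums ([bsum_hnorm]), whence [scheme_error_le]. The
    last part of the theorem chooses [tau0] as small as the step restriction permits
    ([optimal_cutoff]). *)

(** * Complex moduli and absolutely summable families *)

Notation nC := ComplexField.Normc.normc.

Section complex_modulus.
Variable R : realType.
Implicit Types (x y : R[i]) (r : R).

Lemma nC_ge0 x : 0 <= nC x.
Proof. by case: x => u v; exact: sqrtr_ge0. Qed.

Lemma nCM x y : nC (x * y) = nC x * nC y.
Proof. exact: ComplexField.Normc.normcM. Qed.

Lemma nCD x y : nC (x + y) <= nC x + nC y.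
Proof. exact: le_normcD. Qed.

Lemma nCN x : nC (- x) = nC x.
Proof. exact: normcN. Qed.

Lemma nCB x y : nC (x - y) <= nC x + nC y.
Proof. by rewrite -(nCN y) nCD. Qed.

Lemma nCBC x y : nC (x - y) = nC (y - x).
Proof. by rewrite -nCN opprB. Qed.

Lemma nC0 : nC (0 : R[i]) = 0.
Proof. exact: ComplexField.Normc.normc0. Qed.

Lemma nC_eq0 x : nC x = 0 -> x = 0.
Proof. exact: ComplexField.Normc.eq0_normc. Qed.

Lemma nC_real r : nC r%:C = `|r|.
Proof. by rewrite /= expr0n addr0 sqrtr_sqr. Qed.

Lemma nC_i : nC ('i : R[i]) = 1.
Proof. by rewrite /= expr0n expr1n add0r sqrtr1. Qed.

Lemma nC_conj x : nC (conjc x) = nC x.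
Proof. by case: x => u v /=; rewrite sqrrN. Qed.

Lemma nC_sum (I : Type) (s : seq I) (P : pred I) (F : I -> R[i]) :
  nC (\sum_(i <- s | P i) F i) <= \sum_(i <- s | P i) nC (F i).
Proof.
elim/big_ind2 : _ => [|u v w z h1 h2|//]; first by rewrite nC0.
by apply: (le_trans (nCD _ _)); exact: lerD.
Qed.

Lemma normr_Re_le x : `|complex.Re x| <= nC x.
Proof.
by case: x => u v /=; rewrite -sqrtr_sqr ler_wsqrtr// lerDl sqr_ge0.
Qed.

Lemma normr_Im_le x : `|complex.Im x| <= nC x.
Proof.
by case: x => u v /=; rewrite -sqrtr_sqr ler_wsqrtr// lerDr sqr_ge0.
Qed.

Lemma nC_le_ReIm x : nC x <= `|complex.Re x| + `|complex.Im x|.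
Proof.
case: x => u v /=.
rewrite -[leRHS]ger0_norm ?addr_ge0// -sqrtr_sqr ler_wsqrtr//.
rewrite sqrrD !real_normK ?num_real//.
have : 0 <= `|u| * `|v| *+ 2 by rewrite mulrn_wge0// mulr_ge0.
by lra.
Qed.

Lemma nC_sqr x : nC x ^+ 2 = complex.Re x ^+ 2 + complex.Im x ^+ 2.
Proof. by case: x => u v /=; rewrite sqr_sqrtr// addr_ge0 ?sqr_ge0. Qed.

Lemma nC_expi r : nC (expi r) = 1.
Proof. by rewrite /expi /= cos2Dsin2 sqrtr1. Qed.

Lemma expiD r s : expi (r + s) = expi r * expi s :> R[i].
Proof. by rewrite /expi cosD sinD; apply/eqP; rewrite eq_complex /=; apply/andP; split; apply/eqP; ring. Qed.

Lemma expi0 : expi 0 = 1 :> R[i].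
Proof. by rewrite /expi cos0 sin0. Qed.

Lemma expiN r : expi (- r) = conjc (expi r).
Proof. by rewrite /expi cosN sinN. Qed.

Lemma expiK r : expi r * expi (- r) = 1 :> R[i].
Proof. by rewrite -expiD subrr expi0. Qed.

Lemma expi_nat n r : expi (n%:R * r) = expi r ^+ n :> R[i].
Proof.
elim: n => [|n IH]; first by rewrite mul0r expi0.
by rewrite -natr1 mulrDl mul1r expiD IH exprSr.
Qed.

End complex_modulus.

Section bounded_sums.
Variable R : realType.

(** Bounds of l1 norms are stated through finite partial sums: comparison,
    reindexing and exchange of sums then need neither limits nor summability. *)
Definition bsum (I : eqType) (u : I -> R) (B : R) : Prop :=
  forall s : seq I, uniq s -> \sum_(i <- s) u i <= B.

Lemma bsum_ge0 (I : eqType) (u : I -> R) B : bsum u B -> 0 <= B.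
Proof. by move=> /(_ [::] isT); rewrite big_nil. Qed.

Lemma bsum_le (I : eqType) (u v : I -> R) B C :
  (forall i, u i <= v i) -> B <= C -> bsum v B -> bsum u C.
Proof.
move=> uv BC h s us; apply: le_trans BC; apply: le_trans (h s us).
by apply: ler_sum => i _.
Qed.

Lemma bsumZ (I : eqType) (u : I -> R) B k :
  0 <= k -> bsum u B -> bsum (fun i => k * u i) (k * B).
Proof. by move=> k0 h s us; rewrite -mulr_sumr ler_wpM2l// h. Qed.

Lemma bsumD (I : eqType) (u v : I -> R) B C :
  bsum u B -> bsum v C -> bsum (fun i => u i + v i) (B + C).
Proof. by move=> hu hv s us; rewrite big_split lerD ?hu ?hv. Qed.

Lemma bsum_reindex (I J : eqType) (g : J -> I) (u : I -> R) B :
  injective g -> bsum u B -> bsum (u \o g) B.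
Proof.
move=> gi h s us; have := h (map g s); rewrite big_map; apply.
by rewrite map_inj_uniq.
Qed.

Lemma bsum_term (I : eqType) (u : I -> R) B i : bsum u B -> u i <= B.
Proof. by move=> /(_ [:: i] isT); rewrite big_seq1. Qed.

Lemma sum_subset (I : eqType) (u : I -> R) (s t : seq I) :
  (forall i, 0 <= u i) -> uniq s -> uniq t -> {subset s <= t} ->
  \sum_(i <- s) u i <= \sum_(i <- t) u i.
Proof.
move=> u0 us ut st; rewrite [leRHS](bigID (fun i => i \in s) predT) /=.
have -> : \sum_(i <- t | i \in s) u i = \sum_(i <- s) u i.
  rewrite -big_filter; apply: perm_big.
  apply: uniq_perm; [exact: filter_uniq|exact: us|] => i.
  by rewrite mem_filter; case: (boolP (i \in s)) => //= /st ->.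
by rewrite lerDl sumr_ge0.
Qed.

Lemma bsum_sqr (I : eqType) (u : I -> R) B :
  (forall i, 0 <= u i) -> bsum u B -> bsum (fun i => u i ^+ 2) (B ^+ 2).
Proof.
move=> u0 h s us.
have S0 : 0 <= \sum_(i <- s) u i by rewrite sumr_ge0.
apply: (@le_trans _ _ ((\sum_(i <- s) u i) ^+ 2)); last first.
  by rewrite ler_sqr ?nnegrE ?h// (bsum_ge0 h).
elim: s us {S0} => [|i s IH] /=; first by rewrite !big_nil expr0n.
move=> /andP[_ us]; rewrite !big_cons sqrrD.
have := IH us.
have : 0 <= u i * \sum_(j <- s) u j by rewrite mulr_ge0// sumr_ge0.
by rewrite mulr2n; lra.
Qed.

(** The Cauchy-Schwarz inequality in the form given by
    [u * v <= e * u ^+ 2 + e^-1 * v ^+ 2]: the scale [e] is the size of [v], which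
    makes the bound linear in it. *)
Lemma bsum_CS (I : eqType) (u v : I -> R) (A e : R) :
  0 < e -> bsum (fun i => u i ^+ 2) A -> bsum (fun i => v i ^+ 2) (e ^+ 2) ->
  bsum (fun i => u i * v i) (e * (A + 1)).
Proof.
move=> e0 hu hv.
have h := bsumD (bsumZ (ltW e0) hu) (bsumZ (ltW (divr_gt0 ltr01 e0)) hv).
apply: bsum_le h => [i|]; last by rewrite div1r expr2 mulKf ?gt_eqF// mulrDr mulr1.
rewrite -subr_ge0.
have -> : e * u i ^+ 2 + 1 / e * v i ^+ 2 - u i * v i =
   e^-1 * ((e * u i - v i / 2) ^+ 2 + 3 / 4 * v i ^+ 2).
  by field; rewrite gt_eqF.
apply: mulr_ge0; first by rewrite invr_ge0 ltW.
by apply: addr_ge0; [exact: sqr_ge0|apply: mulr_ge0; [lra|exact: sqr_ge0]].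
Qed.

(** A finite family whose sum is within [e] of the supremum leaves at most [e] to
    every family disjoint from it. *)
Lemma bsum_seq_tail (I : eqType) (u : I -> R) (B e : R) :
  (forall i, 0 <= u i) -> bsum u B -> 0 < e ->
  exists2 s0 : seq I, uniq s0 &
    forall s, uniq s -> (forall i, i \in s -> i \notin s0) ->
      \sum_(i <- s) u i <= e.
Proof.
move=> u0 h e0.
pose E : set R :=
  [set x : R | exists2 s : seq I, uniq s & x = \sum_(i <- s) u i]%classic.
have hE : has_sup E.
  split; first by exists 0; exists [::] => //; rewrite big_nil.
  by exists B => _ [s us ->]; exact: h.
have [x [s0 us0 xE] xs] := sup_adherent e0 hE.
exists s0 => // s us dis.
have : \sum_(i <- s0 ++ s) u i <= sup E.
  apply: sup_upper_bound => //; exists (s0 ++ s) => //.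
  rewrite cat_uniq us0 us andbT /=; apply/hasPn => i /dis.
  by [].
by rewrite big_cat /= -xE; lra.
Qed.

Lemma bsum_int_tail (u : int -> R) (B e : R) :
  (forall i, 0 <= u i) -> bsum u B -> 0 < e ->
  exists N : nat, forall s, uniq s -> (forall i, i \in s -> (N < `|i|)%N) ->
      \sum_(i <- s) u i <= e.
Proof.
move=> u0 h e0; have [s0 us0 hs0] := bsum_seq_tail u0 h e0.
exists (\max_(i <- s0) `|i|)%N => s us hs; apply: hs0 => // i /hs.
apply: contraL => is0; rewrite -leqNgt; exact: (@leq_bigmax_seq _ s0 predT (fun j : int => `|j|%N)).
Qed.

Lemma bsum_nat (v : nat -> R) B : (forall n, 0 <= v n) ->
  (forall N, \sum_(i < N) v i <= B) -> bsum v B.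
Proof.
move=> v0 h s us.
apply: le_trans (h (\max_(i <- s) i).+1).
rewrite -(big_mkord predT) /index_iota subn0.
apply: sum_subset => //; first exact: iota_uniq.
by move=> i si; rewrite mem_iota /= ltnS; exact: (@leq_bigmax_seq _ s predT id).
Qed.

Lemma bsum_int_nat (v : nat -> R) B :
  bsum v B -> bsum (fun l : int => v `|l|%N) (B + B).
Proof.
move=> h s us; rewrite (bigID (fun i => 0 <= i)) /=; apply: lerD.
  rewrite -big_filter -(big_map (fun l : int => `|l|%N) predT v); apply: h.
  rewrite map_inj_in_uniq ?filter_uniq// => i j.
  by rewrite !mem_filter => /andP[i0 _] /andP[j0 _]; lia.
rewrite -big_filter -(big_map (fun l : int => `|l|%N) predT v); apply: h.
rewrite map_inj_in_uniq ?filter_uniq// => i j.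
by rewrite !mem_filter => /andP[i0 _] /andP[j0 _]; lia.
Qed.

Lemma bsum_inv_sqr : bsum (fun l : int => (1 + (l%:~R : R) ^+ 2)^-1) 6.
Proof.
have h : bsum (fun n : nat => (1 + (n%:R : R) ^+ 2)^-1) 3.
  apply: bsum_nat => [n|N].
    by rewrite invr_ge0 addr_ge0// sqr_ge0.
  (* 2 / n - 2 / (n + 1) dominates the next term, so the sum telescopes *)
  suff H : \sum_(i < N.+1) (1 + (i%:R : R) ^+ 2)^-1 <= 3 - 2 / N.+1%:R.
    apply: le_trans (_ : 3 - 2 / N.+1%:R <= 3); last first.
      by rewrite gerBl divr_ge0.
    apply: le_trans H; rewrite big_ord_recr /= lerDl invr_ge0.
    by rewrite addr_ge0// sqr_ge0.
  elim: N => [|N IH].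
    by rewrite big_ord_recl big_ord0 expr0n /= !addr0 !mulr1n !divr1 ?invr1; lra.
  rewrite big_ord_recr /=; apply: le_trans (lerD IH (lexx _)) _.
  rewrite -subr_ge0.
  set n := N.+1%:R : R.
  have n0 : 1 <= n by rewrite ler1n.
  rewrite -[N.+2%:R]natr1 -/n.
  have -> : 3 - 2 / (n + 1) - (3 - 2 / n + (1 + n ^+ 2)^-1) =
    (n ^+ 2 - n + 2) / (n * (n + 1) * (1 + n ^+ 2)).
    field.
    by apply/and3P; split; rewrite gt_eqF//; nra.
  apply: divr_ge0; nra.
have := bsum_int_nat h; apply: bsum_le => [l|]; last by lra.
by rewrite (_ : (`|l|%N%:R : R) ^+ 2 = l%:~R ^+ 2)//
  natr_absz intr_norm real_normK// num_real.
Qed.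

End bounded_sums.

(** * Fourier coefficients of integrable functions *)

Section complex_integral.
Variables (R : realType) (a b : R) (hab : a < b).
Implicit Types (f g : R -> R[i]) (k : R[i]).
Local Notation leb := (@lebesgue_measure R).
Local Notation D := (`[a, b]%classic : set R).

Definition inL1 f : Prop :=
  leb.-integrable D (EFin \o (fun x => complex.Re (f x))) /\
  leb.-integrable D (EFin \o (fun x => complex.Im (f x))).

(** Bounded measurable functions form an algebra, and multiplying by them
    preserves integrability; all products below stay in this class. *)
Definition bmeas f : Prop :=
  [/\ measurable_fun D (fun x => complex.Re (f x)),
      measurable_fun D (fun x => complex.Im (f x)) &
      exists B, forall x, a <= x <= b -> nC (f x) <= B].

Lemma lebD_fin : (leb D < +oo)%E.
Proof. by rewrite lebesgue_measure_itv /= lte_fin hab -EFinB ltry. Qed.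

Lemma lebD : leb D = (b - a)%:E.
Proof. by rewrite lebesgue_measure_itv /= lte_fin hab. Qed.

Local Notation measD := (measurable_itv `[a, b]).

Lemma DE x : D x -> a <= x <= b.
Proof. by rewrite /= in_itv. Qed.

Lemma bounded_integrable (u : R -> R) B : measurable_fun D u ->
  (forall x, a <= x <= b -> `|u x| <= B) -> leb.-integrable D (EFin \o u).
Proof.
move=> mu_ hB; apply: measurable_bounded_integrable => //; first exact: lebD_fin.
exists B; split; first exact: num_real.
move=> M BM x Dx; apply: le_trans (hB _ (DE Dx)) _; exact: ltW.
Qed.

Let integrableD_R (u v : R -> R) : leb.-integrable D (EFin \o u) ->
  leb.-integrable D (EFin \o v) ->
  leb.-integrable D (EFin \o (fun x => u x + v x)).
Proof.
move=> iu iv; have h := @integrableD _ _ _ leb D measD _ _ iu iv.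
by move: h; congr (_.-integrable _ _).
Qed.

Let integrableB_R (u v : R -> R) : leb.-integrable D (EFin \o u) ->
  leb.-integrable D (EFin \o v) ->
  leb.-integrable D (EFin \o (fun x => u x - v x)).
Proof.
move=> iu iv; have h := @integrableB _ _ _ leb D measD _ _ iu iv.
by move: h; congr (_.-integrable _ _).
Qed.

Let integrableZ_R (c : R) (u : R -> R) : leb.-integrable D (EFin \o u) ->
  leb.-integrable D (EFin \o (fun x => c * u x)).
Proof.
move=> iu; have h := @integrableZl _ _ _ leb D measD c _ iu.
by move: h; congr (_.-integrable _ _).
Qed.

Lemma measurable_nC2 f : measurable_fun D (fun x => complex.Re (f x)) ->
  measurable_fun D (fun x => complex.Im (f x)) ->
  measurable_fun D (fun x => nC (f x) ^+ 2).
Proof.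
move=> h1 h2; under [X in measurable_fun _ X]eq_fun do rewrite nC_sqr.
by apply: measurable_funD; apply: measurable_funX.
Qed.

Lemma bmeas_L1 f : bmeas f -> inL1 f.
Proof.
move=> [m1 m2 [B hB]]; split; apply: (@bounded_integrable _ B) => // x /hB;
  apply: le_trans; [exact: normr_Re_le|exact: normr_Im_le].
Qed.

Lemma inL2_integrable f : inL2 a b f ->
  leb.-integrable D (EFin \o (fun x => nC (f x) ^+ 2)).
Proof.
move=> [m1 m2 h]; apply/integrableP; split.
  by apply/measurable_EFinP; exact: measurable_nC2.
under eq_integral do rewrite /= ger0_norm ?sqr_ge0//.
exact: h.
Qed.

Lemma inL2_of_integrable f : measurable_fun D (fun x => complex.Re (f x)) ->
  measurable_fun D (fun x => complex.Im (f x)) ->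
  leb.-integrable D (EFin \o (fun x => nC (f x) ^+ 2)) -> inL2 a b f.
Proof.
move=> m1 m2 /integrableP[_].
by under eq_integral do rewrite /= ger0_norm ?sqr_ge0//.
Qed.

Lemma inL2_L1 f : inL2 a b f -> inL1 f.
Proof.
move=> hf; have [m1 m2 _] := hf.
have I1 : leb.-integrable D (EFin \o (fun x => 1 + nC (f x) ^+ 2)).
  apply: integrableD_R; last exact: inL2_integrable.
  by apply: (@bounded_integrable _ 1) => // x _; rewrite normr1.
have key x (r : R) : `|r| <= nC (f x) -> (`|r%:E| <= `|(1 + nC (f x) ^+ 2)%:E|)%E.
  move=> hr; rewrite /= lee_fin (le_trans hr)//.
  rewrite ger0_norm ?addr_ge0 ?sqr_ge0//.
  by rewrite -subr_ge0; nra.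
split.
  apply: le_integrable I1 => //; first exact/measurable_EFinP.
  by move=> x _; apply: key; exact: normr_Re_le.
apply: le_integrable I1 => //; first exact/measurable_EFinP.
by move=> x _; apply: key; exact: normr_Im_le.
Qed.

Lemma cReD (x y : R[i]) : complex.Re (x + y) = complex.Re x + complex.Re y.
Proof. by case: x; case: y. Qed.
Lemma cImD (x y : R[i]) : complex.Im (x + y) = complex.Im x + complex.Im y.
Proof. by case: x; case: y. Qed.
Lemma cReB (x y : R[i]) : complex.Re (x - y) = complex.Re x - complex.Re y.
Proof. by case: x; case: y. Qed.
Lemma cImB (x y : R[i]) : complex.Im (x - y) = complex.Im x - complex.Im y.
Proof. by case: x; case: y. Qed.
Lemma cReM (x y : R[i]) : complex.Re (x * y) =
  complex.Re x * complex.Re y - complex.Im x * complex.Im y.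
Proof. by case: x; case: y. Qed.
Lemma cImM (x y : R[i]) : complex.Im (x * y) =
  complex.Re x * complex.Im y + complex.Im x * complex.Re y.
Proof. by case: x; case: y. Qed.

Lemma complex_ext (x y : R[i]) : complex.Re x = complex.Re y ->
  complex.Im x = complex.Im y -> x = y.
Proof. by case: x; case: y => ? ? ? ? /= -> ->. Qed.

Lemma L1D f g : inL1 f -> inL1 g -> inL1 (fun x => f x + g x).
Proof.
move=> [f1 f2] [g1 g2]; split.
  under [X in EFin \o X]eq_fun do rewrite cReD.
  exact: (integrableD_R f1 g1).
under [X in EFin \o X]eq_fun do rewrite cImD.
exact: (integrableD_R f2 g2).
Qed.

Lemma integrableM_bounded (u v : R -> R) B :
  leb.-integrable D (EFin \o u) -> measurable_fun D v ->
  (forall x, a <= x <= b -> `|v x| <= B) ->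
  leb.-integrable D (EFin \o (fun x => u x * v x)).
Proof.
move=> iu mv hB.
have i2 := integrableZ_R `|B| iu.
apply: le_integrable i2 => //.
  apply/measurable_EFinP; apply: measurable_funM => //.
  by case/integrableP : iu => /measurable_EFinP.
move=> x Dx /=; rewrite lee_fin normrM [leRHS]normrM normr_id mulrC.
by rewrite ler_wpM2r// (le_trans (hB _ (DE Dx)))// ler_norm.
Qed.

Lemma L1M f g : inL1 f -> bmeas g -> inL1 (fun x => f x * g x).
Proof.
move=> [f1 f2] [m1 m2 [B hB]].
have h1 x : a <= x <= b -> `|complex.Re (g x)| <= B.
  by move=> /hB; apply: le_trans; exact: normr_Re_le.
have h2 x : a <= x <= b -> `|complex.Im (g x)| <= B.
  by move=> /hB; apply: le_trans; exact: normr_Im_le.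
split.
  under [X in EFin \o X]eq_fun do rewrite cReM.
  exact: (integrableB_R (integrableM_bounded f1 m1 h1)
                            (integrableM_bounded f2 m2 h2)).
under [X in EFin \o X]eq_fun do rewrite cImM.
exact: (integrableD_R (integrableM_bounded f1 m2 h2)
                          (integrableM_bounded f2 m1 h1)).
Qed.

Lemma bmeas_cst k : bmeas (fun=> k).
Proof. by split; [exact: measurable_cst|exact: measurable_cst|exists (nC k)]. Qed.

Lemma L1Z k f : inL1 f -> inL1 (fun x => k * f x).
Proof.
move=> hf; under [X in inL1 X]eq_fun do rewrite mulrC.
exact: L1M (bmeas_cst k).
Qed.

Lemma L1B f g : inL1 f -> inL1 g -> inL1 (fun x => f x - g x).
Proof.
move=> hf hg; under [X in inL1 X]eq_fun do rewrite -mulN1r.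
by apply: L1D => //; exact: L1Z.
Qed.

Lemma bmeasD f g : bmeas f -> bmeas g -> bmeas (fun x => f x + g x).
Proof.
move=> [f1 f2 [B hB]] [g1 g2 [C hC]]; split.
- by under [X in measurable_fun _ X]eq_fun do rewrite cReD; exact: measurable_funD.
- by under [X in measurable_fun _ X]eq_fun do rewrite cImD; exact: measurable_funD.
exists (B + C) => x hx; rewrite (le_trans (nCD _ _))// lerD ?hB ?hC//.
Qed.

Lemma bmeasM f g : bmeas f -> bmeas g -> bmeas (fun x => f x * g x).
Proof.
move=> [f1 f2 [B hB]] [g1 g2 [C hC]]; split.
- under [X in measurable_fun _ X]eq_fun do rewrite cReM.
  by apply: measurable_funB; exact: measurable_funM.
- under [X in measurable_fun _ X]eq_fun do rewrite cImM.
  by apply: measurable_funD; exact: measurable_funM.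
exists (B * C) => x hx; rewrite nCM ler_pM ?nC_ge0 ?hB ?hC//.
Qed.

Lemma bmeasZ k f : bmeas f -> bmeas (fun x => k * f x).
Proof. by apply: bmeasM; exact: bmeas_cst. Qed.

Lemma bmeasB f g : bmeas f -> bmeas g -> bmeas (fun x => f x - g x).
Proof.
move=> hf hg; under [X in bmeas X]eq_fun do rewrite -mulN1r.
by apply: bmeasD => //; exact: bmeasZ.
Qed.

Lemma bmeasX n f : bmeas f -> bmeas (fun x => f x ^+ n).
Proof.
move=> hf; elim: n => [|n IH].
  by under [X in bmeas X]eq_fun do rewrite expr0; exact: bmeas_cst.
by under [X in bmeas X]eq_fun do rewrite exprS; exact: bmeasM.
Qed.

Lemma bmeas_sum (I : Type) (s : seq I) (F : I -> R -> R[i]) :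
  (forall i, bmeas (F i)) -> bmeas (fun x => \sum_(i <- s) F i x).
Proof.
move=> hF; elim: s => [|i s IH].
  by under [X in bmeas X]eq_fun do rewrite big_nil; exact: bmeas_cst.
by under [X in bmeas X]eq_fun do rewrite big_cons; exact: bmeasD.
Qed.

Lemma bmeas_L2 f : bmeas f -> inL2 a b f.
Proof.
move=> [m1 m2 [B hB]]; apply: inL2_of_integrable => //.
apply: (@bounded_integrable _ (B ^+ 2)); first exact: measurable_nC2.
move=> x hx; rewrite ger0_norm ?sqr_ge0// ler_sqr ?nnegrE ?nC_ge0 ?hB//.
by rewrite (le_trans (nC_ge0 (f x)))// hB.
Qed.

Lemma eq_cint f g : (forall x, a <= x <= b -> f x = g x) ->
  cintegral a b f = cintegral a b g.
Proof.
move=> fg; rewrite /cintegral; congr (_ +i* _);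
  by apply: eq_Rintegral => x /set_mem /DE /fg ->.
Qed.

Lemma cintD f g : inL1 f -> inL1 g ->
  cintegral a b (fun x => f x + g x) = cintegral a b f + cintegral a b g.
Proof.
move=> [f1 f2] [g1 g2]; apply: complex_ext => /=.
  by under eq_Rintegral do rewrite cReD; rewrite RintegralD.
by under eq_Rintegral do rewrite cImD; rewrite RintegralD.
Qed.

Lemma cintZ k f : inL1 f ->
  cintegral a b (fun x => k * f x) = k * cintegral a b f.
Proof.
move=> [f1 f2]; case: k => u v; apply: complex_ext => /=.
  under eq_Rintegral do rewrite cReM /=.
  rewrite RintegralB//; first by rewrite !RintegralZl.
  - exact: (integrableZ_R u f1).
  - exact: (integrableZ_R v f2).
under eq_Rintegral do rewrite cImM /=.
rewrite RintegralD//; first by rewrite !RintegralZl.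
- exact: (integrableZ_R u f2).
- exact: (integrableZ_R v f1).
Qed.

(** The factor 2 comes from estimating the real and the imaginary part
    separately. *)
Lemma cint_le f K : inL1 f -> (forall x, a <= x <= b -> nC (f x) <= K) ->
  nC (cintegral a b f) <= 2 * (b - a) * K.
Proof.
move=> [f1 f2] hK.
have key (u : R -> R) : leb.-integrable D (EFin \o u) ->
    (forall x, a <= x <= b -> `|u x| <= K) ->
    `|Rintegral leb D u| <= (b - a) * K.
  move=> iu hu; have h := @le_normr_Rintegral _ _ _ leb D u measD iu.
  apply: (le_trans h).
  have -> : (b - a) * K = Rintegral leb D (fun=> K).
    rewrite (@Rintegral_cst _ _ _ leb D measD K) mulrC; congr (_ * _).
    exact: (esym (congr1 fine lebD)).
  have iK : leb.-integrable D (EFin \o (fun=> K)).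
    by apply: (@bounded_integrable _ `|K|).
  have iu' := @integrable_norm _ _ _ leb _ _ iu.
  by apply: (@le_Rintegral _ _ _ leb D _ _ measD iu' iK) => x /DE; exact: hu.
apply: le_trans (nC_le_ReIm _) _; rewrite -mulrA mulr2n mulrDl mul1r /=.
apply: lerD; apply: key => // x /hK; apply: le_trans;
  [exact: normr_Re_le|exact: normr_Im_le].
Qed.

End complex_integral.

Section fourier_coefficients.
Variables (R : realType) (a b : R) (hab : a < b).
Implicit Types (f g : R -> R[i]) (k : R[i]) (l : int).
Local Notation leb := (@lebesgue_measure R).
Local Notation D := (`[a, b]%classic : set R).

Definition fexp l (x : R) : R[i] := expi (mu a b l * (x - a)).

Lemma muD l l' : mu a b (l + l') = mu a b l + mu a b l'.
Proof. by rewrite /mu intrD mulrDr mulrDl. Qed.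

Lemma muN l : mu a b (- l) = - mu a b l.
Proof. by rewrite /mu intrN mulrN mulNr. Qed.

Lemma fexpD l l' x : fexp (l + l') x = fexp l x * fexp l' x.
Proof. by rewrite /fexp muD mulrDl expiD. Qed.

Lemma fexp0 x : fexp 0 x = 1.
Proof. by rewrite /fexp /mu mulr0 mul0r mul0r expi0. Qed.

Lemma fexpN l x : fexp (- l) x = conjc (fexp l x).
Proof. by rewrite /fexp muN mulNr expiN. Qed.

Lemma nC_fexp l x : nC (fexp l x) = 1.
Proof. exact: nC_expi. Qed.

Lemma fcoefE f l : fcoef a b f l =
  ((b - a)^-1)%:C * cintegral a b (fun x => f x * fexp (- l) x).
Proof. by rewrite /fcoef; under [in RHS]eq_fun do rewrite /fexp muN mulNr. Qed.

Lemma continuous_phase (th : R) : continuous (fun x : R => th * (x - a)).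
Proof.
move=> x; apply: cvgM; first exact: cvg_cst.
by apply: cvgB; [exact: cvg_id|exact: cvg_cst].
Qed.

Lemma bmeas_fexp l : bmeas a b (fexp l).
Proof.
have c1 := @continuous_phase (mu a b l).
split.
- apply: (measurable_funS measurableT) => //.
  apply: continuous_measurable_fun => x.
  exact: (continuous_comp (c1 x) (@continuous_cos R _)).
- apply: (measurable_funS measurableT) => //.
  apply: continuous_measurable_fun => x.
  exact: (continuous_comp (c1 x) (@continuous_sin R _)).
by exists 1 => x _; rewrite nC_fexp.
Qed.

Lemma fcoef_eq f g l : (forall x, a <= x <= b -> f x = g x) ->
  fcoef a b f l = fcoef a b g l.
Proof.
by move=> fg; rewrite !fcoefE; congr (_ * _); apply: eq_cint => x /fg ->.
Qed.

Lemma fcoefD f g l : inL1 a b f -> inL1 a b g ->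
  fcoef a b (fun x => f x + g x) l = fcoef a b f l + fcoef a b g l.
Proof.
move=> hf hg; rewrite !fcoefE -mulrDr -cintD//; last 2 first.
- by apply: L1M => //; exact: bmeas_fexp.
- by apply: L1M => //; exact: bmeas_fexp.
by congr (_ * _); apply: eq_cint => x _; rewrite mulrDl.
Qed.

Lemma fcoefZ k f l : inL1 a b f ->
  fcoef a b (fun x => k * f x) l = k * fcoef a b f l.
Proof.
move=> hf; rewrite !fcoefE [RHS]mulrCA; congr (_ * _); rewrite -cintZ//.
  by apply: eq_cint => x _; rewrite mulrA.
by apply: L1M => //; exact: bmeas_fexp.
Qed.

Lemma fcoefN f l : inL1 a b f ->
  fcoef a b (fun x => - f x) l = - fcoef a b f l.
Proof.
move=> hf; rewrite -mulN1r -fcoefZ//.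
by apply: fcoef_eq => x _; rewrite mulN1r.
Qed.

Lemma fcoefB f g l : inL1 a b f -> inL1 a b g ->
  fcoef a b (fun x => f x - g x) l = fcoef a b f l - fcoef a b g l.
Proof.
move=> hf hg; rewrite -mulN1r -fcoefZ// -fcoefD//; last exact: L1Z.
by apply: fcoef_eq => x _; rewrite mulN1r.
Qed.

Lemma fcoef_sum (I : Type) (s : seq I) (F : I -> R -> R[i]) l :
  (forall i, bmeas a b (F i)) ->
  fcoef a b (fun x => \sum_(i <- s) F i x) l = \sum_(i <- s) fcoef a b (F i) l.
Proof.
move=> hF; elim: s => [|i s IH].
  rewrite big_nil -[RHS](mul0r (fcoef a b (fun=> 1) l)) -fcoefZ.
    by apply: fcoef_eq => x _; rewrite big_nil mul0r.
  by apply: bmeas_L1 => //; exact: bmeas_cst.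
rewrite big_cons -IH -fcoefD; last 2 first.
- exact: bmeas_L1.
- by apply: bmeas_L1 => //; exact: bmeas_sum.
by apply: fcoef_eq => x _; rewrite big_cons.
Qed.

Lemma fcoef_le f K l : inL1 a b f -> (forall x, a <= x <= b -> nC (f x) <= K) ->
  nC (fcoef a b f l) <= 2 * K.
Proof.
move=> hf hK; rewrite fcoefE nCM nC_real.
have ba : 0 < b - a by rewrite subr_gt0.
have ba' : 0 <= (b - a)^-1 by rewrite invr_ge0 ltW.
rewrite (ger0_norm ba').
have h : nC (cintegral a b (fun x => f x * fexp (- l) x)) <= 2 * (b - a) * K.
  apply: cint_le => //; first by apply: L1M => //; exact: bmeas_fexp.
  by move=> x hx; rewrite nCM nC_fexp mulr1 hK.
apply: (@le_trans _ _ ((b - a)^-1 * (2 * (b - a) * K))).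
  by rewrite ler_wpM2l.
by rewrite [2 * _]mulrC -mulrA mulKf ?gt_eqF.
Qed.

Lemma fcoef_shift f l l' :
  fcoef a b (fun x => fexp l x * f x) l' = fcoef a b f (l' - l).
Proof.
rewrite !fcoefE; congr (_ * _); apply: eq_cint => x _.
by rewrite opprB fexpD; ring.
Qed.

Lemma fcoef_conj f l : fcoef a b (fun x => conjc (f x)) l = conjc (fcoef a b f (- l)).
Proof.
rewrite !fcoefE opprK rmorphM /=; congr (_ * _).
  by rewrite oppr0.
rewrite /cintegral; apply: complex_ext => /=.
  apply: eq_Rintegral => x _; rewrite fexpN.
  by case: (f x) => ? ?; case: (fexp l x) => ? ? /=; rewrite mulrN mulNr opprK.
rewrite -[RHS]mulN1r.
have -> : forall u : R -> R, -1 * Rintegral leb D u = Rintegral leb D (fun x => - u x).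
  move=> u; rewrite mulN1r /Rintegral.
  have -> : (\int[leb]_(x in D) (- u x)%:E = \int[leb]_(x in D) (- (u x)%:E))%E.
    by apply: eq_integral => x _; rewrite EFinN.
  rewrite [in RHS]integralE [in LHS]integralE funeposN funenegN.
  case: (\int[leb]_(x in D) ((fun x => (u x)%:E)^\+ x))%E => [p| |];
  case: (\int[leb]_(x in D) ((fun x => (u x)%:E)^\- x))%E => [q| |] //=;
    by rewrite ?opprB ?oppr0.
apply: eq_Rintegral => x _; rewrite fexpN.
by case: (f x) => ? ?; case: (fexp l x) => ? ? /=; rewrite mulrN mulNr opprD.
Qed.

End fourier_coefficients.

(** * Absolutely convergent Fourier series *)

Definition lowseq (N : nat) : seq int :=
  [seq k%:Z - N%:Z | k <- iota 0 N.*2.+1].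

Arguments lowseq : simpl never.

Lemma lowseq_uniq N : uniq (lowseq N).
Proof. by rewrite map_inj_uniq ?iota_uniq// => i j; lia. Qed.

Lemma mem_lowseq N l : (l \in lowseq N) = (`|l| <= N)%N.
Proof.
apply/mapP/idP => [[k]|lN].
  by rewrite mem_iota /= => kN ->; lia.
by exists (`|(l + N%:Z)%R|%N); rewrite ?mem_iota; lia.
Qed.

Section smooth_integrals.
Variables (R : realType) (a b : R) (hab : a < b).
Local Notation leb := (@lebesgue_measure R).

Lemma expi_2pi : expi (2 * pi) = 1 :> R[i].
Proof. by rewrite mulrDl mul1r expiD /expi cospi sinpi; apply: complex_ext => /=; ring. Qed.

Lemma expi_2pi_int (l : int) : expi (2 * pi * l%:~R) = 1 :> R[i].
Proof.
case: l => n; first by rewrite mulrC expi_nat expi_2pi expr1n.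
by rewrite NegzE intrN mulrN expiN mulrC expi_nat expi_2pi expr1n conjc1.
Qed.

Lemma FTC_smooth (f F : R -> R) : continuous f ->
  (forall x : R, is_derive x 1 F (f x)) ->
  Rintegral leb `[a, b] f = F b - F a.
Proof.
move=> cf dF; rewrite /Rintegral (@continuous_FTC2 _ f F)//.
- exact: continuous_subspaceT.
- have cF : continuous F.
    by move=> x; apply: differentiable_continuous; apply/derivable1_diffP; case: (dF x).
  split.
  + by move=> x _; case: (dF x).
  + exact: cvg_at_right_filter (cF a).
  + exact: cvg_at_left_filter (cF b).
- by move=> x _; rewrite derive1E; apply: derive_val.
Qed.

End smooth_integrals.

Section wiener_algebra.
Variables (R : realType) (a b : R) (hab : a < b).
Implicit Types (f g : R -> R[i]) (c d : int -> R[i]) (l : int).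
Local Notation leb := (@lebesgue_measure R).

Definition tpoly c (N : nat) (x : R) : R[i] :=
  \sum_(l <- lowseq N) c l * fexp a b l x.

(** Membership in the Wiener algebra, with the coefficients as data: it transports
    bounds between functions and coefficients without any regularity of [f]. *)
Definition inA f c : Prop :=
  (exists B, bsum (fun l => nC (c l)) B) /\
  (forall e : R, 0 < e -> exists N0 : nat, forall N, (N0 <= N)%N ->
     forall x, a <= x <= b -> nC (f x - tpoly c N x) <= e).

Lemma bmeas_tpoly c N : bmeas a b (tpoly c N).
Proof. by apply: bmeas_sum => l; apply: bmeasZ; exact: bmeas_fexp. Qed.

Lemma nC_tpolyB c N M x : (N <= M)%N ->
  nC (tpoly c M x - tpoly c N x) <=
  \sum_(l <- lowseq M | l \notin lowseq N) nC (c l).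
Proof.
move=> NM; rewrite /tpoly [X in X - _](bigID (fun l => l \in lowseq N)) /=.
rewrite -[X in X + _ - _]big_filter.
have -> : \sum_(l <- [seq l <- lowseq M | l \in lowseq N]) c l * fexp a b l x =
          \sum_(l <- lowseq N) c l * fexp a b l x.
  apply: perm_big; apply: uniq_perm.
  - by rewrite filter_uniq// lowseq_uniq.
  - exact: lowseq_uniq.
  move=> l; rewrite mem_filter !mem_lowseq; case: leqP => //= h.
  by rewrite (leq_trans h).
rewrite addrAC subrr add0r; apply: le_trans (nC_sum _ _ _) _.
by apply: ler_sum => l _; rewrite nCM nC_fexp mulr1.
Qed.

Lemma tpoly_cauchy c B (e : R) : bsum (fun l => nC (c l)) B -> 0 < e ->
  exists N0 : nat, forall N M x, (N0 <= N)%N -> (N <= M)%N ->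
    nC (tpoly c M x - tpoly c N x) <= e.
Proof.
move=> hc e0.
have [N0 hN0] := bsum_int_tail (fun l => nC_ge0 (c l)) hc e0.
exists N0 => N M x NN NM; apply: le_trans (nC_tpolyB c x NM) _.
rewrite -big_filter; apply: hN0; first by rewrite filter_uniq// lowseq_uniq.
by move=> l; rewrite mem_filter !mem_lowseq; lia.
Qed.

Lemma cauchy_lim (u : nat -> R) :
  (forall e : R, 0 < e -> exists N0 : nat, forall N M, (N0 <= N)%N -> (N <= M)%N ->
    `|u M - u N| <= e) ->
  forall (N : nat) (e : R), (forall M, (N <= M)%N -> `|u M - u N| <= e) ->
    `|limn u - u N| <= e.
Proof.
move=> hu N e he.
have cu : cvgn u.
  apply/cauchy_cvgP; apply: cauchy_exP => d d0.
  have [N0 hN0] := hu (d / 2) ltac:(by apply: divr_gt0).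
  exists (u N0); exists N0 => // M NM /=.
  rewrite /ball /= distrC; apply: le_lt_trans (hN0 _ _ (leqnn _) NM) _.
  by rewrite ltr_pdivrMr// ltr_pMr// ltr1n.
rewrite ler_distl; apply/andP; split.
  apply: limr_ge => //; exists N => // M NM /=.
  by have := he _ NM; rewrite ler_distl => /andP[].
apply: limr_le => //; exists N => // M NM /=.
by have := he _ NM; rewrite ler_distl => /andP[].
Qed.

Lemma fseriesE c x : fseries a b c x =
  limn (fun N => complex.Re (tpoly c N x)) +i* limn (fun N => complex.Im (tpoly c N x)).
Proof.
rewrite /fseries.
have E N : \sum_(k < N.*2.+1)
       c (k%:Z - N%:Z) * expi (mu a b (k%:Z - N%:Z) * (x - a)) = tpoly c N x.
  rewrite /tpoly /lowseq big_map -[in RHS](subn0 N.*2.+1) -/(index_iota 0 _).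
  by rewrite big_mkord.
by congr (_ +i* _); congr (limn _); apply/funext => N; rewrite E.
Qed.

Lemma fseries_inA c B : bsum (fun l => nC (c l)) B -> inA (fseries a b c) c.
Proof.
move=> hc; split; first by exists B.
move=> e e0; have e2 : 0 < e / 2 by apply: divr_gt0.
have [N0 hN0] := tpoly_cauchy hc e2.
exists N0 => N NN x _; rewrite fseriesE; apply: le_trans (nC_le_ReIm _) _.
rewrite [leRHS](splitr e) cReB cImB /=; apply: lerD.
  apply: (@cauchy_lim (fun N => complex.Re (tpoly c N x))) => [e' /(tpoly_cauchy hc)|M NM].
    move=> [M0 hM0]; exists M0 => M M' h1 h2.
    by rewrite -cReB; apply: le_trans (normr_Re_le _) _; exact: hM0.
  by rewrite -cReB; apply: le_trans (normr_Re_le _) _; exact: hN0.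
apply: (@cauchy_lim (fun N => complex.Im (tpoly c N x))) => [e' /(tpoly_cauchy hc)|M NM].
  move=> [M0 hM0]; exists M0 => M M' h1 h2.
  by rewrite -cImB; apply: le_trans (normr_Im_le _) _; exact: hM0.
by rewrite -cImB; apply: le_trans (normr_Im_le _) _; exact: hN0.
Qed.

Lemma inA_cvg f c x : inA f c -> a <= x <= b ->
  (forall e : R, 0 < e -> \forall N \near \oo, nC (f x - tpoly c N x) <= e)%classic.
Proof.
by move=> [_ h] hx e /h[N0 hN0]; exists N0 => // N NN; exact: hN0.
Qed.

Lemma inA_cvgRe f c x : inA f c -> a <= x <= b ->
  ((fun N => complex.Re (tpoly c N x)) @ \oo --> complex.Re (f x))%classic.
Proof.
move=> hf hx; apply/cvgrPdist_le => e e0.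
near=> N; rewrite -cReB; apply: le_trans (normr_Re_le _) _.
near: N; exact: inA_cvg.
Unshelve. all: by end_near. Qed.

Lemma inA_cvgIm f c x : inA f c -> a <= x <= b ->
  ((fun N => complex.Im (tpoly c N x)) @ \oo --> complex.Im (f x))%classic.
Proof.
move=> hf hx; apply/cvgrPdist_le => e e0.
near=> N; rewrite -cImB; apply: le_trans (normr_Im_le _) _.
near: N; exact: inA_cvg.
Unshelve. all: by end_near. Qed.

Lemma nC_tpoly_le c B N x : bsum (fun l => nC (c l)) B -> nC (tpoly c N x) <= B.
Proof.
move=> hc; apply: le_trans (nC_sum _ _ _) _.
under eq_bigr do rewrite nCM nC_fexp mulr1.
by apply: hc; exact: lowseq_uniq.
Qed.

Lemma le_by_eps (x y C : R) : 0 <= C ->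
  (forall e, 0 < e -> x <= y + C * e) -> x <= y.
Proof.
move=> C0 h; apply/ler_addgt0Pr => e e0.
have h2 : 0 < e / (C + 1) by rewrite divr_gt0// ltr_wpDl.
apply: le_trans (h _ h2) _; rewrite lerD2l mulrCA ler_piMr ?ltW//.
by rewrite ltr_pdivrMr ?ltr_wpDl// mul1r ltrDl.
Qed.

Lemma inA_le f c B x : inA f c -> bsum (fun l => nC (c l)) B ->
  a <= x <= b -> nC (f x) <= B.
Proof.
move=> [_ hf] hc hx; apply: (@le_by_eps _ _ 1) => // e /hf[N hN].
rewrite mul1r -[f x](subrK (tpoly c N x)) addrC; apply: le_trans (nCD _ _) _.
by apply: lerD; [exact: nC_tpoly_le|exact: hN].
Qed.

Lemma inA_bmeas f c : inA f c -> bmeas a b f.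
Proof.
move=> hf; have [[B hB] _] := hf; split.
- apply: (@measurable_fun_cvg _ _ R _ (fun N x => complex.Re (tpoly c N x))).
    by move=> N; case: (bmeas_tpoly c N).
  by move=> x /DE hx; exact: inA_cvgRe.
- apply: (@measurable_fun_cvg _ _ R _ (fun N x => complex.Im (tpoly c N x))).
    by move=> N; case: (bmeas_tpoly c N).
  by move=> x /DE hx; exact: inA_cvgIm.
by exists B => x hx; exact: inA_le hf hB hx.
Qed.

Lemma inA_eq f g c : (forall x, a <= x <= b -> f x = g x) -> inA f c -> inA g c.
Proof.
move=> fg [hc hf]; split => // e /hf[N0 hN0]; exists N0 => N NN x hx.
by rewrite -fg// hN0.
Qed.

Lemma inAD f g c d : inA f c -> inA g d ->
  inA (fun x => f x + g x) (fun l => c l + d l).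
Proof.
move=> [[B hc] hf] [[C hd] hg]; split.
  exists (B + C); apply: bsum_le (bsumD hc hd) => // l; exact: nCD.
move=> e e0; have e2 : 0 < e / 2 by rewrite divr_gt0.
have [N1 h1] := hf _ e2; have [N2 h2] := hg _ e2.
exists (maxn N1 N2) => N; rewrite geq_max => /andP[n1 n2] x hx.
have -> : tpoly (fun l => c l + d l) N x = tpoly c N x + tpoly d N x.
  by rewrite /tpoly -big_split; apply: eq_bigr => l _; rewrite mulrDl.
rewrite opprD addrACA (splitr e); apply: le_trans (nCD _ _) _.
by apply: lerD; [exact: h1|exact: h2].
Qed.

Lemma inAZ k f c : inA f c -> inA (fun x => k * f x) (fun l => k * c l).
Proof.
move=> [[B hc] hf]; split.
  by exists (nC k * B); apply: bsum_le (bsumZ (nC_ge0 k) hc) => // l; rewrite nCM.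
move=> e e0; have k1 : 0 < nC k + 1 by rewrite ltr_wpDl// nC_ge0.
have [N0 hN0] := hf _ (divr_gt0 e0 k1); exists N0 => N NN x hx.
have -> : tpoly (fun l => k * c l) N x = k * tpoly c N x.
  by rewrite /tpoly mulr_sumr; apply: eq_bigr => l _; rewrite mulrA.
rewrite -mulrBr nCM; apply: (@le_trans _ _ ((nC k + 1) * (e / (nC k + 1)))).
  by apply: ler_pM; rewrite ?nC_ge0 ?lerDl ?hN0.
by rewrite mulrC divfK// gt_eqF.
Qed.

Lemma inAB f g c d : inA f c -> inA g d ->
  inA (fun x => f x - g x) (fun l => c l - d l).
Proof.
move=> hf hg; have := inAD hf (inAZ (-1) hg).
under [X in inA X _]eq_fun do rewrite mulN1r.
by under [X in inA _ X]eq_fun do rewrite mulN1r.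
Qed.

Lemma tpoly_conj c N x : conjc (tpoly c N x) = tpoly (fun l => conjc (c (- l))) N x.
Proof.
rewrite /tpoly rmorph_sum /=.
rewrite [RHS](perm_big (map -%R (lowseq N))); last first.
  apply: uniq_perm; first exact: lowseq_uniq.
    by rewrite map_inj_uniq ?lowseq_uniq//; exact: oppr_inj.
  move=> l; rewrite -[in RHS](opprK l) mem_map; last exact: oppr_inj.
  by rewrite !mem_lowseq abszN.
by rewrite [RHS]big_map; apply: eq_bigr => l _; rewrite opprK rmorphM fexpN.
Qed.

Lemma inA_conj f c : inA f c -> inA (fun x => conjc (f x)) (fun l => conjc (c (- l))).
Proof.
move=> [[B hc] hf]; split.
  exists B; have := bsum_reindex (@oppr_inj int) hc.
  by apply: bsum_le => // l; rewrite nC_conj.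
move=> e /hf[N0 hN0]; exists N0 => N NN x hx.
by rewrite -tpoly_conj -rmorphB nC_conj hN0.
Qed.

Lemma inA_tpoly c N : inA (tpoly c N) (fun l => if (`|l| <= N)%N then c l else 0).
Proof.
split.
  exists (\sum_(l <- lowseq N) nC (c l)) => s us.
  rewrite (bigID (fun l : int => (`|l| <= N)%N)) /= [X in _ + X]big1 ?addr0; last first.
    by move=> l /negbTE ->; rewrite nC0.
  rewrite -big_filter.
  apply: (@le_trans _ _ (\sum_(l <- [seq l <- s | (`|l| <= N)%N]) nC (c l))).
    by rewrite !big_filter; apply: ler_sum => l ->.
  apply: sum_subset.
  - by move=> l; exact: nC_ge0.
  - exact: filter_uniq.
  - exact: lowseq_uniq.
  by move=> l; rewrite mem_filter mem_lowseq => /andP[].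
move=> e e0; exists N => M NM x hx.
suff -> : tpoly (fun l => if (`|l| <= N)%N then c l else 0) M x = tpoly c N x.
  by rewrite subrr nC0 ltW.
rewrite /tpoly (bigID (fun l : int => (`|l| <= N)%N)) /= [X in _ + X]big1 ?addr0; last first.
  by move=> l /negbTE ->; rewrite mul0r.
rewrite -big_filter.
transitivity (\sum_(l <- [seq l <- lowseq M | (`|l| <= N)%N]) c l * fexp a b l x).
  by rewrite !big_filter; apply: eq_bigr => l ->.
apply: perm_big; apply: uniq_perm.
- by rewrite filter_uniq// lowseq_uniq.
- exact: lowseq_uniq.
move=> l; rewrite mem_filter !mem_lowseq; case: leqP => //= h.
by rewrite (leq_trans h).
Qed.

(** The orthogonality of the exponentials follows with [fcoef_shift]. *)
Lemma fcoef1 l : fcoef a b (fun=> 1) l = (l == 0)%:R.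
Proof.
rewrite fcoefE; have ba : b - a != 0 by rewrite subr_eq0 gt_eqF.
have [->|l0] := eqVneq l 0.
  rewrite oppr0 /cintegral.
  have -> : Rintegral leb `[a, b] (fun x => complex.Re (1 * fexp a b 0 x)) = b - a.
    transitivity (Rintegral leb `[a, b] (fun x : R => 1 : R)).
      by apply: eq_Rintegral => x _; rewrite fexp0 mul1r.
    by apply: (@FTC_smooth _ a b hab (fun=> 1) id) => x; exact: cvg_cst.
  have -> : Rintegral leb `[a, b] (fun x => complex.Im (1 * fexp a b 0 x)) = 0.
    transitivity (Rintegral leb `[a, b] (fun x : R => 0 : R)).
      by apply: eq_Rintegral => x _; rewrite fexp0 mul1r.
    by rewrite (@FTC_smooth _ a b hab (fun=> 0) (fun=> 0)) ?subr0// => x; exact: cvg_cst.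
  by apply: complex_ext; rewrite /= ?mulr0 ?mul0r ?subr0 ?addr0// mulVf.
pose th := mu a b (- l).
have th0 : th != 0.
  rewrite /th /mu; apply: mulf_neq0; last by rewrite invr_eq0.
  apply: mulf_neq0; last by rewrite intr_eq0 oppr_eq0.
  by rewrite mulf_neq0 ?pnatr_eq0// gt_eqF// pi_gt0.
have thb : th * (b - a) = 2 * pi * (- l)%:~R by rewrite /th /mu divfK.
have cD (g : R -> R) : continuous g -> continuous (fun x : R => g (th * (x - a))).
  move=> cg x; apply: (@continuous_comp _ _ _ (fun x : R => th * (x - a)) g); last exact: cg.
  exact: continuous_phase.
have [ec es] : cos (th * (b - a)) = 1 /\ sin (th * (b - a)) = 0.
  by have := expi_2pi_int R (- l); rewrite -thb /expi => -[].
have -> : cintegral a b (fun x => 1 * fexp a b (- l) x) = 0.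
  rewrite (@eq_cint _ _ _ _ (fun x => expi (th * (x - a)))) => [|x _]; last by rewrite mul1r.
  apply: complex_ext.
    rewrite [LHS](@FTC_smooth _ a b hab (fun x => cos (th * (x - a))) (fun x => th^-1 * sin (th * (x - a)))).
    - by rewrite es subrr !mulr0 sin0 mulr0 subr0.
    - by apply: cD; exact: continuous_cos.
    - move=> x; apply: is_derive_eq.
      by rewrite /GRing.scale /=; field.
  rewrite [LHS](@FTC_smooth _ a b hab (fun x => sin (th * (x - a))) (fun x => - th^-1 * cos (th * (x - a)))).
  - by rewrite ec subrr !mulr0 cos0 subrr.
  - by apply: cD; exact: continuous_sin.
  - move=> x; apply: is_derive_eq.
    by rewrite /GRing.scale /=; field.
by rewrite mulr0.
Qed.

Lemma fcoef_tpoly c N l :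
  fcoef a b (tpoly c N) l = if (`|l| <= N)%N then c l else 0.
Proof.
rewrite fcoef_sum//; last by move=> k; apply: bmeasZ; exact: bmeas_fexp.
have E k : fcoef a b (fun x => c k * fexp a b k x) l = c k * (l == k)%:R.
  rewrite fcoefZ//; last by apply: bmeas_L1 => //; exact: bmeas_fexp.
  have -> : fcoef a b (fexp a b k) l = fcoef a b (fun x => fexp a b k x * 1) l.
    by apply: fcoef_eq => // x _; rewrite mulr1.
  by rewrite fcoef_shift// fcoef1 subr_eq0.
under eq_bigr do rewrite E.
case: ifPn => lN.
  rewrite (bigD1_seq l) ?mem_lowseq ?lowseq_uniq//= eqxx mulr1 big1 ?addr0// => k.
  by rewrite eq_sym => /negbTE ->; rewrite mulr0.
rewrite big_seq big1// => k; rewrite mem_lowseq.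
by case: eqVneq => [<-|]; rewrite ?mulr0// (negbTE lN).
Qed.

Lemma inA_fcoef f c l : inA f c -> fcoef a b f l = c l.
Proof.
move=> hf; have [_ h] := hf; apply/eqP; rewrite -subr_eq0; apply/eqP/nC_eq0.
apply/eqP; rewrite eq_le nC_ge0 andbT.
apply: (@le_by_eps _ _ 2) => // e /h[N0 hN0]; rewrite add0r.
pose N := maxn N0 `|l|%N.
have -> : c l = fcoef a b (tpoly c N) l by rewrite fcoef_tpoly leq_maxr.
have bm := inA_bmeas hf; have bt := bmeas_tpoly c N.
rewrite -fcoefB//; try exact: bmeas_L1.
apply: fcoef_le => //; first by apply: bmeas_L1 => //; exact: bmeasB.
by move=> x hx; apply: hN0; rewrite ?leq_maxl.
Qed.

(** Young's inequality for the convolution of the coefficients. Replacing [f] by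
    a partial sum of its series leaves finite convolutions only; the rest is small
    uniformly in [x] and disappears for fixed [s] as the partial sums converge. *)
Lemma young_weighted f g c (w : int -> R) (K B1 B2 : R) :
  inA f c -> bmeas a b g -> (forall l, 0 <= w l) ->
  0 <= K -> (forall k l, w (k + l) <= K * (w k * w l)) ->
  bsum (fun l => w l * nC (c l)) B1 ->
  bsum (fun l => w l * nC (fcoef a b g l)) B2 ->
  bsum (fun l => w l * nC (fcoef a b (fun x => f x * g x) l)) (K * (B1 * B2)).
Proof.
move=> hf hg w0 K0 hw h1 h2 s us.
have [_ h] := hf; have [_ _ [Bg hBg]] := hg.
have Bg0 : 0 <= `|Bg| by [].
pose W := \sum_(l <- s) w l.
have W0 : 0 <= W by rewrite sumr_ge0.
apply: (@le_by_eps _ _ (2 * `|Bg| * W)); first by rewrite !mulr_ge0.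
move=> e e0; have [N0 hN] := h _ e0; pose N := N0.
have bf := inA_bmeas hf; have bt := bmeas_tpoly c N.
have step l : nC (fcoef a b (fun x => f x * g x) l) <=
    \sum_(k <- lowseq N) nC (c k) * nC (fcoef a b g (l - k)) + 2 * (e * `|Bg|).
  have -> : fcoef a b (fun x => f x * g x) l =
      fcoef a b (fun x => tpoly c N x * g x) l +
      fcoef a b (fun x => (f x - tpoly c N x) * g x) l.
    rewrite -fcoefD//; first by apply: fcoef_eq => // x _; ring.
      by apply: bmeas_L1 => //; exact: bmeasM.
    by apply: bmeas_L1 => //; apply: bmeasM => //; exact: bmeasB.
  apply: le_trans (nCD _ _) _; apply: lerD; last first.
    apply: fcoef_le => //.
      by apply: bmeas_L1 => //; apply: bmeasM => //; exact: bmeasB.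
    move=> x hx; rewrite nCM; apply: ler_pM; rewrite ?nC_ge0//; first exact: hN.
    by apply: le_trans (hBg _ hx) _; exact: ler_norm.
  have -> : fcoef a b (fun x => tpoly c N x * g x) l =
     \sum_(k <- lowseq N) c k * fcoef a b g (l - k).
    transitivity (fcoef a b (fun x => \sum_(k <- lowseq N) c k * (fexp a b k x * g x)) l).
      apply: fcoef_eq => // x _; rewrite mulr_suml; apply: eq_bigr => k _.
      by rewrite mulrA.
    have bg k : bmeas a b (fun x => fexp a b k x * g x).
      by apply: bmeasM => //; exact: bmeas_fexp.
    rewrite fcoef_sum//; last by move=> k; exact: bmeasZ.
    by apply: eq_bigr => k _; rewrite fcoefZ ?fcoef_shift//; exact: bmeas_L1.
  apply: le_trans (nC_sum _ _ _) _; apply: ler_sum => k _; by rewrite nCM.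
apply: (@le_trans _ _ (\sum_(l <- s) (\sum_(k <- lowseq N)
   K * (w k * nC (c k) * (w (l - k) * nC (fcoef a b g (l - k)))) +
   2 * (e * `|Bg|) * w l))).
  apply: ler_sum => l _; apply: le_trans (ler_wpM2l (w0 l) (step l)) _.
  rewrite mulrDr [w l * (2 * _)]mulrC lerD2r mulr_sumr; apply: ler_sum => k _.
  have := hw k (l - k); rewrite addrC subrK => hk.
  have nn : 0 <= nC (c k) * nC (fcoef a b g (l - k)) by rewrite mulr_ge0 ?nC_ge0.
  apply: le_trans (ler_wpM2r nn hk) _; rewrite le_eqVlt; apply/orP; left.
  by apply/eqP; ring.
rewrite big_split /= -mulr_sumr -/W; apply: lerD; last first.
  by rewrite le_eqVlt; apply/orP; left; apply/eqP; ring.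
rewrite exchange_big /=.
apply: (@le_trans _ _ (\sum_(k <- lowseq N) K * (w k * nC (c k)) * B2)).
  apply: ler_sum => k _.
  have -> : \sum_(l <- s) K * (w k * nC (c k) * (w (l - k) * nC (fcoef a b g (l - k)))) =
    K * (w k * nC (c k)) * \sum_(l <- s) (w (l - k) * nC (fcoef a b g (l - k))).
    by rewrite mulr_sumr; apply: eq_bigr => l _; ring.
  apply: ler_wpM2l; first by rewrite !mulr_ge0 ?nC_ge0.
  by have := bsum_reindex (@addIr int (- k)) h2; exact.
rewrite -mulr_suml -mulr_sumr -mulrA; apply: ler_wpM2l => //.
apply: ler_wpM2r; first exact: bsum_ge0 h2.
by apply: h1; exact: lowseq_uniq.
Qed.

End wiener_algebra.

(** * Fourier series of continuous functions *)

Section fourier_uniqueness.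
Variables (R : realType) (a b : R) (hab : a < b).
Local Notation leb := (@lebesgue_measure R).
Implicit Types (f : R -> R[i]) (g : R -> R).

Definition contD g : Prop := forall x, a <= x <= b -> forall e, 0 < e ->
  exists2 d, 0 < d & forall y, a <= y <= b -> `|y - x| <= d -> `|g y - g x| <= e.

Lemma contD_within g : contD g -> {within `[a, b], continuous g}%classic.
Proof.
move=> cg; apply/subspace_continuousP => x /DE hx.
apply/cvgrPdist_le => e e0; have [d d0 hd] := cg x hx e e0.
apply/nbhs_ballP; exists d => //= y; rewrite /ball /= => hy Dy.
by rewrite distrC hd ?(DE Dy)// distrC ltW.
Qed.

Lemma contD_bmeas g : contD g -> bmeas a b (toC g).
Proof.
move=> /contD_within cg; split.
- exact: subspace_continuous_measurable_fun.
- by under [X in measurable_fun _ X]eq_fun do rewrite /toC /=; exact: measurable_cst.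
have [x1 _ h1] := EVT_max (ltW hab) cg.
have [x2 _ h2] := EVT_min (ltW hab) cg.
exists (`|g x1| + `|g x2|) => x hx; rewrite nC_real.
have := h1 x; have := h2 x; rewrite in_itv /= => /(_ hx) q2 /(_ hx) q1.
rewrite ler_norml; apply/andP; split.
  have := ler_norm (- g x2); rewrite normrN; have : 0 <= `|g x1| by []; lra.
have := ler_norm (g x1); have : 0 <= `|g x2| by []; lra.
Qed.

Lemma contD_const (k : R) : contD (fun=> k).
Proof. by move=> x hx e e0; exists 1 => // y _ _; rewrite subrr normr0 ltW. Qed.

Lemma contDN g : contD g -> contD (fun x => - g x).
Proof.
move=> cg x hx e /(cg x hx)[d d0 hd]; exists d => // y hy yx.
by rewrite -opprD normrN hd.
Qed.

Lemma contDB g h : contD g -> contD h -> contD (fun x => g x - h x).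
Proof.
move=> cg ch x hx e e0; have e2 : 0 < e / 2 by rewrite divr_gt0.
have [d1 d10 h1] := cg x hx _ e2; have [d2 d20 h2] := ch x hx _ e2.
exists (Num.min d1 d2); first by rewrite lt_min d10.
move=> y hy; rewrite le_min => /andP[y1 y2].
have -> : g y - h y - (g x - h x) = (g y - g x) - (h y - h x) by ring.
apply: le_trans (ler_normB _ _) _; rewrite (splitr e).
by apply: lerD; [exact: h1|exact: h2].
Qed.

Lemma contD_expi (th : R) : contD (fun x => cos (th * (x - a))) /\
  contD (fun x => sin (th * (x - a))).
Proof.
have c1 := @continuous_phase R a th.
have key (u : R -> R) : continuous u -> contD u.
  move=> cu x hx e e0; have /cvgrPdist_le/(_ e e0)/nbhs_ballP[d d0 hd] := cu x.
  exists (d / 2); first by rewrite divr_gt0.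
  move=> y _ yx; rewrite distrC; apply: hd; rewrite /ball /= distrC.
  by apply: le_lt_trans yx _; rewrite ltr_pdivrMr// ltr_pMr// ltr1n.
split; apply: key => x.
  exact: (continuous_comp (c1 x) (@continuous_cos R _)).
exact: (continuous_comp (c1 x) (@continuous_sin R _)).
Qed.

(** A trigonometric polynomial that is maximal at [x0] and smaller elsewhere: its
    powers concentrate at [x0] and stay trigonometric polynomials. *)
Definition kern (x0 x : R) : R := (1 + cos (2 * pi / (b - a) * (x - x0))) / 2.

Lemma mu1 : mu a b 1 = 2 * pi / (b - a).
Proof. by rewrite /mu mulr1. Qed.

Lemma kernE x0 x : (kern x0 x)%:C = (2^-1)%:C +
  (4^-1)%:C * conjc (fexp a b 1 x0) * fexp a b 1 x +
  (4^-1)%:C * fexp a b 1 x0 * fexp a b (-1) x.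
Proof.
rewrite fexpN /fexp /kern mu1 /expi.
have -> : 2 * pi / (b - a) * (x - x0) =
  2 * pi / (b - a) * (x - a) - 2 * pi / (b - a) * (x0 - a) by ring.
by rewrite cosB; apply: complex_ext => /=; field.
Qed.

Lemma bmeas_kern x0 n : bmeas a b (fun x => (kern x0 x ^+ n)%:C).
Proof.
have -> : (fun x => (kern x0 x ^+ n)%:C) = (fun x => (kern x0 x)%:C ^+ n).
  by apply/funext => x; rewrite rmorphXn.
apply: bmeasX; under [X in bmeas _ _ X]eq_fun do rewrite kernE.
apply: bmeasD; first apply: bmeasD; first exact: bmeas_cst.
  by apply: bmeasZ; exact: bmeas_fexp.
by apply: bmeasZ; exact: bmeas_fexp.
Qed.

(** Multiplication by the kernel combines shifts of the coefficients. *)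
Lemma fcoef_kern f x0 n l : bmeas a b f -> (forall l, fcoef a b f l = 0) ->
  fcoef a b (fun x => f x * ((kern x0 x) ^+ n)%:C) l = 0.
Proof.
move=> bf f0; elim: n l => [|n IH] l.
  rewrite -(f0 l); apply: fcoef_eq => // x _.
  by rewrite expr0 mulr1.
have bk m : bmeas a b (fun x => f x * ((kern x0 x) ^+ m)%:C).
  by apply: bmeasM => //; exact: bmeas_kern.
pose h x := f x * ((kern x0 x) ^+ n)%:C.
have bh : bmeas a b h by exact: bk.
have E x : f x * ((kern x0 x) ^+ n.+1)%:C = (2^-1)%:C * h x +
   (4^-1)%:C * conjc (fexp a b 1 x0) * (fexp a b 1 x * h x) +
   (4^-1)%:C * fexp a b 1 x0 * (fexp a b (-1) x * h x).
  have -> : (kern x0 x ^+ n.+1)%:C = (kern x0 x ^+ n)%:C * (kern x0 x)%:C.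
    by rewrite exprSr rmorphM.
  by rewrite /h [X in _ * (_ * X)]kernE; ring.
rewrite (fcoef_eq (g := fun x => (2^-1)%:C * h x +
   (4^-1)%:C * conjc (fexp a b 1 x0) * (fexp a b 1 x * h x) +
   (4^-1)%:C * fexp a b 1 x0 * (fexp a b (-1) x * h x)))//.
have bs j : bmeas a b (fun x => fexp a b j x * h x).
  by apply: bmeasM => //; exact: bmeas_fexp.
rewrite fcoefD//; last 2 first.
- by apply: bmeas_L1 => //; apply: bmeasD; exact: bmeasZ.
- by apply: bmeas_L1 => //; exact: bmeasZ.
rewrite fcoefD//; last 2 first.
- by apply: bmeas_L1 => //; exact: bmeasZ.
- by apply: bmeas_L1 => //; exact: bmeasZ.
rewrite !fcoefZ//; try exact: bmeas_L1.
by rewrite !fcoef_shift !IH !mulr0 !addr0.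
Qed.

Lemma cos_le (u v : R) : 0 <= u -> u <= v -> v <= pi -> cos v <= cos u.
Proof. by move=> u0 uv vp; rewrite leNgt ltr_cos ?in_itv/= -?leNgt//; lra. Qed.

Lemma kern_bounds x0 rho : a + rho <= x0 <= b - rho -> 0 < rho ->
  exists q1 q2 : R, [/\ 0 <= q1, q1 < q2,
    forall x, 0 <= kern x0 x,
    forall x, `|x - x0| <= rho / 2 -> q2 <= kern x0 x &
    forall x, a <= x <= b -> rho <= `|x - x0| -> kern x0 x <= q1].
Proof.
move=> hx0 rho0.
have ba : 0 < b - a by rewrite subr_gt0.
pose k := 2 * pi / (b - a).
have k0 : 0 < k by rewrite divr_gt0// mulr_gt0// pi_gt0.
have kba : k * (b - a) = 2 * pi by rewrite /k divfK// gt_eqF.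
have krho : k * rho <= pi.
  have : k * (rho * 2) <= k * (b - a) by rewrite ler_pM2l//; lra.
  by rewrite kba; lra.
have kE x : kern x0 x = (1 + cos (k * `|x - x0|)) / 2.
  rewrite /kern -/k; case: (ger0P (x - x0)) => _ //.
  by rewrite mulrN cosN.
have pi0 := pi_gt0 R.
have kr0 : 0 < k * rho by rewrite mulr_gt0.
exists ((1 + cos (k * rho)) / 2), ((1 + cos (k * (rho / 2))) / 2); split.
- by have := cos_geN1 (k * rho); lra.
- have : cos (k * rho) < cos (k * (rho / 2)); last by lra.
  by rewrite ltr_cos ?in_itv/=; [lra|lra|lra].
- by move=> x; rewrite kE; have := cos_geN1 (k * `|x - x0|); lra.
- move=> x hx; rewrite kE.
  have : cos (k * (rho / 2)) <= cos (k * `|x - x0|); last by lra.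
  have : k * `|x - x0| <= k * (rho / 2) by rewrite ler_pM2l.
  have : 0 <= k * `|x - x0| by rewrite mulr_ge0// ltW.
  by move=> h1 h2; apply: cos_le; lra.
move=> x hx hr; rewrite kE.
have : cos (k * `|x - x0|) <= cos (k * rho); last by lra.
have h1 : k * rho <= k * `|x - x0| by rewrite ler_pM2l.
have h2 : k * `|x - x0| <= 2 * pi - k * rho.
  rewrite -kba -mulrBr ler_pM2l// ler_norml; lra.
have [h|h] := leP (k * `|x - x0|) pi.
  by apply: cos_le; lra.
have -> : cos (k * `|x - x0|) = cos (2 * pi - k * `|x - x0|).
  rewrite -cosN -(cosD2pi (- _)); congr cos; rewrite -mulr_natl; ring.
by apply: cos_le; lra.
Qed.

Lemma Rintegral_lower (h : R -> R) (p r m : R) :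
  leb.-integrable `[a, b] (EFin \o h) -> (forall x, a <= x <= b -> 0 <= h x) ->
  a <= p -> p <= r -> r <= b -> 0 <= m ->
  (forall x, p <= x <= r -> m <= h x) ->
  m * (r - p) <= Rintegral leb `[a, b] h.
Proof.
move=> ih h0 ap pr rb m0 hm.
have mh : measurable_fun `[a, b]%classic h.
  by case/integrableP : ih => /measurable_EFinP.
have fin := @integrable_fin_num _ _ _ leb _ (measurable_itv _) _ ih.
rewrite -lee_fin /Rintegral fineK//.
have sub : (`[p, r] `<=` `[a, b])%classic.
  by move=> x /=; rewrite !in_itv /= => /andP[h1 h2]; apply/andP; split; lra.
apply: (@le_trans _ _ (\int[leb]_(x in `[p, r]) (h x)%:E)%E); last first.
  apply: (@ge0_subset_integral _ _ _ leb _ _ (measurable_itv _) (measurable_itv _)) => //.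
  exact/measurable_EFinP.
apply: (@le_trans _ _ (\int[leb]_(x in `[p, r]) (cst m%:E x))%E).
  rewrite (@integral_cst _ _ _ leb _ (measurable_itv _)).
  have -> : (m%:E * leb `[p, r]%classic = m%:E * (if (p < r)%R then r%:E - p%:E else 0))%E.
    congr (_ * _)%E; have := @lebesgue_measure_itv R `[p, r].
    by rewrite /= lte_fin.
  case: ltP => prq; first by rewrite -EFinB -EFinM.
  by rewrite (_ : p = r) ?subrr ?mulr0 ?mule0//; apply/eqP; rewrite eq_le pr prq.
apply: (@ge0_le_integral _ _ _ leb _ (measurable_itv _)) => //.
- by apply/measurable_EFinP; apply: measurable_funS mh => //; exact: measurable_itv.
Qed.

(** If [g] is positive at [x0], its integral against [kern x0 ^+ n] is at least of
    order [q2 ^+ n] by the contribution near [x0], and what is far from [x0] is at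
    most of order [q1 ^+ n] with [q1 < q2]; so it does not vanish for large [n]. *)
Lemma fcoef0_le0 g x0 : contD g -> (forall l, fcoef a b (toC g) l = 0) ->
  a < x0 < b -> g x0 <= 0.
Proof.
move=> cg g0 hx0; rewrite leNgt; apply/negP => gx0.
have x0D : a <= x0 <= b by lra.
have [d d0 hd] := cg x0 x0D _ (divr_gt0 gx0 (ltr0Sn R 1)).
pose rho := Num.min d (Num.min (x0 - a) (b - x0)).
have rho0 : 0 < rho by rewrite !lt_min d0 !subr_gt0.
have [rd ra rb] : [/\ rho <= d, rho <= x0 - a & rho <= b - x0].
  by split; rewrite !ge_min lexx ?orbT.
have [|q1 [q2 [q10 q12 kp k2 k1]]] := @kern_bounds x0 rho _ rho0; first by lra.
have bg := contD_bmeas cg; have [_ _ [G hG]] := bg.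
have hG' x : a <= x <= b -> `|g x| <= G by move=> /hG; rewrite nC_real.
have G0 : 0 <= G by apply: le_trans (hG' _ x0D).
have ba : 0 < b - a by rewrite subr_gt0.
pose c0 := g x0 / 2.
have c00 : 0 < c0 by rewrite divr_gt0.
have key n : c0 * q2 ^+ n * rho <= G * q1 ^+ n * (b - a).
  have bk : bmeas a b (fun x => toC g x * ((kern x0 x) ^+ n)%:C).
    by apply: bmeasM => //; exact: bmeas_kern.
  have [i1 _] := bmeas_L1 hab bk.
  have Ek x : complex.Re (toC g x * ((kern x0 x) ^+ n)%:C) = g x * kern x0 x ^+ n.
    by rewrite cReM /= mul0r subr0.
  have ik : leb.-integrable `[a, b] (EFin \o (fun x => g x * kern x0 x ^+ n)).
    by move: i1; under [X in EFin \o X]eq_fun do rewrite Ek.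
  have I0 : Rintegral leb `[a, b] (fun x => g x * kern x0 x ^+ n) = 0.
    have := fcoef_kern x0 n 0 bg g0; rewrite fcoefE => /eqP.
    rewrite mulf_eq0 => /orP[|/eqP].
      by rewrite eq_complex /= eqxx andbT invr_eq0 gt_eqF.
    move/(congr1 (@complex.Re R)) => H; rewrite -[RHS]/(complex.Re 0) -H; apply: eq_Rintegral => x _.
    by rewrite oppr0 fexp0 mulr1 Ek.
  (* adding the size of the part far from x0 makes the integrand nonnegative *)
  pose h x := g x * kern x0 x ^+ n + G * q1 ^+ n.
  have ic : leb.-integrable `[a, b] (EFin \o (fun=> G * q1 ^+ n)).
    by apply: (@bounded_integrable _ _ _ hab _ `|G * q1 ^+ n|).
  have ih : leb.-integrable `[a, b] (EFin \o h).
    have h' := @integrableD _ _ _ leb _ (measurable_itv _) _ _ ik ic.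
    by move: h'; congr (_.-integrable _ _).
  have Ih : Rintegral leb `[a, b] h = G * q1 ^+ n * (b - a).
    rewrite /h (@RintegralD _ _ _ leb _ _ _ (measurable_itv _) ik ic) I0 add0r.
    rewrite (@Rintegral_cst _ _ _ leb _ (measurable_itv _)); congr (_ * _).
    exact: (congr1 fine (lebD hab)).
  have qn : 0 <= q1 ^+ n by rewrite exprn_ge0.
  rewrite -Ih.
  have -> : c0 * q2 ^+ n * rho = c0 * q2 ^+ n * ((x0 + rho / 2) - (x0 - rho / 2)).
    by congr (_ * _); field.
  have near x : a <= x <= b -> `|x - x0| <= rho -> c0 <= g x.
    move=> hx xr; have := hd x hx (le_trans xr rd).
    by rewrite /c0 ler_norml => /andP[]; clear; lra.
  have [ap pr pb] : [/\ a <= x0 - rho / 2, x0 - rho / 2 <= x0 + rho / 2 & x0 + rho / 2 <= b].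
    by clear -rho0 ra rb; split; lra.
  apply: Rintegral_lower => //.
  - move=> x hx; rewrite /h; have [xr|rx] := leP `|x - x0| rho.
      rewrite addr_ge0// mulr_ge0// ?exprn_ge0//.
      by apply: le_trans (near _ hx xr); exact: ltW.
    have hk := k1 x hx (ltW rx).
    have kn : kern x0 x ^+ n <= q1 ^+ n by rewrite lerXn2r ?nnegrE.
    have kn0 : 0 <= kern x0 x ^+ n by rewrite exprn_ge0.
    have : - g x <= G by apply: le_trans (hG' _ hx); rewrite -normrN ler_norm.
    move: (hG' _ hx); rewrite ler_norml => /andP[gG _].
    have : - G * kern x0 x ^+ n <= g x * kern x0 x ^+ n by rewrite ler_wpM2r.
    have : G * kern x0 x ^+ n <= G * q1 ^+ n by rewrite ler_wpM2l.
    by clear; lra.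
  - by rewrite mulr_ge0 ?exprn_ge0 ?ltW// (le_lt_trans q10).
  move=> x hx; rewrite /h.
  have xr : `|x - x0| <= rho / 2 by rewrite ler_norml; move: hx; clear; lra.
  have hx' : a <= x <= b by move: hx ap pb; clear; lra.
  have h1 : c0 <= g x by apply: near => //; apply: le_trans xr _; move: rho0; clear; lra.
  have h2 : q2 ^+ n <= kern x0 x ^+ n.
    by rewrite lerXn2r ?nnegrE ?k2//; apply: ltW; apply: le_lt_trans q10 _.
  have : c0 * q2 ^+ n <= g x * kern x0 x ^+ n.
    by apply: ler_pM => //; rewrite ?exprn_ge0 ?ltW//; apply: le_lt_trans q10 _.
  have : 0 <= G * q1 ^+ n by rewrite mulr_ge0.
  by clear; lra.
have q20 : 0 < q2 by apply: le_lt_trans q12.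
pose t := q1 / q2.
have t0 : 0 <= t by rewrite divr_ge0// ltW.
have t1 : `|t| < 1 by rewrite ger0_norm// /t ltr_pdivrMr// mul1r.
have cr : 0 < c0 * rho by rewrite mulr_gt0.
have Gb : 0 < G * (b - a) + 1 by rewrite ltr_wpDl// mulr_ge0// ltW.
have := cvg_expr t1; move/cvgrPdist_lt/(_ _ (divr_gt0 cr Gb)) => [n _ /(_ n (leqnn n)) /=].
rewrite sub0r normrN ger0_norm ?exprn_ge0// ltr_pdivlMr//.
have q1E : q1 = t * q2 by rewrite /t divfK// gt_eqF.
have := key n; rewrite q1E exprMn.
have qn : 0 < q2 ^+ n by rewrite exprn_gt0.
have tn : 0 <= t ^+ n by rewrite exprn_ge0.
have -> : c0 * q2 ^+ n * rho = c0 * rho * q2 ^+ n by ring.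
have -> : G * (t ^+ n * q2 ^+ n) * (b - a) = (t ^+ n * (G * (b - a))) * q2 ^+ n by ring.
rewrite ler_pM2r// => h1 h2; move: h2; rewrite [t ^+ n * (_ + 1)]mulrDr mulr1.
by move: h1; lra.
Qed.

Lemma contD_ext0 g : contD g -> (forall x, a < x < b -> g x = 0) ->
  forall x, a <= x <= b -> g x = 0.
Proof.
move=> cg g0 x hx; apply/eqP; rewrite -normr_eq0 eq_le normr_ge0 andbT.
apply/ler_addgt0Pr => e e0; rewrite add0r.
have [d d0 hd] := cg x hx e e0.
have [y [hy yx]] : exists y, a < y < b /\ `|y - x| <= d.
  pose r := Num.min d ((b - a) / 2) / 2.
  have r0 : 0 < r by rewrite divr_gt0// lt_min d0 divr_gt0// subr_gt0.
  have rd : r < d.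
    by rewrite ltr_pdivrMr// gt_min; apply/orP; left; rewrite ltr_pMr// ltr1n.
  have rb : r <= (b - a) / 4.
    have : Num.min d ((b - a) / 2) <= (b - a) / 2 by rewrite ge_min lexx orbT.
    by rewrite /r; lra.
  have [h|h] := leP x ((a + b) / 2).
    exists (x + r); split; first lra.
    by rewrite addrC addKr ger0_norm ltW.
  exists (x - r); split; first lra.
  by rewrite addrC addKr normrN ger0_norm ltW.
have hy' : a <= y <= b by lra.
by have := hd y hy' yx; rewrite (g0 y hy) sub0r normrN.
Qed.

Lemma fcoef0_eq0 g : contD g -> (forall l, fcoef a b (toC g) l = 0) ->
  forall x, a <= x <= b -> g x = 0.
Proof.
move=> cg g0; apply: contD_ext0 => // x hx.
apply/eqP; rewrite eq_le (fcoef0_le0 cg g0 hx) /=.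
rewrite -oppr_le0; apply: (@fcoef0_le0 (fun x => - g x)) => //; first exact: contDN.
move=> l; transitivity (fcoef a b (fun x => - toC g x) l).
  by apply: fcoef_eq => // y _; apply: complex_ext; rewrite /= ?oppr0.
rewrite fcoefN ?g0 ?oppr0//; apply: bmeas_L1 => //; exact: contD_bmeas.
Qed.

Lemma inA_contRe f c : inA a b f c -> contD (fun x => complex.Re (f x)).
Proof.
move=> [_ hf] x hx e e0.
have e3 : 0 < e / 3 by rewrite divr_gt0.
have [N hN] := hf _ e3.
have ct : contD (fun x => complex.Re (tpoly a b c N x)).
  rewrite /tpoly; elim: (lowseq N) => [|l s IH].
    have := contD_const 0; congr contD; apply/funext => y.
    by rewrite big_nil.
  have [c1 c2] := contD_expi (mu a b l).
  have key : contD (fun x => complex.Im (c l) * sin (mu a b l * (x - a)) -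
     complex.Re (c l) * cos (mu a b l * (x - a))).
    have sc k u : contD u -> contD (fun x => k * u x).
      move=> cu y hy e' e'0; have k1 : 0 < `|k| + 1 by rewrite ltr_wpDl.
      have [d d0 hd] := cu y hy _ (divr_gt0 e'0 k1); exists d => // z hz zy.
      rewrite -mulrBr normrM; apply: (@le_trans _ _ ((`|k| + 1) * (e' / (`|k| + 1)))).
        by apply: ler_pM; rewrite ?lerDl ?hd.
      by rewrite mulrC divfK// gt_eqF.
    by apply: contDB; exact: sc.
  have := contDB IH key; congr contD; apply/funext => y.
  by rewrite big_cons cReD cReM /fexp /expi /=; ring.
have [d d0 hd] := ct x hx _ e3; exists d => // y hy yx.
have -> : complex.Re (f y) - complex.Re (f x) =
  complex.Re (f y - tpoly a b c N y) - complex.Re (f x - tpoly a b c N x)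
  + (complex.Re (tpoly a b c N y) - complex.Re (tpoly a b c N x)).
  by rewrite !cReB; ring.
have -> : e = e / 3 + e / 3 + e / 3 by field.
apply: le_trans (ler_normD _ _) _; apply: lerD; last exact: hd.
apply: le_trans (ler_normB _ _) _; apply: lerD;
  apply: le_trans (normr_Re_le _) _; exact: hN.
Qed.

(** The sum of the series is continuous and has the same coefficients as [g], so
    the difference vanishes by [fcoef0_eq0]. Taking real parts keeps the comparison
    among real functions. *)
Lemma contD_inA g B : contD g -> bsum (fun l => nC (fcoef a b (toC g) l)) B ->
  inA a b (toC g) (fcoef a b (toC g)).
Proof.
move=> cg hB; set c := fcoef a b (toC g).
have cc l : conjc (c (- l)) = c l.
  rewrite /c -fcoef_conj; apply: fcoef_eq => // x _.
  by apply: complex_ext; rewrite /= ?oppr0.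
pose F := fseries a b c; have hF : inA a b F c by apply: fseries_inA hB.
pose ReF x := complex.Re (F x).
have hR : inA a b (toC ReF) c.
  have h := inAZ (2^-1)%:C (inAD hF (inA_conj hF)).
  have : inA a b (fun x => (2^-1)%:C * (F x + conjc (F x))) c.
    move: h; congr inA; apply/funext => l; rewrite cc.
    by case: (c l) => u v; apply: complex_ext => /=; field.
  apply: inA_eq => x _; rewrite /toC /ReF; case: (F x) => u v.
  by apply: complex_ext => /=; field.
have bR := inA_bmeas hR; have bg := contD_bmeas cg.
have cR := inA_contRe hF.
have z : forall x, a <= x <= b -> g x - ReF x = 0.
  apply: fcoef0_eq0; first exact: contDB.
  move=> l; transitivity (fcoef a b (fun x => toC g x - toC ReF x) l).
    by apply: fcoef_eq => // x _; rewrite /toC rmorphB.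
  by rewrite fcoefB ?(inA_fcoef _ _ hR) ?subrr//; exact: bmeas_L1.
by apply: inA_eq hR => x /z/eqP; rewrite subr_eq0 /toC => /eqP ->.
Qed.

End fourier_uniqueness.

(** * Sobolev norms and weighted sums of coefficients *)

Section sobolev_norms.
Variables (R : realType) (a b : R) (hab : a < b).
Implicit Types (f : R -> R[i]) (l : int).

Definition jap (s : R) l : R := (1 + mu a b l ^+ 2) `^ s.

Lemma jap_base l : 1 <= 1 + mu a b l ^+ 2.
Proof. by rewrite lerDl sqr_ge0. Qed.

Lemma jap_base0 l : 0 < 1 + mu a b l ^+ 2.
Proof. exact: lt_le_trans ltr01 (jap_base l). Qed.

Lemma jap_gt0 s l : 0 < jap s l.
Proof. by apply: powR_gt0; exact: jap_base0. Qed.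

Lemma jap_ge0 s l : 0 <= jap s l.
Proof. exact: ltW (jap_gt0 s l). Qed.

Lemma japD s t l : jap (s + t) l = jap s l * jap t l.
Proof.
rewrite /jap powRD//; apply/implyP => _.
by rewrite gt_eqF// jap_base0.
Qed.

Lemma jap0 l : jap 0 l = 1.
Proof. by rewrite /jap powRr0. Qed.

Lemma jap_half s l : jap (s / 2) l ^+ 2 = jap s l.
Proof. by rewrite expr2 -japD -splitr. Qed.

Lemma jap_le s t l : s <= t -> jap s l <= jap t l.
Proof. by move=> st; apply: ler_powR => //; exact: jap_base. Qed.

(** Peetre's inequality. *)
Lemma jap_submul s k l : 0 <= s -> jap s (k + l) <= 2 `^ s * (jap s k * jap s l).
Proof.
move=> s0; rewrite /jap -powRM ?addr_ge0 ?sqr_ge0// -powRM ?mulr_ge0 ?addr_ge0 ?sqr_ge0//.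
apply: ge0_ler_powR; rewrite ?nnegrE ?mulr_ge0 ?addr_ge0 ?sqr_ge0//.
rewrite muD; set x := mu a b k; set y := mu a b l.
rewrite -subr_ge0.
have -> : 2 * ((1 + x ^+ 2) * (1 + y ^+ 2)) - (1 + (x + y) ^+ 2) =
  1 + (x - y) ^+ 2 + 2 * x ^+ 2 * y ^+ 2 by ring.
have := sqr_ge0 (x - y); have := mulr_ge0 (sqr_ge0 x) (sqr_ge0 y); lra.
Qed.

Lemma bsum_jap_inv : exists2 K, 0 < K & bsum (fun l => (1 + mu a b l ^+ 2)^-1) K.
Proof.
pose k := 2 * pi / (b - a).
have k0 : 0 < k by rewrite divr_gt0 ?subr_gt0// mulr_gt0// pi_gt0.
have k2 : 0 < k ^+ 2 by rewrite exprn_gt0.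
pose c := 1 + (k ^+ 2)^-1.
have c0 : 0 < c by rewrite addr_gt0// invr_gt0.
exists (c * 6); first by rewrite mulr_gt0.
apply: bsum_le (bsumZ (ltW c0) (@bsum_inv_sqr R)) => // l.
have -> : mu a b l = k * l%:~R by rewrite /mu /k mulrAC.
set x : R := l%:~R; have x2 : 0 <= x ^+ 2 by rewrite sqr_ge0.
have p1 : 0 < 1 + (k * x) ^+ 2 by rewrite ltr_pwDl// sqr_ge0.
have p2 : 0 < 1 + x ^+ 2 by rewrite ltr_pwDl.
rewrite -[leLHS]mul1r ler_pdivrMr// mulrAC ler_pdivlMr// mul1r.
pose ki := (k ^+ 2)^-1; have kk : ki * k ^+ 2 = 1 by rewrite mulVf// gt_eqF.
have -> : c * (1 + (k * x) ^+ 2) = 1 + k ^+ 2 * x ^+ 2 + ki + (ki * k ^+ 2) * x ^+ 2.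
  by rewrite /c -/ki; ring.
have : 0 <= ki by rewrite invr_ge0 ltW.
have : 0 <= k ^+ 2 * x ^+ 2 by rewrite mulr_ge0// ltW.
rewrite kk; lra.
Qed.

Lemma hnorm_bsum f s (M : R) : (hnorm a b s f <= M%:E)%E ->
  [/\ inL2 a b f, 0 <= M & bsum (fun l => jap s l * nC (fcoef a b f l) ^+ 2) (M ^+ 2)].
Proof.
rewrite /hnorm; case: ifPn => [/asboolP h2|_]; last by rewrite leye_eq.
set X := (\esum_(_ in _) _)%E => hX.
have X0 : (0 <= X)%E.
  by apply: esum_ge0 => l _; rewrite lee_fin mulr_ge0 ?jap_ge0 ?sqr_ge0.
have M0 : 0 <= M by rewrite -lee_fin; apply: le_trans hX; exact: poweR_ge0.
split => // r ur.
have hr : ((\sum_(l <- r) jap s l * nC (fcoef a b f l) ^+ 2)%:E <= X)%E.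
  apply: esum_ge; exists [set` r]%classic.
    by split => //; exact: finite_seq.
  rewrite -fsbig_seq// -sumEFin.
  by [].
case: X X0 hX hr => [x| |] //.
  rewrite !lee_fin => x0 hX hr; apply: le_trans hr _.
  rewrite -(sqr_sqrtr x0) ler_sqr ?nnegrE ?sqrtr_ge0//.
  by move: hX; rewrite -powR12_sqrt.
by rewrite /= invr_eq0 pnatr_eq0.
Qed.

Lemma bsum_hnorm f s (B : R) : inL2 a b f ->
  bsum (fun l => jap (s / 2) l * nC (fcoef a b f l)) B ->
  (hnorm a b s f <= B%:E)%E.
Proof.
move=> h2 hB; rewrite /hnorm asboolT//.
have B0 := bsum_ge0 hB.
have hX : ((\esum_(l in [set: int]) ((1 + mu a b l ^+ 2) `^ s *
   nC (fcoef a b f l) ^+ 2)%:E) <= (B ^+ 2)%:E)%E.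
  apply: ub_ereal_sup => _ [X [finX _] <-].
  rewrite fsbig_finite//= sumEFin lee_fin.
  have hB2 : bsum (fun l => (jap (s / 2) l * nC (fcoef a b f l)) ^+ 2) (B ^+ 2).
    by apply: bsum_sqr => // l; rewrite mulr_ge0 ?jap_ge0 ?nC_ge0.
  apply: le_trans (hB2 _ (fset_uniq _)).
  by apply: ler_sum => l _; rewrite [leRHS]exprMn jap_half.
set X := (\esum_(_ in _) _)%E in hX *.
have X0 : (0 <= X)%E.
  by apply: esum_ge0 => l _; rewrite lee_fin mulr_ge0 ?jap_ge0 ?sqr_ge0.
case: X X0 hX => [x| |] //.
rewrite /= !lee_fin => x0 hX; rewrite powR12_sqrt//.
by rewrite -(ger0_norm B0) -sqrtr_sqr ler_wsqrtr.
Qed.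

(** Sobolev's embedding into weighted Wiener algebras, by Cauchy-Schwarz against
    the summable family [(1 + mu ^+ 2)^-1]: one power of [mu ^+ 2] in the squared
    weights is lost. *)
Lemma hnorm_wsum (s K : R) (w : int -> R) : 0 <= K -> (forall l, 0 <= w l) ->
  (forall l, w l ^+ 2 <= K * jap (s - 1) l) ->
  exists2 C, 0 < C & forall f (e : R), 0 < e -> (hnorm a b s f <= e%:E)%E ->
    bsum (fun l => w l * nC (fcoef a b f l)) (C * e).
Proof.
move=> K0 w0 hw; have [K1 K10 hK1] := bsum_jap_inv.
exists (K * K1 + 1); first by rewrite ltr_wpDl// mulr_ge0// ltW.
move=> f e e0 /hnorm_bsum[_ _ hf].
pose u l := w l * jap (- (s / 2)) l.
pose v l := jap (s / 2) l * nC (fcoef a b f l).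
have hu : bsum (fun l => u l ^+ 2) (K * K1).
  apply: bsum_le (bsumZ K0 hK1) => // l; rewrite /u exprMn.
  rewrite (_ : jap (- (s / 2)) l ^+ 2 = jap (- s) l); last first.
    by rewrite -(jap_half (- s)) mulNr.
  apply: le_trans (ler_wpM2r (jap_ge0 _ _) (hw l)) _.
  rewrite -mulrA -japD addrAC subrr add0r /jap powR_inv1//.
  exact: ltW (jap_base0 l).
have hv : bsum (fun l => v l ^+ 2) (e ^+ 2).
  by apply: bsum_le hf => // l; rewrite /v exprMn jap_half.
have := bsum_CS e0 hu hv; rewrite mulrC; apply: bsum_le => // l.
have -> : u l * v l = w l * (jap (- (s / 2)) l * jap (s / 2) l) * nC (fcoef a b f l).
  by rewrite /u /v; ring.
by rewrite -japD addNr jap0 mulr1.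
Qed.

End sobolev_norms.

(** * Time derivatives of complex-valued functions *)

Section complex_derivatives.
Variable R : realType.
Implicit Types (f g : R -> R[i]) (t r : R).

(** Relative to [[A, Z]], so that the ends of the interval carry one-sided
    derivatives; without quotients, so that finite families can be summed. *)
Definition cderiv (A Z : R) f t (l : R[i]) : Prop :=
  forall e : R, 0 < e -> exists2 d : R, 0 < d &
    forall r, A <= r <= Z -> `|r - t| <= d ->
      nC (f r - f t - (r - t)%:C * l) <= e * `|r - t|.

Lemma cderiv_sub A Z A' Z' f t l : A <= A' -> Z' <= Z ->
  cderiv A Z f t l -> cderiv A' Z' f t l.
Proof.
move=> AA ZZ h e /h[d d0 hd]; exists d => // r /andP[h1 h2]; apply: hd.
by rewrite (le_trans AA h1) (le_trans h2 ZZ).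
Qed.

Lemma cderiv_ext A Z f g t l : (forall r, f r = g r) -> cderiv A Z f t l ->
  cderiv A Z g t l.
Proof. by move=> fg h e /h[d d0 hd]; exists d => // r; rewrite -!fg; exact: hd. Qed.

Lemma cderiv_lip A Z f t l : cderiv A Z f t l -> exists2 d : R, 0 < d &
  forall r, A <= r <= Z -> `|r - t| <= d -> nC (f r - f t) <= (nC l + 1) * `|r - t|.
Proof.
move=> /(_ 1 ltr01)[d d0 hd]; exists d => // r hr rt.
rewrite -[f r - f t](subrK ((r - t)%:C * l)) mulrDl addrC.
apply: le_trans (nCD _ _) _; apply: lerD; last exact: hd.
by rewrite nCM nC_real mulrC.
Qed.

Lemma cderiv_cst A Z k t : cderiv A Z (fun=> k) t 0.
Proof.
move=> e e0; exists 1 => // r _ _.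
by rewrite subrr mulr0 subr0 nC0 mulr_ge0// ltW.
Qed.

Lemma cderivD A Z f g t l m : cderiv A Z f t l -> cderiv A Z g t m ->
  cderiv A Z (fun r => f r + g r) t (l + m).
Proof.
move=> hf hg e e0; have e2 : 0 < e / 2 by rewrite divr_gt0.
have [d1 d10 h1] := hf _ e2; have [d2 d20 h2] := hg _ e2.
exists (Num.min d1 d2); first by rewrite lt_min d10.
move=> r hr; rewrite le_min => /andP[r1 r2].
have -> : f r + g r - (f t + g t) - (r - t)%:C * (l + m) =
  (f r - f t - (r - t)%:C * l) + (g r - g t - (r - t)%:C * m) by ring.
apply: le_trans (nCD _ _) _; rewrite (splitr e) [leRHS]mulrDl.
by apply: lerD; [exact: h1|exact: h2].
Qed.

Lemma cderivM A Z f g t l m : cderiv A Z f t l -> cderiv A Z g t m ->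
  cderiv A Z (fun r => f r * g r) t (l * g t + f t * m).
Proof.
move=> hf hg e e0.
pose G := nC (g t) + (nC m + 1); pose F := nC (f t) + 1; pose L := nC l + 1.
have G0 : 0 < G by rewrite ltr_wpDl ?nC_ge0// ltr_wpDl ?nC_ge0.
have F0 : 0 < F by rewrite ltr_wpDl ?nC_ge0.
have L0 : 0 < L by rewrite ltr_wpDl ?nC_ge0.
have e1 : 0 < e / 3 / G by rewrite !divr_gt0.
have e2 : 0 < e / 3 / F by rewrite !divr_gt0.
have e3 : 0 < e / 3 / (L * (nC m + 1)).
  by apply: divr_gt0; [exact: divr_gt0|apply: mulr_gt0; rewrite // ltr_wpDl ?nC_ge0].
have [d1 d10 h1] := hf _ e1; have [d2 d20 h2] := hg _ e2.
have [d3 d30 h3] := cderiv_lip hg.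
exists (Num.min (Num.min d1 d2) (Num.min d3 (Num.min 1 (e / 3 / (L * (nC m + 1)))))).
  by rewrite !lt_min d10 d20 d30 ltr01.
move=> r hr; rewrite !le_min => /andP[/andP[r1 r2] /andP[r3 /andP[r4 r5]]].
have {}h1 := h1 r hr r1; have {}h2 := h2 r hr r2; have {}h3 := h3 r hr r3.
set h := `|r - t| in r1 r2 r3 r4 r5 h1 h2 h3 *.
have h0 : 0 <= h by exact: normr_ge0.
have -> : f r * g r - f t * g t - (r - t)%:C * (l * g t + f t * m) =
  (f r - f t - (r - t)%:C * l) * g r + (f t * (g r - g t - (r - t)%:C * m) +
  (r - t)%:C * l * (g r - g t)) by ring.
have gr : nC (g r) <= G.
  rewrite -[g r](subrK (g t)) addrC; apply: le_trans (nCD _ _) _.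
  rewrite lerD2l; apply: le_trans h3 _.
  by rewrite ler_piMr// addr_ge0 ?nC_ge0.
have -> : e * h = e / 3 / G * h * G + (F * (e / 3 / F * h) + e / 3 * h).
  by field; rewrite !gt_eqF.
apply: le_trans (nCD _ _) _; apply: lerD.
  by rewrite nCM ler_pM ?nC_ge0.
apply: le_trans (nCD _ _) _; apply: lerD.
  by rewrite nCM ler_pM ?nC_ge0// lerDl.
rewrite !nCM nC_real -/h.
have m0 : 0 < nC m + 1 by rewrite ltr_wpDl ?nC_ge0.
apply: (@le_trans _ _ (h * L * ((nC m + 1) * h))).
  by rewrite ler_pM ?nC_ge0 ?mulr_ge0 ?nC_ge0// ler_pM ?nC_ge0// lerDl.
have -> : h * L * ((nC m + 1) * h) = h * (L * (nC m + 1)) * h by ring.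
by rewrite ler_wpM2r// -ler_pdivlMr ?mulr_gt0.
Qed.

Lemma cderivZ A Z k f t l : cderiv A Z f t l ->
  cderiv A Z (fun r => k * f r) t (k * l).
Proof.
by move=> hf; have := cderivM (cderiv_cst A Z k t) hf; rewrite mul0r add0r.
Qed.

Lemma cderiv_sum A Z (I : Type) (s : seq I) (F : I -> R -> R[i]) (F' : I -> R[i]) t :
  (forall i, cderiv A Z (F i) t (F' i)) ->
  cderiv A Z (fun r => \sum_(i <- s) F i r) t (\sum_(i <- s) F' i).
Proof.
move=> h; elim: s => [|i s IH].
  by rewrite big_nil; apply: cderiv_ext (cderiv_cst A Z 0 t) => r; rewrite big_nil.
by rewrite big_cons; apply: cderiv_ext (cderivD (h i) IH) => r; rewrite big_cons.
Qed.

Lemma cderiv_shift A Z m t : cderiv A Z (fun r => (r - m)%:C) t 1.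
Proof.
move=> e e0; exists 1 => // r _ _.
have -> : (r - m)%:C - (t - m)%:C - (r - t)%:C * 1 = 0 :> R[i].
  by apply: complex_ext => /=; ring.
by rewrite nC0 mulr_ge0// ltW.
Qed.

Lemma rderiv (F : R -> R) (t l : R) : is_derive t (1 : R) F l ->
  forall e : R, 0 < e -> exists2 d : R, 0 < d &
    forall r, `|r - t| <= d -> `|F r - F t - (r - t) * l| <= e * `|r - t|.
Proof.
move=> hF e e0.
have [dF <-] := hF; rewrite /derive.
have /cvgrPdist_le/(_ e e0)/nbhs_ballP[d d0 hd] := dF.
exists (d / 2); first by rewrite divr_gt0.
move=> r rt; have [->|rt0] := eqVneq r t.
  by rewrite !subrr mul0r subr0 normr0 mulr0.
have rt1 : r - t != 0 by rewrite subr_eq0.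
have bl : ball (0 : R) d (r - t).
  rewrite /ball /= sub0r normrN.
  by apply: le_lt_trans rt _; rewrite ltr_pdivrMr// ltr_pMr// ltr1n.
have := hd _ bl rt1; rewrite /= /GRing.scale /= mulr1 subrK => h.
rewrite -ler_pdivrMr ?normr_gt0// -normf_div -normrN; apply: le_trans h.
by rewrite le_eqVlt; apply/orP; left; apply/eqP; congr (`|_|); field.
Qed.

Lemma cderiv_expi A Z (th m : R) t :
  cderiv A Z (fun r => expi (th * (r - m))) t ('i * th%:C * expi (th * (t - m))).
Proof.
move=> e e0; have e2 : 0 < e / 2 by rewrite divr_gt0.
have D1 : is_derive t (1 : R) (fun r : R => cos (th * (r - m))) (- th * sin (th * (t - m))).
  by apply: is_derive_eq; rewrite /GRing.scale /=; ring.
have D2 : is_derive t (1 : R) (fun r : R => sin (th * (r - m))) (th * cos (th * (t - m))).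
  by apply: is_derive_eq; rewrite /GRing.scale /=; ring.
have [d1 d10 h1] := rderiv D1 e2; have [d2 d20 h2] := rderiv D2 e2.
exists (Num.min d1 d2); first by rewrite lt_min d10.
move=> r _; rewrite le_min => /andP[r1 r2].
apply: le_trans (nC_le_ReIm _) _; rewrite (splitr e) [leRHS]mulrDl.
apply: lerD.
  apply: le_trans (h1 r r1); rewrite le_eqVlt; apply/orP; left; apply/eqP.
  by congr (`|_|); rewrite /expi /=; ring.
apply: le_trans (h2 r r2); rewrite le_eqVlt; apply/orP; left; apply/eqP.
by congr (`|_|); rewrite /expi /=; ring.
Qed.

Lemma cderiv_sum_near A Z (I : Type) (L : seq I) (F : I -> R -> R[i]) (F' : I -> R[i]) t :
  (forall i, cderiv A Z (F i) t (F' i)) ->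
  forall e : R, 0 < e -> exists2 d : R, 0 < d & forall r, A <= r <= Z -> `|r - t| <= d ->
    \sum_(i <- L) nC (F i r - F i t - (r - t)%:C * F' i) <= e * `|r - t|.
Proof.
move=> dF; elim: L => [|i s IH] e e0.
  by exists 1 => // r _ _; rewrite big_nil mulr_ge0// ltW.
have e2 : 0 < e / 2 by rewrite divr_gt0.
have [d1 d10 h1] := dF i _ e2; have [d2 d20 h2] := IH _ e2.
exists (Num.min d1 d2); first by rewrite lt_min d10.
move=> r hr; rewrite le_min => /andP[r1 r2]; rewrite big_cons.
rewrite (splitr e) [leRHS]mulrDl.
by apply: lerD; [exact: h1|exact: h2].
Qed.

Section mean_value.
Variables (I : Type) (L : seq I) (F F' : I -> R -> R[i]) (A Z K : R).
Hypothesis (AZ : A <= Z).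
Hypothesis dF : forall i t, A <= t <= Z -> cderiv A Z (F i) t (F' i t).
Hypothesis bF : forall t, A <= t <= Z -> \sum_(i <- L) nC (F' i t) <= K.

Lemma sum_cderiv t e : A <= t <= Z -> 0 < e -> exists2 d : R, 0 < d &
  forall r, A <= r <= Z -> `|r - t| <= d ->
    \sum_(i <- L) nC (F i r - F i t) <= (K + e) * `|r - t|.
Proof.
move=> ht /(cderiv_sum_near L (fun i => dF i ht))[d d0 hd]; exists d => // r hr rt.
apply: (@le_trans _ _ (\sum_(i <- L) (nC (F i r - F i t - (r - t)%:C * F' i t)
   + `|r - t| * nC (F' i t)))).
  apply: ler_sum => i _.
  rewrite -[F i r - F i t](subrK ((r - t)%:C * F' i t)).
  apply: le_trans (nCD _ _) _; rewrite nCM nC_real.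
  by rewrite [F i r - F i t - _ + _]subrK.
rewrite big_split /= -mulr_sumr mulrDl addrC; apply: lerD; last exact: hd.
by rewrite mulrC ler_wpM2r// bF.
Qed.

(** The mean value inequality in l1. The set of times up to which the bound with
    slope [K + e] holds is closed, and it can be continued beyond each of its
    points. *)
Lemma mean_value_sum : \sum_(i <- L) nC (F i Z - F i A) <= K * (Z - A).
Proof.
apply: (@le_by_eps _ _ _ (Z - A)); first by rewrite subr_ge0.
move=> e e0; rewrite [(Z - A) * e]mulrC -mulrDl.
pose Phi t := \sum_(i <- L) nC (F i t - F i A).
have AA : A <= A <= Z by rewrite lexx.
have K0 : 0 <= K by apply: le_trans (bF AA); apply: sumr_ge0 => i _; exact: nC_ge0.
have tri r t : Phi r <= Phi t + \sum_(i <- L) nC (F i r - F i t).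
  rewrite /Phi -big_split; apply: ler_sum => i _ /=.
  by rewrite addrC -[F i r - F i A](subrKA (F i t)); exact: nCD.
pose S : set R := [set t : R | A <= t <= Z /\ Phi t <= (K + e) * (t - A)]%classic.
have SA : S A.
  split => //; rewrite subrr mulr0 /Phi big1// => i _.
  by rewrite subrr nC0.
have hS : has_sup S by split; [exists A|exists Z => t [/andP[]]].
have Ss : A <= sup S <= Z.
  apply/andP; split; first exact: sup_upper_bound.
  by apply: sup_le_ub => //; [exists A|move=> t [/andP[]]].
set s := sup S in Ss *.
have [d d0 hd] := sum_cderiv Ss e0.
have Ssup : S s.
  split => //; have [r Sr] := sup_adherent d0 hS; rewrite -/s => rs.
  have rle : r <= s by exact: sup_upper_bound.
  have [rAZ hr] := Sr.
  have rs' : `|r - s| <= d by rewrite distrC ger0_norm ?subr_ge0//; lra.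
  have h1 := hd r rAZ rs'.
  apply: le_trans (tri s r) _.
  have -> : \sum_(i <- L) nC (F i s - F i r) = \sum_(i <- L) nC (F i r - F i s).
    by apply: eq_bigr => i _; exact: nCBC.
  have -> : (K + e) * (s - A) = (K + e) * (r - A) + (K + e) * `|r - s|.
    by rewrite distrC ger0_norm ?subr_ge0//; ring.
  exact: lerD.
have [sZ|Zs] := ltP s Z; last first.
  have -> : Z = s by apply/eqP; rewrite eq_le Zs /=; case/andP: Ss.
  by case: Ssup.
pose r := Num.min Z (s + d).
have sr : s < r by rewrite lt_min sZ ltrDl.
have rZ : A <= r <= Z.
  rewrite ge_min lexx andbT; case/andP: Ss => h _; apply: ltW.
  exact: le_lt_trans h sr.
have rs0 : `|r - s| = r - s by rewrite ger0_norm// subr_ge0 (ltW sr).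
have rd : `|r - s| <= d by rewrite rs0 lerBlDl ge_min lexx orbT.
have Sr : S r.
  split => //; apply: le_trans (tri r s) _.
  have -> : (K + e) * (r - A) = (K + e) * (s - A) + (K + e) * `|r - s|.
    by rewrite rs0; ring.
  by apply: lerD; [case: Ssup|exact: hd].
have : r <= s by exact: sup_upper_bound.
by rewrite leNgt sr.
Qed.

End mean_value.

End complex_derivatives.

(** * The error kernel of the trapezoidal rule *)

Section trigonometric_bounds.
Variable R : realType.
Implicit Types x : R.

Lemma MVT_smooth (f df : R -> R) x : 0 < x ->
  (forall y : R, is_derive y (1 : R) f (df y)) ->
  exists2 c, 0 < c < x & f x - f 0 = df c * x.
Proof.
move=> x0 hf.
have [|c] := @MVT R f df 0 x x0.
  apply: continuous_subspaceT => y; apply: differentiable_continuous.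
  by apply/derivable1_diffP; case: (hf y).
by rewrite in_itv /= subr0 => hc E; exists c.
Qed.

Lemma sin_le_id x : 0 <= x -> sin x <= x.
Proof.
rewrite le_eqVlt => /predU1P[<-|x0]; first by rewrite sin0.
have [c _] := MVT_smooth x0 (fun y => is_derive_sin y).
by rewrite sin0 subr0 => ->; apply: ler_piMl; [exact: ltW|exact: cos_le1].
Qed.

Lemma sin_sub_xcos x : 0 <= x <= pi -> 0 <= sin x - x * cos x <= x ^+ 3.
Proof.
move=> /andP[]; rewrite le_eqVlt => /predU1P[<-|x0] xpi.
  by rewrite sin0 mul0r subrr expr0n lexx.
have D (y : R) : is_derive y (1 : R) (fun x : R => sin x - x * cos x) (y * sin y).
  by apply: is_derive_eq; rewrite /GRing.scale /=; ring.
have [c /andP[c0 cx]] := MVT_smooth x0 D.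
rewrite sin0 mul0r !subr0 => ->.
have s0 : 0 <= sin c.
  by apply: sin_ge0_pi; rewrite (ltW c0) (le_trans (ltW cx)).
have s1 : sin c <= c by apply: sin_le_id; exact: ltW.
apply/andP; split; first by rewrite !mulr_ge0// ltW.
have : c * sin c <= x * x by rewrite ler_pM// ?(ltW c0)// ?(ltW cx)// (le_trans s1)// ltW.
by rewrite exprSr expr2 ler_pM2r.
Qed.

(** The function [x * cot x] is smooth up to its first pole at [pi]; bounding [x]
    by [pi * gamma] keeps away from the pole, and [1 - x * cot x] vanishes to second
    order at 0. *)
Lemma xcot_bound (gamma x : R) : 0 < gamma < 1 -> `|x| <= pi * gamma -> x != 0 ->
  sin x != 0 /\ `|1 - x * cos x / sin x| <= x ^+ 2 / cos (pi * gamma / 2) ^+ 2.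
Proof.
move=> hg.
have pi0 := pi_gt0 R.
have pg : pi * gamma < pi by rewrite gtr_pMr//; lra.
have pg0 : 0 < pi * gamma by rewrite mulr_gt0//; lra.
have cq : 0 < cos (pi * gamma / 2) by apply: cos_gt0_pihalf; lra.
wlog x0 : x / 0 < x.
  move=> H hx xn; have [x0|x0] := ltP 0 x; first exact: H.
  have nx : 0 < - x by rewrite oppr_gt0 lt_neqAle xn.
  have [||s h] := H (- x) nx; rewrite ?normrN ?oppr_eq0//.
  move: s h; rewrite sinN cosN oppr_eq0 => s; split => //.
  by move: h; rewrite sqrrN invrN mulrN mulNr mulNr opprK.
rewrite ger0_norm ?(ltW x0)// => hx _.
have hx2 : cos (pi * gamma / 2) <= cos (x / 2) by apply: cos_le; lra.
have s2 : x / 2 * cos (x / 2) <= sin (x / 2).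
  have /sin_sub_xcos/andP[+ _] : 0 <= x / 2 <= pi by lra.
  by rewrite subr_ge0.
have hs : x * cos (pi * gamma / 2) ^+ 2 <= sin x.
  have -> : sin x = 2 * (sin (x / 2) * cos (x / 2)).
    by rewrite {1}(splitr x) sinD; ring.
  have : x / 2 * cos (x / 2) * cos (x / 2) <= sin (x / 2) * cos (x / 2).
    by rewrite ler_wpM2r// (le_trans (ltW cq)).
  have : cos (pi * gamma / 2) ^+ 2 <= cos (x / 2) ^+ 2.
    by rewrite ler_sqr ?nnegrE ?(ltW cq)// (le_trans (ltW cq)).
  have : x * cos (pi * gamma / 2) ^+ 2 <= x * cos (x / 2) ^+ 2.
    rewrite ler_pM2l// ler_sqr ?nnegrE ?(ltW cq)//.
    by rewrite (le_trans (ltW cq)).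
  lra.
have sx0 : 0 < sin x by apply: lt_le_trans hs; rewrite mulr_gt0// exprn_gt0.
split; first by rewrite gt_eqF.
have -> : 1 - x * cos x / sin x = (sin x - x * cos x) / sin x.
  by field; rewrite gt_eqF.
have /sin_sub_xcos/andP[h1 h2] : 0 <= x <= pi by lra.
rewrite normrM normfV (ger0_norm h1) (gtr0_norm sx0).
have cq2 : 0 < cos (pi * gamma / 2) ^+ 2 by rewrite exprn_gt0.
rewrite ler_pdivrMr// mulrAC ler_pdivlMr//.
apply: (@le_trans _ _ (x ^+ 3 * cos (pi * gamma / 2) ^+ 2)).
  by rewrite ler_pM2r.
by rewrite exprSr -mulrA ler_pM2l// exprn_gt0.
Qed.

End trigonometric_bounds.

Section trapezoidal_kernel.
Variables (R : realType) (gamma tau : R).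
Hypothesis (hg : 0 < gamma < 1) (tau0 : 0 < tau).

(** The Peano kernel of the trapezoidal rule on [[0, tau]]. *)
Definition pker (s : R) : R := s * (s - tau) / 2.

(** With [x = tau * la / 2] this is [(1 - x * cot x) / la], the constant of
    integration for which [qker_period] holds. Solving for it divides by
    [expi (la * tau) - 1], so it is singular at the resonances of the rule, the
    nonzero frequencies whose period is a fraction of [tau]. *)
Definition wker (la : R) : R :=
  (1 - tau * la / 2 * cos (tau * la / 2) / sin (tau * la / 2)) / la.

(** A primitive of [la ^+ 2 * pker s * expi (la * s)], by integrating twice by
    parts. *)
Definition gker (la s : R) : R[i] :=
  expi (la * s) * (- 'i * (la * pker s)%:C + (s - tau / 2)%:C + 'i * (la^-1)%:C).

(** The primitive of [la ^+ 2 * pker s * expi (la * s)] that is multiplied by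
    [expi (la * tau)] when [s] runs through a step. It can be continued from one
    step to the next, so the local errors of an oscillation of frequency [la] do
    not accumulate over many steps. *)
Definition qker (la s : R) : R[i] :=
  if la == 0 then 0 else 'i * (wker la)%:C + gker la s - gker la 0.

Definition cker : R := (4 * cos (pi * gamma / 2) ^+ 2)^-1 + 1.

Lemma cker_ge1 : 1 <= cker.
Proof. by rewrite /cker lerDr invr_ge0 mulr_ge0// sqr_ge0. Qed.

Lemma ii : 'i * 'i = -1 :> R[i].
Proof. by apply: complex_ext => /=; ring. Qed.

Lemma pker_deriv A Z m t : cderiv A Z (fun r => (pker (r - m))%:C) t
  ((t - m - tau / 2)%:C).
Proof.
have h1 := cderiv_shift A Z m t.
have h2 := cderiv_shift A Z (m + tau) t.
have := cderivZ (2^-1)%:C (cderivM h1 h2).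
have -> : (2^-1)%:C * (1 * (t - (m + tau))%:C + (t - m)%:C * 1) =
  (t - m - tau / 2)%:C.
  by apply: complex_ext => /=; field.
apply: cderiv_ext => r; rewrite /pker.
by apply: complex_ext => /=; field.
Qed.

Lemma cderivD0 A Z (f : R -> R[i]) k t l : cderiv A Z f t l ->
  cderiv A Z (fun r => f r + k) t l.
Proof. by move=> hf; have := cderivD hf (cderiv_cst A Z k t); rewrite addr0. Qed.

Lemma gker_deriv A Z la m t : la != 0 -> cderiv A Z (fun r => gker la (r - m)) t
  ((la ^+ 2 * pker (t - m))%:C * expi (la * (t - m))).
Proof.
move=> la0.
have h1 := cderiv_expi A Z la m t.
have h2 := cderivD0 ('i * (la^-1)%:C) (cderivD (cderivZ (- 'i * la%:C) (pker_deriv A Z m t))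
   (cderiv_shift A Z (m + tau / 2) t)).
have := cderivM h1 h2.
have E (u : R[i]) : 'i * la%:C * u * (- 'i * la%:C * (pker (t - m))%:C +
    (t - (m + tau / 2))%:C + 'i * (la^-1)%:C) +
    u * (- 'i * la%:C * (t - m - tau / 2)%:C + 1) =
    (la ^+ 2 * pker (t - m))%:C * u.
  by case: u => u v; apply: complex_ext => /=; field.
rewrite E.
apply: cderiv_ext => r; rewrite /gker.
by congr (_ * _); apply: complex_ext => /=; field.
Qed.

Lemma qker_deriv A Z la m t : cderiv A Z (fun r => qker la (r - m)) t
  ((la ^+ 2 * pker (t - m))%:C * expi (la * (t - m))).
Proof.
rewrite /qker; have [->|la0] := eqVneq la 0.
  by rewrite expr0n mul0r mul0r; exact: cderiv_cst.
apply: cderiv_ext (cderivD0 ('i * (wker la)%:C - gker la 0) (gker_deriv A Z m t la0)).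
by move=> r; ring.
Qed.

Lemma qker_period la : `|tau * la| <= 2 * pi * gamma ->
  qker la tau = expi (la * tau) * qker la 0.
Proof.
move=> hla; rewrite /qker; have [->|la0] := eqVneq la 0; first by rewrite mulr0.
pose x := tau * la / 2.
have x0 : x != 0.
  by rewrite /x !mulf_eq0 invr_eq0 pnatr_eq0 (gt_eqF tau0) (negbTE la0).
have hx : `|x| <= pi * gamma.
  by rewrite /x normrM (ger0_norm (_ : 0 <= 2^-1)) ?invr_ge0//; move: hla; lra.
have [sx _] := xcot_bound hg hx x0.
have E : expi (la * tau) = expi x * expi x by rewrite -expiD -splitr mulrC.
have cs : cos x ^+ 2 + sin x ^+ 2 - 1 = 0 by rewrite cos2Dsin2 subrr.
rewrite /gker /wker -/x E mulr0 expi0 /pker subrr !(mulr0, mul0r) /expi.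
have xE : x = tau * la / 2 by [].
move: sx cs; set c := cos x; set S := sin x => sx cs.
apply: complex_ext.
  apply/eqP; rewrite -subr_eq0; apply/eqP.
  transitivity (- (tau / 2) * (c ^+ 2 + S ^+ 2 - 1)); last by rewrite cs mulr0.
  by rewrite /= xE; field; rewrite sx la0.
apply/eqP; rewrite -subr_eq0; apply/eqP.
transitivity (x * c / S / la * (c ^+ 2 + S ^+ 2 - 1)); last by rewrite cs mulr0.
by rewrite /= xE; field; rewrite sx la0.
Qed.

(** The size [tau ^+ 2 * `|la|] is that of the error of a single oscillation; the
    factor [cker] blows up as [gamma] tends to 1, where [tau * la] reaches the
    resonance [2 * pi]. *)
Lemma qker_bound la s : `|tau * la| <= 2 * pi * gamma -> 0 <= s <= tau ->
  nC (qker la s) <= cker * (tau ^+ 2 * `|la|).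
Proof.
move=> hla hs; rewrite /qker.
have nn : 0 <= cker * (tau ^+ 2 * `|la|).
  rewrite mulr_ge0 ?(le_trans ler01 cker_ge1)// mulr_ge0 ?sqr_ge0//.
have [->|la0] := eqVneq la 0; first by rewrite nC0 normr0 !mulr0.
have pi0 := pi_gt0 R.
pose x := tau * la / 2.
have x0 : x != 0.
  by rewrite /x !mulf_eq0 invr_eq0 pnatr_eq0 (gt_eqF tau0) (negbTE la0).
have hx : `|x| <= pi * gamma.
  by rewrite /x normrM (ger0_norm (_ : 0 <= 2^-1)) ?invr_ge0//; move: hla; lra.
have [sx hw] := xcot_bound hg hx x0.
rewrite -addrA; apply: le_trans (nCD _ _) _; rewrite /cker mulrDl mul1r.
have na : 0 < `|la| by rewrite normr_gt0.
apply: lerD.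
  rewrite nCM nC_i mul1r nC_real /wker -/x normrM normfV ler_pdivrMr//.
  apply: le_trans hw _; rewrite le_eqVlt; apply/orP; left; apply/eqP.
  have ll : la ^+ 2 = `|la| ^+ 2 by rewrite real_normK ?num_real.
  have cq : cos (pi * gamma / 2) != 0.
    rewrite gt_eqF//; apply: cos_gt0_pihalf.
    case/andP: (hg) => g0 g1.
    have pg : 0 < pi * gamma by rewrite mulr_gt0.
    have pg' : pi * gamma < pi by rewrite gtr_pMr.
    lra.
  have -> : x ^+ 2 = tau ^+ 2 * `|la| ^+ 2 / 4 by rewrite -ll /x; field.
  by field.
pose F (i : unit) r := gker la (r - 0).
have hF (i : unit) t : 0 <= t <= s ->
  cderiv 0 s (F i) t ((la ^+ 2 * pker (t - 0))%:C * expi (la * (t - 0))).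
  by move=> _; exact: gker_deriv.
have := @mean_value_sum R unit [:: tt] F
  (fun _ t => (la ^+ 2 * pker (t - 0))%:C * expi (la * (t - 0))) 0 s (la ^+ 2 * (tau ^+ 2 / 8)).
case/andP: (hs) => s0 st.
move=> /(_ s0 hF); rewrite big_seq1 /F !subr0 => h.
apply: le_trans (h _) _.
  move=> t ht; rewrite big_seq1 nCM nC_expi mulr1 nC_real normrM ger0_norm ?sqr_ge0//.
  rewrite ler_wpM2l ?sqr_ge0// /pker subr0 ler_norml.
  have : 0 <= (t - tau / 2) ^+ 2 by rewrite sqr_ge0.
  have : 0 <= t * (tau - t) by apply: mulr_ge0; lra.
  by rewrite expr2; lra.
have : tau * `|la| <= 8.
  move: hla; rewrite normrM (gtr0_norm tau0) => hla; apply: le_trans hla _.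
  have := pihalf_lt2 R; have : pi * gamma <= pi by case/andP: (hg) => _ g1; rewrite ger_pMr// ltW.
  lra.
move=> h8.
have -> : la ^+ 2 = `|la| ^+ 2 by rewrite real_normK ?num_real.
apply: (@le_trans _ _ (`|la| ^+ 2 * (tau ^+ 2 / 8) * tau)).
  by rewrite ler_wpM2l// mulr_ge0 ?sqr_ge0// divr_ge0 ?sqr_ge0.
have -> : `|la| ^+ 2 * (tau ^+ 2 / 8) * tau = tau ^+ 2 * `|la| * (tau * `|la| / 8) by field.
rewrite ger_pMr ?mulr_gt0 ?exprn_gt0//; lra.
Qed.

End trapezoidal_kernel.

(** * The trapezoidal rule for slowly modulated oscillations *)

Section oscillatory_quadrature.
Variables (R : realType) (gamma tau Te : R).
Hypothesis (hg : 0 < gamma < 1) (tau0 : 0 < tau).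
Variables (I J : Type) (L : seq I) (Js : seq J).
Variables (La : I -> J -> R) (Am A1 A2 : I -> J -> R -> R[i]).
Variables (y r : I -> R -> R[i]) (B0 B1 B2 rho : R).

Definition osum i t : R[i] := \sum_(j <- Js) expi (La i j * t) * Am i j t.

Hypothesis hLa : forall i j, `|tau * La i j| <= 2 * pi * gamma.
Hypothesis dy : forall i t, 0 <= t <= Te ->
  cderiv 0 Te (y i) t (osum i t + r i t).
Hypothesis dA : forall i j t, 0 <= t <= Te -> cderiv 0 Te (Am i j) t (A1 i j t).
Hypothesis dA1 : forall i j t, 0 <= t <= Te -> cderiv 0 Te (A1 i j) t (A2 i j t).
Hypothesis hB0 : forall t, 0 <= t <= Te ->
  \sum_(i <- L) \sum_(j <- Js) `|La i j| * nC (Am i j t) <= B0.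
Hypothesis hB1 : forall t, 0 <= t <= Te ->
  \sum_(i <- L) \sum_(j <- Js) `|La i j| * nC (A1 i j t) <= B1.
Hypothesis hB2 : forall t, 0 <= t <= Te ->
  \sum_(i <- L) \sum_(j <- Js) nC (A2 i j t) <= B2.
Hypothesis hrho : forall t, 0 <= t <= Te -> \sum_(i <- L) nC (r i t) <= rho.

Let tk (k : nat) : R := k%:R * tau.

(** On the step starting at [tk k], the negative of a primitive of the mode [j] up
    to the remainder [rem]: two integrations by parts with [pker] produce the
    trapezoidal values at the ends, and [qker] absorbs the term in which both
    derivatives fall on the oscillating factor. *)
Let mode i j k t : R[i] := expi (La i j * tk k) *
  (expi (La i j * (t - tk k)) *
    (- (t - (tk k + tau / 2))%:C * Am i j t +
     (pker tau (t - tk k))%:C * ('i * (La i j)%:C * Am i j t + A1 i j t)) +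
   qker tau (La i j) (t - tk k) * Am i j t).

(** Only derivatives of the amplitudes are left. *)
Let rem i j k t : R[i] := expi (La i j * tk k) *
  (expi (La i j * (t - tk k)) *
    ((pker tau (t - tk k))%:C * (2 * 'i * (La i j)%:C * A1 i j t + A2 i j t)) +
   qker tau (La i j) (t - tk k) * A1 i j t).

Let mode_deriv i j k t : 0 <= t <= Te ->
  cderiv 0 Te (mode i j k) t (rem i j k t - expi (La i j * t) * Am i j t).
Proof.
move=> ht; set la := La i j; set m := tk k.
have dAt := dA i j ht; have dA1t := dA1 i j ht.
have de := cderiv_expi 0 Te la m t.
have ds := cderivZ (-1) (cderiv_shift 0 Te (m + tau / 2) t).
have dp := pker_deriv tau 0 Te m t.
have dq := qker_deriv tau 0 Te la m t.
have h := cderivZ (expi (la * m)) (cderivD (cderivM de (cderivD (cderivM ds dAt)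
  (cderivM dp (cderivD (cderivZ ('i * la%:C) dAt) dA1t)))) (cderivM dq dAt)).
have -> : rem i j k t - expi (la * t) * Am i j t = expi (la * m) *
  (expi (la * (t - m)) * ((pker tau (t - m))%:C *
    (2 * 'i * la%:C * A1 i j t + A2 i j t) - Am i j t) +
   qker tau la (t - m) * A1 i j t).
  have -> : la * t = la * m + la * (t - m) by ring.
  by rewrite expiD /rem -/la -/m; ring.
move: h; set D := (X in cderiv _ _ _ _ X -> _).
have -> : D = expi (la * m) *
  (expi (la * (t - m)) * ((pker tau (t - m))%:C *
    (2 * 'i * la%:C * A1 i j t + A2 i j t) - Am i j t) +
   qker tau la (t - m) * A1 i j t).
  rewrite /D; congr (_ * _).
  have -> : (t - (m + tau / 2))%:C = (t - m - tau / 2)%:C :> R[i].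
    by congr (_%:C); ring.
  have -> : (la ^+ 2 * pker tau (t - m))%:C = la%:C * la%:C * (pker tau (t - m))%:C :> R[i].
    by rewrite -!rmorphM; congr (_%:C); ring.
  move: (Am i j t) (A1 i j t) (A2 i j t) (expi (la * (t - m))) (la%:C)
    ((pker tau (t - m))%:C) ((t - m - tau / 2)%:C) (qker tau la (t - m)) => A A' A'' e l p s q.
  have key (ic : R[i]) : ic * ic + 1 = 0 ->
      ic * l * e * (-1 * s * A + p * (ic * l * A + A')) +
      e * (-1 * 1 * A + -1 * s * A' +
        (s * (ic * l * A + A') + p * (ic * l * A' + A''))) +
      (l * l * p * e * A + q * A') =
      e * (p * (2 * ic * l * A' + A'') - A) + q * A'.
    move=> hi; apply/eqP; rewrite -subr_eq0; apply/eqP.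
    transitivity ((ic * ic + 1) * (l * l * p * e * A)); last by rewrite hi mul0r.
    ring.
  by apply: key; rewrite ii addNr.
apply: cderiv_ext => u; rewrite /mode -/la -/m; ring.
Qed.

Let Kstep := rho + (tau ^+ 2 / 8 * (2 * B1 + B2) + cker gamma * tau ^+ 2 * B1).

Let rem_le i j k t : tk k <= t <= tk k.+1 ->
  nC (rem i j k t) <= tau ^+ 2 / 8 * (2 * (`|La i j| * nC (A1 i j t)) + nC (A2 i j t))
    + cker gamma * tau ^+ 2 * (`|La i j| * nC (A1 i j t)).
Proof.
move=> ht; rewrite /rem nCM nC_expi mul1r.
have hs : 0 <= t - tk k <= tau by move: ht; rewrite /tk -natr1 mulrDl mul1r; lra.
apply: le_trans (nCD _ _) _; apply: lerD; last first.
  rewrite nCM; apply: le_trans (ler_wpM2r (nC_ge0 _) (qker_bound hg tau0 (hLa i j) hs)) _.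
  by rewrite !mulrA.
rewrite !nCM nC_expi mul1r nC_real; apply: ler_pM; rewrite ?nC_ge0//.
  rewrite /pker ler_norml; move: hs; set s := t - tk k => hs.
  have : 0 <= (s - tau / 2) ^+ 2 by rewrite sqr_ge0.
  have : 0 <= s * (tau - s) by apply: mulr_ge0; lra.
  by rewrite !expr2; lra.
have n2 : nC (2 : R[i]) = 2.
  by rewrite -(rmorph_nat (real_complex R)) nC_real normr_nat.
by apply: le_trans (nCD _ _) _; rewrite lerD2r !nCM nC_i nC_real n2 mulr1 mulrA.
Qed.

Let step_le k : tk k.+1 <= Te ->
  \sum_(i <- L) nC (y i (tk k.+1) - y i (tk k)
    + \sum_(j <- Js) (mode i j k (tk k.+1) - mode i j k (tk k))) <= Kstep * tau.
Proof.
move=> hk.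
have tkS : tk k.+1 = tk k + tau by rewrite /tk -natr1 mulrDl mul1r.
have tk0 : 0 <= tk k by rewrite /tk mulr_ge0// ltW.
have kk : tk k <= tk k.+1 by rewrite tkS lerDl ltW.
pose F i t := y i t + \sum_(j <- Js) mode i j k t.
pose F' i t := r i t + \sum_(j <- Js) rem i j k t.
have hF i t : tk k <= t <= tk k.+1 -> cderiv (tk k) (tk k.+1) (F i) t (F' i t).
  move=> ht; have ht' : 0 <= t <= Te by lra.
  apply: (cderiv_sub tk0 hk).
  have := cderivD (dy i ht') (cderiv_sum Js (fun j => mode_deriv i j k ht')).
  have -> // : F' i t = osum i t + r i t +
    \sum_(j <- Js) (rem i j k t - expi (La i j * t) * Am i j t).
  by rewrite sumrB /F' /osum; ring.
have hK t : tk k <= t <= tk k.+1 -> \sum_(i <- L) nC (F' i t) <= Kstep.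
  move=> ht; have ht' : 0 <= t <= Te by lra.
  apply: (@le_trans _ _ (\sum_(i <- L) (nC (r i t) + \sum_(j <- Js) (
    tau ^+ 2 / 8 * (2 * (`|La i j| * nC (A1 i j t)) + nC (A2 i j t))
    + cker gamma * tau ^+ 2 * (`|La i j| * nC (A1 i j t)))))).
    apply: ler_sum => i _; apply: le_trans (nCD _ _) _; rewrite lerD2l.
    by apply: le_trans (nC_sum _ _ _) _; apply: ler_sum => j _; exact: rem_le.
  rewrite big_split /=; apply: lerD; first exact: hrho.
  under eq_bigr do rewrite big_split /= -!mulr_sumr big_split /= -mulr_sumr.
  rewrite big_split /= -!mulr_sumr big_split /= -mulr_sumr.
  have c0 : 0 <= cker gamma * tau ^+ 2.
    by rewrite mulr_ge0 ?sqr_ge0// (le_trans ler01)// cker_ge1.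
  apply: lerD; last by rewrite ler_wpM2l// hB1.
  rewrite ler_wpM2l ?divr_ge0 ?sqr_ge0//.
  by apply: lerD; [rewrite ler_wpM2l// hB1|exact: hB2].
have := mean_value_sum kk hF hK.
rewrite tkS addrAC subrr add0r; apply: le_trans.
rewrite -tkS; apply: ler_sum => i _; rewrite le_eqVlt; apply/orP; left; apply/eqP.
by congr nC; rewrite /F sumrB; ring.
Qed.

(* The values of the corrector at the nodes; they telescope by [qker_period]. *)
Let zk i k : R[i] := \sum_(j <- Js) expi (La i j * tk k) * qker tau (La i j) 0 * Am i j (tk k).

Let mode_ends i k : \sum_(j <- Js) (mode i j k (tk k.+1) - mode i j k (tk k)) =
  zk i k.+1 - zk i k - (tau / 2)%:C * (osum i (tk k) + osum i (tk k.+1)).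
Proof.
rewrite /zk /osum -sumrB -big_split /= mulr_sumr -sumrB; apply: eq_bigr => j _.
have tkS : tk k.+1 = tk k + tau by rewrite /tk -natr1 mulrDl mul1r.
rewrite /mode tkS subrr addrAC subrr add0r mulr0 expi0 /pker subrr !(mul0r, mulr0).
rewrite (qker_period hg tau0 (hLa i j)).
have -> : expi (La i j * (tk k + tau)) = expi (La i j * tk k) * expi (La i j * tau) :> R[i].
  by rewrite mulrDr expiD.
have -> : - (tk k + tau - (tk k + tau / 2))%:C = - (tau / 2)%:C :> R[i].
  by congr (- _%:C); field.
have -> : - (tk k - (tk k + tau / 2))%:C = (tau / 2)%:C :> R[i].
  by rewrite -rmorphN; congr (_%:C); field.
ring.
Qed.

(** Without derivatives of the amplitudes the error consists of the boundary terms
    [zk] at times 0 and [n * tau], however many steps there are; the other terms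
    grow with time, but contain derivatives of the amplitudes or the
    nonoscillating part [r]. *)
Lemma oscillatory_trapezoid n : n%:R * tau <= Te ->
  \sum_(i <- L) nC (y i (n%:R * tau) - y i 0 -
     \sum_(k < n) (tau / 2)%:C * (osum i (k%:R * tau) + osum i (k.+1%:R * tau))) <=
  2 * cker gamma * tau ^+ 2 * B0 + n%:R * tau *
   (rho + (tau ^+ 2 / 8 * (2 * B1 + B2) + cker gamma * tau ^+ 2 * B1)).
Proof.
move=> hn; rewrite -/Kstep.
have tk_in k : (k <= n)%N -> 0 <= tk k <= Te.
  move=> kn; rewrite /tk mulr_ge0 ?(ltW tau0)//=; apply: le_trans hn.
  by rewrite ler_pM2r// ler_nat.
have tele : \sum_(i <- L) nC (y i (tk n) - y i 0 -
     \sum_(k < n) (tau / 2)%:C * (osum i (tk k) + osum i (tk k.+1))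
     + zk i n - zk i 0) <= n%:R * tau * Kstep.
  elim: n hn tk_in => [|n IH] hn tk_in.
    rewrite mul0r mul0r big1// => i _; rewrite big_ord0 /tk mul0r.
    have -> : y i 0 - y i 0 - 0 + zk i 0 - zk i 0 = 0 by ring.
    exact: nC0.
  have hn' : n%:R * tau <= Te by case/andP: (tk_in n (leqnSn n)).
  have {}IH := IH hn' (fun k kn => tk_in k (leqW kn)).
  have := lerD IH (step_le hn); rewrite -big_split /=.
  have -> : n%:R * tau * Kstep + Kstep * tau = n.+1%:R * tau * Kstep.
    by rewrite -natr1; ring.
  apply: le_trans; apply: ler_sum => i _; rewrite mode_ends big_ord_recr /=.
  apply: le_trans (nCD _ _); rewrite le_eqVlt; apply/orP; left; apply/eqP.
  by congr nC; ring.
have zle k : (k <= n)%N -> \sum_(i <- L) nC (zk i k) <= cker gamma * tau ^+ 2 * B0.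
  move=> kn.
  apply: (@le_trans _ _ (\sum_(i <- L) \sum_(j <- Js)
     cker gamma * tau ^+ 2 * (`|La i j| * nC (Am i j (tk k))))).
    apply: ler_sum => i _; apply: le_trans (nC_sum _ _ _) _; apply: ler_sum => j _.
    rewrite !nCM nC_expi mul1r mulrA ler_wpM2r ?nC_ge0// -mulrA.
    by apply: qker_bound => //; rewrite lexx (ltW tau0).
  under eq_bigr do rewrite -mulr_sumr; rewrite -mulr_sumr ler_wpM2l ?hB0 ?tk_in//.
  by rewrite mulr_ge0 ?sqr_ge0// (le_trans ler01)// cker_ge1.
have -> : 2 * cker gamma * tau ^+ 2 * B0 + n%:R * tau * Kstep =
  n%:R * tau * Kstep + (cker gamma * tau ^+ 2 * B0 + cker gamma * tau ^+ 2 * B0) by ring.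
have := lerD tele (lerD (zle n (leqnn n)) (zle 0%N (leq0n n))).
rewrite -!big_split /=; apply: le_trans; apply: ler_sum => i _.
set u := (X in nC X <= _); set v := (X in _ <= nC X + _).
have -> : u = v + (zk i 0 - zk i n) by rewrite /u /v; ring.
apply: le_trans (nCD _ _) _; rewrite lerD2l addrC; exact: nCB.
Qed.

End oscillatory_quadrature.

(** * Nonresonant modes of the cubic interaction *)

Section convolution_sums.
Variable R : realType.

Lemma triple_sum_le (X Y Z : int -> R) (BX BY BZ : R) (L s1 s2 : seq int) :
  (forall k, 0 <= X k) -> (forall k, 0 <= Y k) -> (forall k, 0 <= Z k) ->
  bsum X BX -> bsum Y BY -> bsum Z BZ -> uniq L -> uniq s1 -> uniq s2 ->
  \sum_(l <- L) \sum_(k1 <- s1) \sum_(k2 <- s2) X k1 * Y k2 * Z (l - k1 - k2)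
  <= BX * BY * BZ.
Proof.
move=> X0 Y0 Z0 hX hY hZ uL u1 u2.
rewrite exchange_big /=.
under eq_bigr do rewrite exchange_big /=.
apply: (@le_trans _ _ (\sum_(k1 <- s1) \sum_(k2 <- s2) X k1 * (Y k2 * BZ))).
  apply: ler_sum => k1 _; apply: ler_sum => k2 _.
  under eq_bigr do rewrite -mulrA; rewrite -mulr_sumr ler_wpM2l// -mulr_sumr ler_wpM2l//.
  have inj : injective (fun l : int => l - k1 - k2) by move=> i j; lia.
  exact: (bsum_reindex inj hZ).
under eq_bigr do rewrite -mulr_sumr -mulr_suml.
rewrite -mulr_suml -mulrA; apply: ler_pM; rewrite ?sumr_ge0 ?mulr_ge0 ?sumr_ge0//.
- exact: bsum_ge0 hZ.
- exact: hX.
- by apply: ler_wpM2r; [exact: bsum_ge0 hZ|exact: hY].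
Qed.

End convolution_sums.

Definition sgnR {R : realType} (s : bool) : R := if s then 1 else -1.

Section interaction_modes.
Variables (R : realType) (gamma tau eps T B rho d0 D : R) (N0 : nat).
Variables (del : int -> R) (c d NN N1 : int -> R -> R[i]).
Hypotheses (hg : 0 < gamma < 1) (tau0 : 0 < tau) (he : 0 < eps <= 1) (T0 : 0 < T).
Hypotheses (d00 : 0 < d0) (D0 : 0 <= D) (B0 : 0 <= B) (rho0 : 0 <= rho).
Hypothesis del_ge : forall l, d0 <= del l.
Hypothesis del_sub : forall k l, del (k + l) <= D * (del k * del l).
Hypothesis del_low : forall l : int, (`|l| <= N0)%N -> tau * del l <= gamma * pi / 2.
Let Te := T / eps ^+ 2.
Hypothesis dc : forall l t, 0 <= t <= Te -> cderiv 0 Te (c l) t (d l t).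
Hypothesis dd : forall l t, 0 <= t <= Te -> cderiv 0 Te (d l) t
  (- ((del l ^+ 2)%:C * c l t) - (eps ^+ 2)%:C * NN l t).
Hypothesis dN : forall l t, 0 <= t <= Te -> cderiv 0 Te (NN l) t (N1 l t).
Hypothesis bc : forall t, 0 <= t <= Te -> bsum (fun l => del l * nC (c l t)) B.
Hypothesis bd : forall t, 0 <= t <= Te -> bsum (fun l => nC (d l t)) B.
Hypothesis bN : forall t, 0 <= t <= Te -> bsum (fun l => nC (NN l t)) B.
Hypothesis bN1 : forall t, 0 <= t <= Te -> bsum (fun l => nC (N1 l t)) B.

(** Both the factors and the product are truncated: then only finitely many
    phases occur, all of them made of resolved frequencies. *)
Definition lowc l t : R[i] := if (`|l| <= N0)%N then c l t else 0.

Definition Nlow l t : R[i] := if (`|l| <= N0)%N then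
  \sum_(k1 <- lowseq N0) \sum_(k2 <- lowseq N0) c k1 t * c k2 t * lowc (l - k1 - k2) t
  else 0.

Hypothesis brho : forall t, 0 <= t <= Te -> bsum (fun l => nC (NN l t - Nlow l t)) rho.

Let del0 l : 0 < del l. Proof. exact: lt_le_trans (del_ge l). Qed.
Let ndV l : `|(del l)^-1| = (del l)^-1.
Proof. by rewrite gtr0_norm// invr_gt0. Qed.
Let sg (s : bool) : R[i] := (sgnR s)%:C.
Let sgsg s : sg s * sg s = 1.
Proof. by rewrite /sg /sgnR; case: s; apply: complex_ext => /=; ring. Qed.
Let nsg s : nC (sg s) = 1.
Proof. by rewrite /sg nC_real /sgnR; case: s; rewrite ?normrN normr1. Qed.

(** The waves that travel in the two directions; [chi] is constant along the linear
    flow, so that its time derivatives are of order [eps ^+ 2]. *)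
Definition trav (s : bool) l t : R[i] := c l t - sg s * 'i * ((del l)^-1)%:C * d l t.
Definition chi (s : bool) l t : R[i] :=
  expi (- (sgnR s * del l) * (t - 0)) * trav s l t.
Let chi1 (s : bool) l t : R[i] := expi (- (sgnR s * del l) * (t - 0)) *
  (sg s * 'i * (eps ^+ 2)%:C * ((del l)^-1)%:C * NN l t).
Let chi2 (s : bool) l t : R[i] := expi (- (sgnR s * del l) * (t - 0)) *
  (sg s * 'i * (eps ^+ 2)%:C * ((del l)^-1)%:C *
    (N1 l t - sg s * 'i * (del l)%:C * NN l t)).

Let dchi s l t : 0 <= t <= Te -> cderiv 0 Te (chi s l) t (chi1 s l t).
Proof.
move=> ht; have h := cderivM (cderiv_expi 0 Te (- (sgnR s * del l)) 0 t)
  (cderivD (dc l ht) (cderivZ (- (sg s * 'i * ((del l)^-1)%:C)) (dd l ht))).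
have E : chi1 s l t = 'i * (- (sgnR s * del l))%:C * expi (- (sgnR s * del l) * (t - 0)) *
  (c l t + - (sg s * 'i * ((del l)^-1)%:C) * d l t) +
  expi (- (sgnR s * del l) * (t - 0)) * (d l t + - (sg s * 'i * ((del l)^-1)%:C) *
  (- ((del l ^+ 2)%:C * c l t) - (eps ^+ 2)%:C * NN l t)).
  rewrite /chi1.
  have -> : (- (sgnR s * del l))%:C = - (sg s * (del l)%:C) by rewrite rmorphN rmorphM.
  have -> : (del l ^+ 2)%:C = (del l)%:C * (del l)%:C by rewrite expr2 rmorphM.
  have dV : (del l)%:C * ((del l)^-1)%:C = 1 by rewrite -rmorphM mulfV ?gt_eqF.
  move: (expi _) (c l t) (d l t) (NN l t) (sg s) (sgsg s) ((del l)%:C) (((del l)^-1)%:C)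
    ((eps ^+ 2)%:C) dV => e cc dd' n g gg de dv ee dV.
  have key (ic : R[i]) : ic * ic = -1 -> e * (g * ic * ee * dv * n) =
    ic * - (g * de) * e * (cc + - (g * ic * dv) * dd') +
    e * (dd' + - (g * ic * dv) * (- (de * de * cc) - ee * n)).
    move=> hi; transitivity (e * (g * ic * ee * dv * n) + e * g * ic * de * cc * (de * dv - 1)
       + e * dd' * ((ic * ic) * (g * g) * (de * dv) + 1)); last by ring.
    by rewrite dV hi gg; ring.
  exact: key (ii R).
rewrite E; apply: cderiv_ext h => u; rewrite /chi /trav; ring.
Qed.

Let dchi1 s l t : 0 <= t <= Te -> cderiv 0 Te (chi1 s l) t (chi2 s l t).
Proof.
move=> ht; have h := cderivM (cderiv_expi 0 Te (- (sgnR s * del l)) 0 t)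
  (cderivZ (sg s * 'i * (eps ^+ 2)%:C * ((del l)^-1)%:C) (dN l ht)).
have -> : chi2 s l t = 'i * (- (sgnR s * del l))%:C * expi (- (sgnR s * del l) * (t - 0)) *
  (sg s * 'i * (eps ^+ 2)%:C * ((del l)^-1)%:C * NN l t) +
  expi (- (sgnR s * del l) * (t - 0)) *
  (sg s * 'i * (eps ^+ 2)%:C * ((del l)^-1)%:C * N1 l t).
  rewrite /chi2.
  have -> : (- (sgnR s * del l))%:C = - (sg s * (del l)%:C) by rewrite rmorphN rmorphM.
  ring.
exact: h.
Qed.

Let P l t := del l * nC (c l t) + nC (d l t).
Let P1 l t := eps ^+ 2 * nC (NN l t).
Let P2 l t := eps ^+ 2 * (d0^-1 * nC (N1 l t) + nC (NN l t)).

Let P_ge0 l t : 0 <= P l t.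
Proof. by rewrite addr_ge0 ?mulr_ge0 ?nC_ge0 ?(ltW (del0 l)). Qed.
Let P1_ge0 l t : 0 <= P1 l t.
Proof. by rewrite mulr_ge0 ?nC_ge0 ?sqr_ge0. Qed.
Let P2_ge0 l t : 0 <= P2 l t.
Proof.
rewrite /P2 mulr_ge0 ?sqr_ge0// addr_ge0 ?nC_ge0// mulr_ge0 ?nC_ge0//.
by rewrite invr_ge0 ltW.
Qed.

Let nchi s l t : del l * nC (chi s l t) <= P l t.
Proof.
rewrite /chi nCM nC_expi mul1r /trav /P.
apply: le_trans (ler_wpM2l (ltW (del0 l)) (nCB _ _)) _.
rewrite mulrDr lerD2l !nCM nsg nC_i !mul1r nC_real mulrA ndV.
by rewrite mulfV ?mul1r// gt_eqF.
Qed.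

Let nchi1 s l t : del l * nC (chi1 s l t) = P1 l t.
Proof.
rewrite /chi1 !nCM nC_expi nsg nC_i !mul1r !nC_real ndV.
rewrite ger0_norm ?sqr_ge0// /P1.
by field; rewrite gt_eqF.
Qed.

Let nchi2 s l t : nC (chi2 s l t) <= P2 l t.
Proof.
rewrite /chi2 !nCM nC_expi nsg nC_i !mul1r !nC_real ndV.
rewrite ger0_norm ?sqr_ge0// /P2 -mulrA ler_wpM2l ?sqr_ge0//.
apply: le_trans (ler_wpM2l (_ : 0 <= (del l)^-1) (nCB _ _)) _.
  by rewrite invr_ge0 ltW.
rewrite mulrDr !nCM nsg nC_i !mul1r nC_real gtr0_norm// mulKf ?gt_eqF// lerD2r.
by apply: ler_wpM2r; [exact: nC_ge0|rewrite lef_pV2 ?posrel ?del_ge//; exact: del0].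
Qed.

Let bP t : 0 <= t <= Te -> bsum (P ^~ t) (B + B).
Proof. by move=> ht; exact: bsumD (bc ht) (bd ht). Qed.
Let bP1 t : 0 <= t <= Te -> bsum (P1 ^~ t) (eps ^+ 2 * B).
Proof. by move=> ht; apply: bsumZ (bN ht); rewrite sqr_ge0. Qed.
Let bP2 t : 0 <= t <= Te -> bsum (P2 ^~ t) (eps ^+ 2 * (d0^-1 * B + B)).
Proof.
move=> ht; apply: bsumZ; first by rewrite sqr_ge0.
by apply: bsumD (bN ht); apply: bsumZ (bN1 ht); rewrite invr_ge0 ltW.
Qed.

Let CL := 3 * d0 ^- 2 + D ^+ 2.
Let CL0 : 0 <= CL.
Proof.
by rewrite addr_ge0 ?sqr_ge0// mulr_ge0// invr_ge0 exprn_ge0// ltW.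
Qed.

Variable s : bool.

Let mode := (int * int * (bool * (bool * bool)))%type.
Let bb := [:: true; false].
Let Js : seq mode := [seq (kk, ss) | kk <- [seq (k1, k2) | k1 <- lowseq N0, k2 <- lowseq N0],
  ss <- [seq (s1, s23) | s1 <- bb, s23 <- [seq (s2, s3) | s2 <- bb, s3 <- bb]]].

Let sumJs (A : zmodType) (F : mode -> A) : \sum_(j <- Js) F j =
  \sum_(k1 <- lowseq N0) \sum_(k2 <- lowseq N0)
   \sum_(s1 <- bb) \sum_(s2 <- bb) \sum_(s3 <- bb) F (k1, k2, (s1, (s2, s3))).
Proof.
rewrite /Js big_allpairs big_allpairs; apply: eq_bigr => k1 _; apply: eq_bigr => k2 _.
by rewrite big_allpairs; apply: eq_bigr => s1 _; rewrite big_allpairs.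
Qed.

Let valid (l : int) (j : mode) : bool := let: ((k1, k2), _) := j in
  [&& `|l| <= N0, `|k1| <= N0, `|k2| <= N0 & `|(l - k1 - k2)%R| <= N0]%N.

Let La (l : int) (j : mode) : R := let: ((k1, k2), (s1, (s2, s3))) := j in
  if valid l j then sgnR s1 * del k1 + sgnR s2 * del k2 + sgnR s3 * del (l - k1 - k2)
     - sgnR s * del l else 0.

Let kap : R[i] := sg s * 'i * (eps ^+ 2)%:C * (8^-1)%:C.

Let Am (l : int) (j : mode) t : R[i] := let: ((k1, k2), (s1, (s2, s3))) := j in
  if valid l j then kap * (chi s1 k1 t * chi s2 k2 t * chi s3 (l - k1 - k2) t) else 0.

Let A1 (l : int) (j : mode) t : R[i] := let: ((k1, k2), (s1, (s2, s3))) := j in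
  let k3 := l - k1 - k2 in
  if valid l j then kap * ((chi1 s1 k1 t * chi s2 k2 t + chi s1 k1 t * chi1 s2 k2 t) * chi s3 k3 t
     + chi s1 k1 t * chi s2 k2 t * chi1 s3 k3 t) else 0.

Let A2 (l : int) (j : mode) t : R[i] := let: ((k1, k2), (s1, (s2, s3))) := j in
  let k3 := l - k1 - k2 in
  if valid l j then kap * (((chi2 s1 k1 t * chi s2 k2 t + chi1 s1 k1 t * chi1 s2 k2 t) +
      (chi1 s1 k1 t * chi1 s2 k2 t + chi s1 k1 t * chi2 s2 k2 t)) * chi s3 k3 t
     + (chi1 s1 k1 t * chi s2 k2 t + chi s1 k1 t * chi1 s2 k2 t) * chi1 s3 k3 t
     + ((chi1 s1 k1 t * chi s2 k2 t + chi s1 k1 t * chi1 s2 k2 t) * chi1 s3 k3 t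
     + chi s1 k1 t * chi s2 k2 t * chi2 s3 k3 t)) else 0.

Let dAm l j t : 0 <= t <= Te -> cderiv 0 Te (Am l j) t (A1 l j t).
Proof.
case: j => -[k1 k2] [s1 [s2 s3]] ht; rewrite /Am /A1; case: valid; last exact: cderiv_cst.
by apply: cderivZ; apply: cderivM; [apply: cderivM; exact: dchi|exact: dchi].
Qed.

Let dA1 l j t : 0 <= t <= Te -> cderiv 0 Te (A1 l j) t (A2 l j t).
Proof.
case: j => -[k1 k2] [s1 [s2 s3]] ht; rewrite /A2 /A1; case: valid; last exact: cderiv_cst.
have h1 x k := dchi x k ht; have h2 x k := dchi1 x k ht.
apply: cderivZ; apply: cderivD.
  by apply: cderivM => //; apply: cderivD; exact: cderivM.
by apply: cderivM => //; exact: cderivM.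
Qed.

Let nsgnR x : `|sgnR x : R| = 1.
Proof. by case: x; rewrite /sgnR ?normrN normr1. Qed.

Let tri4 (x1 x2 x3 x4 : R) : `|x1 + x2 + x3 - x4| <= `|x1| + `|x2| + `|x3| + `|x4|.
Proof.
apply: le_trans (ler_normB _ _) _; rewrite lerD2r.
by apply: le_trans (ler_normD _ _) _; rewrite lerD2r; exact: ler_normD.
Qed.

(** The combined phase of four resolved frequencies stays below the first
    resonance of the trapezoidal rule. *)
Let hLa l j : `|tau * La l j| <= 2 * pi * gamma.
Proof.
case: j => -[k1 k2] [s1 [s2 s3]]; rewrite /La.
case V: valid; last first.
  case/andP: hg => g0 _.
  by rewrite mulr0 normr0 !mulr_ge0// ?pi_ge0// ltW.
move: V => /and4P[h1 h2 h3 h4].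
rewrite normrM (gtr0_norm tau0).
apply: le_trans (ler_wpM2l (ltW tau0) (tri4 _ _ _ _)) _.
rewrite !normrM !nsgnR !mul1r !(gtr0_norm (del0 _)).
have := del_low h1; have := del_low h2; have := del_low h3; have := del_low h4.
lra.
Qed.

(** The phase factor costs one weight [del] on each of the three waves; this is
    affordable in the energy norm. *)
Let La_le l k1 k2 s1 s2 s3 : `|La l (k1, k2, (s1, (s2, s3)))| <=
  CL * (del k1 * del k2 * del (l - k1 - k2)).
Proof.
have nn k : 0 <= del k by exact: ltW.
rewrite /La; case V: valid; last by rewrite normr0 mulr_ge0// !mulr_ge0.
set k3 := l - k1 - k2.
apply: le_trans (tri4 _ _ _ _) _.
rewrite !normrM !nsgnR !mul1r !(gtr0_norm (del0 _)).
have two x y z : d0 <= x -> d0 <= y -> 0 <= z -> z <= d0 ^- 2 * (x * y * z).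
  move=> hx hy z0; rewrite mulrA ler_peMl// mulrC ler_pdivlMr ?exprn_gt0// mul1r expr2.
  by apply: ler_pM => //; exact: ltW.
have h1 := two _ _ _ (del_ge k2) (del_ge k3) (nn k1).
have h2 := two _ _ _ (del_ge k1) (del_ge k3) (nn k2).
have h3 := two _ _ _ (del_ge k1) (del_ge k2) (nn k3).
have h4 : del l <= D ^+ 2 * (del k1 * del k2 * del k3).
  have -> : l = k1 + (k2 + k3) by rewrite /k3 [k2 + _]addrC subrK addrC subrK.
  apply: le_trans (del_sub _ _) _.
  have -> : D ^+ 2 * (del k1 * del k2 * del k3) =
    D * (del k1 * (D * (del k2 * del k3))) by ring.
  by rewrite ler_wpM2l// ler_wpM2l.
rewrite /CL mulrDl.
have -> : 3 * d0 ^- 2 * (del k1 * del k2 * del k3) = d0 ^- 2 * (del k2 * del k3 * del k1)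
  + d0 ^- 2 * (del k1 * del k3 * del k2) + d0 ^- 2 * (del k1 * del k2 * del k3) by ring.
by rewrite !lerD.
Qed.

Let nkap : nC kap = eps ^+ 2 / 8.
Proof.
rewrite /kap !nCM nsg nC_i !mul1r !nC_real !ger0_norm ?sqr_ge0// invr_ge0//.
Qed.

Let nCM3 (x y z : R[i]) : nC (x * y * z) = nC x * nC y * nC z.
Proof. by rewrite !nCM. Qed.

Let sum8 (x : R) : \sum_(s1 <- bb) \sum_(s2 <- bb) \sum_(s3 <- bb) x = 8 * x.
Proof. by rewrite /bb !big_cons !big_nil; ring. Qed.

Let sumJs_le (L : seq int) (X : int -> int -> int -> R) (F : int -> mode -> R) :
  (forall l k1 k2 s1 s2 s3, F l (k1, k2, (s1, (s2, s3))) <= X k1 k2 (l - k1 - k2)) ->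
  \sum_(l <- L) \sum_(j <- Js) F l j <=
  8 * \sum_(l <- L) \sum_(k1 <- lowseq N0) \sum_(k2 <- lowseq N0) X k1 k2 (l - k1 - k2).
Proof.
move=> h; rewrite mulr_sumr; apply: ler_sum => l _; rewrite sumJs mulr_sumr.
apply: ler_sum => k1 _; rewrite mulr_sumr; apply: ler_sum => k2 _.
by rewrite -sum8; apply: ler_sum => s1 _; apply: ler_sum => s2 _; apply: ler_sum => s3 _.
Qed.

Variable L : seq int.
Hypothesis uL : uniq L.

Let b0 := CL * (B + B) ^+ 3.
Let b1 := CL * (3 * B * (B + B) ^+ 2).
Let b2 := 3 * (d0^-1 * B + B) * (d0^-1 * (B + B)) ^+ 2 +
  6 * (d0^-1 * B) ^+ 2 * (d0^-1 * (B + B)).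

Let SS (f : int -> int -> int -> R) : R :=
  \sum_(l <- L) \sum_(k1 <- lowseq N0) \sum_(k2 <- lowseq N0) f k1 k2 (l - k1 - k2).

Let SSD f g : SS (fun k1 k2 k3 => f k1 k2 k3 + g k1 k2 k3) = SS f + SS g.
Proof.
rewrite /SS -big_split; apply: eq_bigr => l _; rewrite -big_split; apply: eq_bigr => k1 _.
by rewrite -big_split; apply: eq_bigr.
Qed.

Let SSZ x f : SS (fun k1 k2 k3 => x * f k1 k2 k3) = x * SS f.
Proof.
rewrite /SS mulr_sumr; apply: eq_bigr => l _; rewrite mulr_sumr; apply: eq_bigr => k1 _.
by rewrite mulr_sumr.
Qed.

Let SS_le (X Y Z : int -> R) (BX BY BZ : R) : (forall k, 0 <= X k) -> (forall k, 0 <= Y k) ->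
  (forall k, 0 <= Z k) -> bsum X BX -> bsum Y BY -> bsum Z BZ ->
  SS (fun k1 k2 k3 => X k1 * Y k2 * Z k3) <= BX * BY * BZ.
Proof. by move=> *; apply: triple_sum_le => //; exact: lowseq_uniq. Qed.

Let e8 : 0 <= eps ^+ 2 / 8. Proof. by rewrite divr_ge0 ?sqr_ge0. Qed.
Let nn k : 0 <= del k. Proof. exact: ltW. Qed.

Local Ltac pos := repeat first [exact: P_ge0 | exact: P1_ge0 | exact: P2_ge0
  | exact: nC_ge0 | exact: sqr_ge0 | assumption | exact: nn | exact: ler0n
  | exact: CL0 | exact: e8
  | apply: mulr_ge0 | apply: addr_ge0].

Let hB0 t : 0 <= t <= Te ->
  \sum_(l <- L) \sum_(j <- Js) `|La l j| * nC (Am l j t) <= eps ^+ 2 * b0.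
Proof.
move=> ht.
apply: (@le_trans _ _ (8 * SS (fun k1 k2 k3 => eps ^+ 2 / 8 * CL *
    (P k1 t * P k2 t * P k3 t)))).
  apply: (@sumJs_le L (fun k1 k2 k3 => _) (fun l j => `|La l j| * nC (Am l j t))) => l k1 k2 s1 s2 s3.
  apply: le_trans (ler_wpM2r (nC_ge0 _) (La_le _ _ _ _ _ _)) _.
  rewrite /Am; case: valid; last first.
    by rewrite nC0 mulr0; pos.
  rewrite nCM nkap nCM3; set k3 := l - k1 - k2.
  have -> : CL * (del k1 * del k2 * del k3) * (eps ^+ 2 / 8 *
     (nC (chi s1 k1 t) * nC (chi s2 k2 t) * nC (chi s3 k3 t))) =
     eps ^+ 2 / 8 * CL * ((del k1 * nC (chi s1 k1 t)) * (del k2 * nC (chi s2 k2 t)) *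
       (del k3 * nC (chi s3 k3 t))) by ring.
  apply: ler_wpM2l; first by pos.
  by repeat (apply: ler_pM; try by pos); exact: nchi.
rewrite SSZ.
have h := SS_le (P_ge0 ^~ t) (P_ge0 ^~ t) (P_ge0 ^~ t) (bP ht) (bP ht) (bP ht).
apply: (@le_trans _ _ (8 * (eps ^+ 2 / 8 * CL * ((B + B) * (B + B) * (B + B))))).
  by apply: ler_wpM2l => //; apply: ler_wpM2l => //; pos.
by rewrite /b0 le_eqVlt; apply/orP; left; apply/eqP; field.
Qed.

Let hB1 t : 0 <= t <= Te ->
  \sum_(l <- L) \sum_(j <- Js) `|La l j| * nC (A1 l j t) <= eps ^+ 4 * b1.
Proof.
move=> ht.
apply: (@le_trans _ _ (8 * SS (fun k1 k2 k3 => eps ^+ 2 / 8 * CL *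
    (P1 k1 t * P k2 t * P k3 t + P k1 t * P1 k2 t * P k3 t + P k1 t * P k2 t * P1 k3 t)))).
  apply: (@sumJs_le L (fun k1 k2 k3 => _) (fun l j => `|La l j| * nC (A1 l j t))) => l k1 k2 s1 s2 s3.
  apply: le_trans (ler_wpM2r (nC_ge0 _) (La_le _ _ _ _ _ _)) _.
  rewrite /A1; case: valid; last first.
    by rewrite nC0 mulr0; pos.
  set k3 := l - k1 - k2; rewrite nCM nkap.
  set x1 := chi1 s1 k1 t; set x2 := chi1 s2 k2 t; set x3 := chi1 s3 k3 t.
  set y1 := chi s1 k1 t; set y2 := chi s2 k2 t; set y3 := chi s3 k3 t.
  have h : nC ((x1 * y2 + y1 * x2) * y3 + y1 * y2 * x3) <=
    nC x1 * nC y2 * nC y3 + nC y1 * nC x2 * nC y3 + nC y1 * nC y2 * nC x3.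
    apply: le_trans (nCD _ _) _; rewrite nCM3 lerD2r -mulrDl nCM ler_wpM2r ?nC_ge0//.
    by apply: le_trans (nCD _ _) _; rewrite -!nCM.
  apply: (@le_trans _ _ (CL * (del k1 * del k2 * del k3) * (eps ^+ 2 / 8 * (
    nC x1 * nC y2 * nC y3 + nC y1 * nC x2 * nC y3 + nC y1 * nC y2 * nC x3)))).
    by apply: ler_wpM2l; [pos|apply: ler_wpM2l].
  have -> : CL * (del k1 * del k2 * del k3) * (eps ^+ 2 / 8 * (
    nC x1 * nC y2 * nC y3 + nC y1 * nC x2 * nC y3 + nC y1 * nC y2 * nC x3)) =
    eps ^+ 2 / 8 * CL * ((del k1 * nC x1) * (del k2 * nC y2) * (del k3 * nC y3) +
     (del k1 * nC y1) * (del k2 * nC x2) * (del k3 * nC y3) +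
     (del k1 * nC y1) * (del k2 * nC y2) * (del k3 * nC x3)) by ring.
  rewrite /x1 /x2 /x3 !nchi1; apply: ler_wpM2l; first by pos.
  by repeat apply: lerD; repeat (apply: ler_pM; try by pos); try exact: nchi.
rewrite SSZ !SSD.
have h1 := SS_le (P1_ge0 ^~ t) (P_ge0 ^~ t) (P_ge0 ^~ t) (bP1 ht) (bP ht) (bP ht).
have h2 := SS_le (P_ge0 ^~ t) (P1_ge0 ^~ t) (P_ge0 ^~ t) (bP ht) (bP1 ht) (bP ht).
have h3 := SS_le (P_ge0 ^~ t) (P_ge0 ^~ t) (P1_ge0 ^~ t) (bP ht) (bP ht) (bP1 ht).
have c0 : 0 <= eps ^+ 2 / 8 * CL by pos.
apply: le_trans (ler_wpM2l _ (ler_wpM2l c0 (lerD (lerD h1 h2) h3))) _ => //.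
by rewrite /b1 le_eqVlt; apply/orP; left; apply/eqP; field.
Qed.

Let PV l t := d0^-1 * P l t.
Let PV1 l t := d0^-1 * P1 l t.
Let dV0 : 0 <= d0^-1. Proof. by rewrite invr_ge0 ltW. Qed.
Let PV_ge0 l t : 0 <= PV l t. Proof. by rewrite /PV; pos. Qed.
Let PV1_ge0 l t : 0 <= PV1 l t. Proof. by rewrite /PV1; pos. Qed.

Let nPV x l t : nC (chi x l t) <= PV l t.
Proof.
rewrite /PV mulrC ler_pdivlMr//; apply: le_trans (nchi x l t).
by rewrite mulrC ler_wpM2r ?nC_ge0.
Qed.

Let nPV1 x l t : nC (chi1 x l t) <= PV1 l t.
Proof.
rewrite /PV1 mulrC ler_pdivlMr// -(nchi1 x l t).
by rewrite mulrC ler_wpM2r ?nC_ge0.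
Qed.

Let hB2 t : 0 <= t <= Te ->
  \sum_(l <- L) \sum_(j <- Js) nC (A2 l j t) <= eps ^+ 4 * b2.
Proof.
move=> ht.
apply: (@le_trans _ _ (8 * SS (fun k1 k2 k3 => eps ^+ 2 / 8 *
    (P2 k1 t * PV k2 t * PV k3 t + PV k1 t * P2 k2 t * PV k3 t + PV k1 t * PV k2 t * P2 k3 t
     + 2 * (PV1 k1 t * PV1 k2 t * PV k3 t + PV1 k1 t * PV k2 t * PV1 k3 t
         + PV k1 t * PV1 k2 t * PV1 k3 t))))).
  apply: (@sumJs_le L (fun k1 k2 k3 => _) (fun l j => nC (A2 l j t))) => l k1 k2 s1 s2 s3.
  rewrite /A2; case: valid; last first.
    by rewrite nC0; repeat first [exact: PV_ge0 | exact: PV1_ge0 | pos].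
  set k3 := l - k1 - k2; rewrite nCM nkap ler_wpM2l//.
  have q1 := nchi2 s1 k1 t; have q2 := nchi2 s2 k2 t; have q3 := nchi2 s3 k3 t.
  have x1 := nPV1 s1 k1 t; have x2 := nPV1 s2 k2 t; have x3 := nPV1 s3 k3 t.
  have y1 := nPV s1 k1 t; have y2 := nPV s2 k2 t; have y3 := nPV s3 k3 t.
  have M3 (u v w : R[i]) (U V W : R) : nC u <= U -> nC v <= V -> nC w <= W ->
    nC (u * v * w) <= U * V * W.
    by move=> hu hv hw; rewrite nCM3; repeat (apply: ler_pM => //; try by pos).
  rewrite [X in nC X](_ : _ =
     chi2 s1 k1 t * chi s2 k2 t * chi s3 k3 t + chi s1 k1 t * chi2 s2 k2 t * chi s3 k3 t
     + chi s1 k1 t * chi s2 k2 t * chi2 s3 k3 t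
     + (chi1 s1 k1 t * chi1 s2 k2 t * chi s3 k3 t + chi1 s1 k1 t * chi s2 k2 t * chi1 s3 k3 t
         + chi s1 k1 t * chi1 s2 k2 t * chi1 s3 k3 t)
     + (chi1 s1 k1 t * chi1 s2 k2 t * chi s3 k3 t + chi1 s1 k1 t * chi s2 k2 t * chi1 s3 k3 t
         + chi s1 k1 t * chi1 s2 k2 t * chi1 s3 k3 t)); last by ring.
  have D3 (u v w : R[i]) (U V W : R) : nC u <= U -> nC v <= V -> nC w <= W ->
    nC (u + v + w) <= U + V + W.
    move=> hu hv hw; apply: le_trans (nCD _ _) _; apply: lerD hw.
    by apply: le_trans (nCD _ _) _; exact: lerD.
  rewrite mulr2n mulrDl mul1r [leRHS]addrA.
  by apply: (D3 _ _ _ _ _ _); first apply: (D3 _ _ _ _ _ _);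
    try apply: (D3 _ _ _ _ _ _); apply: (M3 _ _ _ _ _ _).
rewrite SSZ !SSD SSZ !SSD.
have bV : bsum (PV ^~ t) (d0^-1 * (B + B)) by apply: bsumZ (bP ht).
have bV1 : bsum (PV1 ^~ t) (d0^-1 * (eps ^+ 2 * B)) by apply: bsumZ (bP1 ht).
have b2' := bP2 ht.
have h1 := SS_le (P2_ge0 ^~ t) (PV_ge0 ^~ t) (PV_ge0 ^~ t) b2' bV bV.
have h2 := SS_le (PV_ge0 ^~ t) (P2_ge0 ^~ t) (PV_ge0 ^~ t) bV b2' bV.
have h3 := SS_le (PV_ge0 ^~ t) (PV_ge0 ^~ t) (P2_ge0 ^~ t) bV bV b2'.
have g1 := SS_le (PV1_ge0 ^~ t) (PV1_ge0 ^~ t) (PV_ge0 ^~ t) bV1 bV1 bV.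
have g2 := SS_le (PV1_ge0 ^~ t) (PV_ge0 ^~ t) (PV1_ge0 ^~ t) bV1 bV bV1.
have g3 := SS_le (PV_ge0 ^~ t) (PV1_ge0 ^~ t) (PV1_ge0 ^~ t) bV bV1 bV1.
have gg : 2 * (SS (fun k1 k2 k3 => PV1 k1 t * PV1 k2 t * PV k3 t) +
  SS (fun k1 k2 k3 => PV1 k1 t * PV k2 t * PV1 k3 t) +
  SS (fun k1 k2 k3 => PV k1 t * PV1 k2 t * PV1 k3 t)) <= _ :=
  ler_wpM2l (ler0n R 2) (lerD (lerD g1 g2) g3).
apply: le_trans (ler_wpM2l (ler0n R 8) (ler_wpM2l e8 (lerD (lerD (lerD h1 h2) h3) gg))) _.
have e20 : 0 <= eps ^+ 2 by rewrite sqr_ge0.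
have e21 : eps ^+ 2 <= 1 by case/andP: he => e0 e1; rewrite expr_le1// ltW.
rewrite /b2.
set u := d0^-1 * B + B; set v := d0^-1 * (B + B).
have v0 : 0 <= v by rewrite /v mulr_ge0// addr_ge0.
rewrite -subr_ge0.
have -> : eps ^+ 4 * (3 * u * v ^+ 2 + 6 * (d0^-1 * B) ^+ 2 * v) -
  8 * (eps ^+ 2 / 8 * (eps ^+ 2 * u * v * v + v * (eps ^+ 2 * u) * v +
    v * v * (eps ^+ 2 * u) +
    2 * (d0^-1 * (eps ^+ 2 * B) * (d0^-1 * (eps ^+ 2 * B)) * v +
      d0^-1 * (eps ^+ 2 * B) * v * (d0^-1 * (eps ^+ 2 * B)) +
      v * (d0^-1 * (eps ^+ 2 * B)) * (d0^-1 * (eps ^+ 2 * B))))) =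
  eps ^+ 4 * (1 - eps ^+ 2) * (6 * (d0^-1 * B) ^+ 2 * v).
  by field; rewrite gt_eqF.
have e40 : 0 <= eps ^+ 4 by rewrite (_ : eps ^+ 4 = (eps ^+ 2) ^+ 2) ?sqr_ge0//; ring.
apply: mulr_ge0; first by apply: mulr_ge0 => //; rewrite subr_ge0.
by pos.
Qed.

(** Each coefficient is half the sum of its two travelling waves, which expands the
    truncated nonlinearity into modes with a fixed phase. *)
Let oscE l t : osum Js La Am l t =
  sg s * 'i * (eps ^+ 2)%:C * expi (- (sgnR s * del l) * (t - 0)) * Nlow l t.
Proof.
set G := sg s * 'i * (eps ^+ 2)%:C * expi (- (sgnR s * del l) * (t - 0)).
rewrite /osum sumJs /Nlow; case: ifPn => lN; last first.
  rewrite mulr0; apply: big1 => k1 _; apply: big1 => k2 _.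
  by apply: big1 => s1 _; apply: big1 => s2 _; apply: big1 => s3 _; rewrite /Am /valid (negbTE lN) mulr0.
rewrite mulr_sumr; apply: eq_big_seq => k1; rewrite mem_lowseq => h1.
rewrite mulr_sumr; apply: eq_big_seq => k2; rewrite mem_lowseq => h2.
rewrite /lowc; set k3 := l - k1 - k2.
case: ifPn => h3; last first.
  rewrite !mulr0; apply: big1 => s1 _; apply: big1 => s2 _; apply: big1 => s3 _.
  by rewrite /Am /valid -/k3 (negbTE h3) !andbF mulr0.
have V x : valid l (k1, k2, x) by rewrite /valid lN h1 h2.
have ct x k : expi (sgnR x * del k * t) * chi x k t = trav x k t.
  by rewrite /chi subr0 mulNr mulrA expiK mul1r.
have tt k : trav true k t + trav false k t = 2 * c k t.
  rewrite /trav /sg /sgnR (_ : (-1)%:C = -1 :> R[i]); last first.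
    by rewrite rmorphN.
  by rewrite (_ : 1%:C = 1 :> R[i])//; ring.
transitivity (\sum_(s1 <- bb) \sum_(s2 <- bb) \sum_(s3 <- bb)
   G * (8^-1)%:C * (trav s1 k1 t * trav s2 k2 t * trav s3 k3 t)).
  apply: eq_bigr => s1 _; apply: eq_bigr => s2 _; apply: eq_bigr => s3 _.
  rewrite /Am /La V -/k3 -!ct /G /kap.
  have -> : (sgnR s1 * del k1 + sgnR s2 * del k2 + sgnR s3 * del k3 - sgnR s * del l) * t =
    sgnR s1 * del k1 * t + (sgnR s2 * del k2 * t + (sgnR s3 * del k3 * t +
      - (sgnR s * del l) * (t - 0))) by ring.
  by rewrite !expiD; ring.
have e8' : (8^-1)%:C * 8 = 1 :> R[i].
  by rewrite -(rmorph_nat (real_complex R)) -rmorphM mulVf// pnatr_eq0.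
rewrite /bb !big_cons !big_nil !addr0.
transitivity (G * (8^-1)%:C * ((trav true k1 t + trav false k1 t) *
  (trav true k2 t + trav false k2 t) * (trav true k3 t + trav false k3 t))); first by ring.
rewrite !tt; transitivity (G * ((8^-1)%:C * 8) * (c k1 t * c k2 t * c k3 t)); first by ring.
by rewrite e8' mulr1.
Qed.

Definition Kquad : R :=
  2 * cker gamma * b0 + T * ((2 * b1 + b2) / 8 + cker gamma * b1) + 2 * T.

(** The trapezoidal rule applied to the Duhamel integral of the exact solution. A
    time of order [eps ^- 2] costs one of the factors [eps ^+ 2] of the terms that
    grow with time, but these have two such factors. *)
Lemma exact_trapezoid n : n%:R * tau <= Te ->
  \sum_(l <- L) nC ((del l)%:C * (chi s l (n%:R * tau) - chi s l 0) -
    \sum_(k < n) (tau / 2)%:C * (sg s * 'i * (eps ^+ 2)%:C *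
      (expi (- (sgnR s * del l) * (k%:R * tau)) * NN l (k%:R * tau) +
       expi (- (sgnR s * del l) * (k.+1%:R * tau)) * NN l (k.+1%:R * tau)))) <=
  Kquad * (eps ^+ 2 * tau ^+ 2 + rho).
Proof.
move=> hn.
pose G l t := sg s * 'i * (eps ^+ 2)%:C * expi (- (sgnR s * del l) * (t - 0)).
pose r l t := G l t * (NN l t - Nlow l t).
pose y l t := (del l)%:C * chi s l t.
have e2 : 0 < eps ^+ 2 by case/andP: he => e0 _; rewrite exprn_gt0.
have nG l t : nC (G l t) = eps ^+ 2.
  by rewrite /G !nCM nC_expi nsg nC_i nC_real mulr1 !mul1r gtr0_norm.
have hy l t : 0 <= t <= Te -> cderiv 0 Te (y l) t (osum Js La Am l t + r l t).
  move=> ht; rewrite oscE /r -/(G l t) -mulrDr addrC subrK.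
  have -> : G l t * NN l t = (del l)%:C * chi1 s l t.
    have dV : (del l)%:C * ((del l)^-1)%:C = 1 by rewrite -rmorphM mulfV ?gt_eqF.
    rewrite /chi1 /G; transitivity ((del l)%:C * ((del l)^-1)%:C *
      (sg s * 'i * (eps ^+ 2)%:C * expi (- (sgnR s * del l) * (t - 0)) * NN l t)).
      by rewrite dV mul1r.
    by ring.
  by apply: cderivZ; exact: dchi.
have hr t : 0 <= t <= Te -> \sum_(l <- L) nC (r l t) <= eps ^+ 2 * rho.
  move=> ht; rewrite /r; under eq_bigr do rewrite nCM nG.
  by rewrite -mulr_sumr ler_wpM2l ?(ltW e2)// brho.
have main := oscillatory_trapezoid hg tau0 hLa hy dAm dA1 hB0 hB1 hB2 hr hn.
have tk_in k : (k <= n)%N -> 0 <= k%:R * tau <= Te.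
  move=> kn; rewrite mulr_ge0 ?(ltW tau0)//=; apply: le_trans hn.
  by rewrite ler_pM2r// ler_nat.
have corr : \sum_(l <- L) nC (\sum_(k < n) (tau / 2)%:C *
    (r l (k%:R * tau) + r l (k.+1%:R * tau))) <= n%:R * tau * (eps ^+ 2 * rho).
  apply: (@le_trans _ _ (\sum_(l <- L) \sum_(k < n) tau / 2 *
      (nC (r l (k%:R * tau)) + nC (r l (k.+1%:R * tau))))).
    apply: ler_sum => l _; apply: le_trans (nC_sum _ _ _) _; apply: ler_sum => k _.
    rewrite nCM nC_real ger0_norm ?divr_ge0 ?(ltW tau0)//.
    by rewrite ler_wpM2l ?divr_ge0 ?(ltW tau0)// nCD.
  rewrite exchange_big /=.
  apply: (@le_trans _ _ (\sum_(k < n) tau * (eps ^+ 2 * rho))).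
    apply: ler_sum => k _; rewrite -mulr_sumr big_split /=.
    have h1 := hr _ (tk_in k (ltnW (ltn_ord k))).
    have h2 := hr _ (tk_in k.+1 (ltn_ord k)).
    apply: le_trans (ler_wpM2l _ (lerD h1 h2)) _; first by rewrite divr_ge0// ltW.
    by rewrite le_eqVlt; apply/orP; left; apply/eqP; field.
  rewrite sumr_const card_ord -[_ *+ n]mulr_natl le_eqVlt; apply/orP; left; apply/eqP.
  by ring.
have nT : n%:R * tau * eps ^+ 2 <= T by rewrite -ler_pdivlMr.
have nt0 : 0 <= n%:R * tau by rewrite mulr_ge0// ltW.
have c1 := cker_ge1 gamma.
have ck0 : 0 <= cker gamma by exact: le_trans ler01 c1.
have e20 : 0 <= eps ^+ 2 by exact: ltW.
have T0' : 0 <= T by exact: ltW.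
have b00 : 0 <= b0.
  by rewrite /b0 (_ : (B + B) ^+ 3 = (B + B) * (B + B) ^+ 2); [pos|rewrite exprS].
have b10 : 0 <= b1 by rewrite /b1; pos.
have b20 : 0 <= b2 by rewrite /b2; pos.
apply: (@le_trans _ _ (2 * cker gamma * tau ^+ 2 * (eps ^+ 2 * b0) + n%:R * tau *
   (eps ^+ 2 * rho + (tau ^+ 2 / 8 * (2 * (eps ^+ 4 * b1) + eps ^+ 4 * b2) +
     cker gamma * tau ^+ 2 * (eps ^+ 4 * b1))) + n%:R * tau * (eps ^+ 2 * rho))).
  apply: le_trans (lerD main corr).
  rewrite -[leRHS]big_split /=; apply: ler_sum => l _; apply: le_trans (nCB _ _).
  rewrite le_eqVlt; apply/orP; left; apply/eqP; congr nC.
  rewrite /y mulrBr -[RHS]addrA -opprD -big_split /=; congr (_ - _).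
  apply: eq_bigr => k _ /=; rewrite -mulrDr; congr (_ * _).
  by rewrite !oscE /r /G !subr0; ring.
pose w := (2 * b1 + b2) / 8 + cker gamma * b1.
have w0 : 0 <= w.
  by rewrite /w; apply: addr_ge0; [apply: divr_ge0 => //|]; pos.
have -> : 2 * cker gamma * tau ^+ 2 * (eps ^+ 2 * b0) + n%:R * tau *
   (eps ^+ 2 * rho + (tau ^+ 2 / 8 * (2 * (eps ^+ 4 * b1) + eps ^+ 4 * b2) +
     cker gamma * tau ^+ 2 * (eps ^+ 4 * b1))) + n%:R * tau * (eps ^+ 2 * rho) =
  2 * cker gamma * b0 * (eps ^+ 2 * tau ^+ 2) +
   (n%:R * tau * eps ^+ 2) * (w * (eps ^+ 2 * tau ^+ 2) + 2 * rho).
  by rewrite /w; field.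
set x := eps ^+ 2 * tau ^+ 2.
have x0 : 0 <= x by rewrite mulr_ge0 ?sqr_ge0.
have h1 : (n%:R * tau * eps ^+ 2) * (w * x + 2 * rho) <= T * (w * x + 2 * rho).
  by apply: ler_wpM2r => //; pos.
rewrite /Kquad -/w.
have : 0 <= 2 * cker gamma * b0 * rho by pos.
have : 0 <= T * w * rho by pos.
have : 0 <= T * x by pos.
move: h1; set p1 := n%:R * tau * eps ^+ 2 * (w * x + 2 * rho) => h1 g1 g2 g3.
rewrite -subr_ge0.
have -> : (2 * cker gamma * b0 + T * w + 2 * T) * (x + rho) - (2 * cker gamma * b0 * x + p1) =
  (T * (w * x + 2 * rho) - p1) + 2 * cker gamma * b0 * rho + T * w * rho + 2 * (T * x) by ring.
apply: addr_ge0; last by rewrite mulr_ge0.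
by apply: addr_ge0 => //; apply: addr_ge0 => //; rewrite subr_ge0.
Qed.

End interaction_modes.

(** * Cubes in the Wiener algebra *)

Section cubic_terms.
Variables (R : realType) (a b : R) (hab : a < b).
Implicit Types (f g h : R -> R[i]) (c : int -> R[i]) (w : int -> R).

Lemma bsum1 c B : bsum (fun l => nC (c l)) B -> bsum (fun l => 1 * nC (c l)) B.
Proof. by apply: bsum_le => // l; rewrite mul1r. Qed.

Lemma bsum1_inv c B : bsum (fun l => 1 * nC (c l)) B -> bsum (fun l => nC (c l)) B.
Proof. by apply: bsum_le => // l; rewrite mul1r. Qed.

Lemma young f g c B1 B2 : inA a b f c -> bmeas a b g ->
  bsum (fun l => nC (c l)) B1 -> bsum (fun l => nC (fcoef a b g l)) B2 ->
  bsum (fun l => nC (fcoef a b (fun x => f x * g x) l)) (B1 * B2).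
Proof.
move=> hf hg /bsum1 h1 /bsum1 h2; apply: bsum1_inv.
rewrite -[X in bsum _ X]mul1r.
have w0 (l : int) : 0 <= (fun=> 1 : R) l by exact: ler01.
have w1 (k l : int) : (fun=> 1 : R) (k + l) <= 1 * ((fun=> 1) k * (fun=> 1) l) by rewrite !mul1r.
exact: (young_weighted hab hf hg w0 ler01 w1 h1 h2).
Qed.

Lemma bsum_inA w f c B : inA a b f c -> bsum (fun l => w l * nC (c l)) B ->
  bsum (fun l => w l * nC (fcoef a b f l)) B.
Proof. by move=> hf; apply: bsum_le => // l; rewrite (inA_fcoef hab _ hf). Qed.

Lemma cube_weighted w K B f c : inA a b f c -> (forall l, 0 <= w l) ->
  0 <= K -> (forall k l, w (k + l) <= K * (w k * w l)) ->
  bsum (fun l => w l * nC (c l)) B ->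
  bsum (fun l => w l * nC (fcoef a b (fun x => f x ^+ 3) l)) (K ^+ 2 * B ^+ 3).
Proof.
move=> hf w0 K0 hw hB; have bf := inA_bmeas hf.
have h2 := young_weighted hab hf bf w0 K0 hw hB (bsum_inA hf hB).
have h3 := young_weighted hab hf (bmeasM bf bf) w0 K0 hw hB h2.
apply: bsum_le h3 => [l|]; last by rewrite le_eqVlt; apply/orP; left; apply/eqP; ring.
by rewrite le_eqVlt; apply/orP; left; apply/eqP.
Qed.

Lemma cube_diff f g c c' B B' e : inA a b f c -> inA a b g c' ->
  bsum (fun l => nC (c l)) B -> bsum (fun l => nC (c' l)) B' ->
  bsum (fun l => nC (c l - c' l)) e ->
  bsum (fun l => nC (fcoef a b (fun x => f x ^+ 3) l - fcoef a b (fun x => g x ^+ 3) l))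
    (e * (B * B + B * B' + B' * B')).
Proof.
move=> hf hg hB hB' he.
have bf := inA_bmeas hf; have bg := inA_bmeas hg.
have hBf : bsum (fun l => nC (fcoef a b f l)) B.
  by apply: bsum1_inv; apply: bsum_inA hf _; exact: bsum1.
have hBg : bsum (fun l => nC (fcoef a b g l)) B'.
  by apply: bsum1_inv; apply: bsum_inA hg _; exact: bsum1.
have q1 := young hf bf hB hBf; have q2 := young hf bg hB hBg.
have q3 := young hg bg hB' hBg.
have bq : bmeas a b (fun x => f x * f x + f x * g x + g x * g x).
  by apply: bmeasD; [apply: bmeasD|]; exact: bmeasM.
have hq : bsum (fun l => nC (fcoef a b (fun x => f x * f x + f x * g x + g x * g x) l))
   (B * B + B * B' + B' * B').
  apply: bsum_le (bsumD (bsumD q1 q2) q3) => // l.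
  rewrite fcoefD//; last 2 first.
  - by apply: bmeas_L1 => //; apply: bmeasD; exact: bmeasM.
  - by apply: bmeas_L1 => //; exact: bmeasM.
  apply: le_trans (nCD _ _) _; rewrite lerD2r fcoefD//.
  - exact: nCD.
  - by apply: bmeas_L1 => //; exact: bmeasM.
  - by apply: bmeas_L1 => //; exact: bmeasM.
have := young (inAB hf hg) bq he hq; apply: bsum_le => // l.
rewrite -fcoefB//; last 2 first.
- by apply: bmeas_L1 => //; exact: bmeasX.
- by apply: bmeas_L1 => //; exact: bmeasX.
rewrite le_eqVlt; apply/orP; left; apply/eqP; congr nC.
by apply: fcoef_eq => // x _; ring.
Qed.

Lemma fcoef_tpoly_cube c N l : fcoef a b (fun x => tpoly a b c N x ^+ 3) l =
  \sum_(k1 <- lowseq N) \sum_(k2 <- lowseq N) c k1 * c k2 *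
    (if (`|(l - k1 - k2)%R| <= N)%N then c (l - k1 - k2) else 0).
Proof.
have step g l' : bmeas a b g -> fcoef a b (fun x => tpoly a b c N x * g x) l' =
    \sum_(k <- lowseq N) c k * fcoef a b g (l' - k).
  move=> bg.
  transitivity (fcoef a b (fun x => \sum_(k <- lowseq N) c k * (fexp a b k x * g x)) l').
    apply: fcoef_eq => // x _; rewrite mulr_suml; apply: eq_bigr => k _.
    by rewrite mulrA.
  have bgk k : bmeas a b (fun x => fexp a b k x * g x).
    by apply: bmeasM => //; exact: bmeas_fexp.
  rewrite fcoef_sum//; last by move=> k; exact: bmeasZ.
  by apply: eq_bigr => k _; rewrite fcoefZ ?fcoef_shift//; exact: bmeas_L1.
have bt := bmeas_tpoly a b c N.
transitivity (fcoef a b (fun x => tpoly a b c N x * (tpoly a b c N x * tpoly a b c N x)) l).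
  by apply: fcoef_eq => // x _; rewrite !exprS expr0 mulr1.
rewrite step; last exact: bmeasM.
apply: eq_bigr => k1 _; rewrite step// mulr_sumr; apply: eq_bigr => k2 _.
by rewrite fcoef_tpoly// mulrA.
Qed.

Lemma bsum_tail_cut w c B x N : (forall l, 0 <= w l) -> 0 <= x ->
  (forall l : int, (N < `|l|)%N -> 1 <= x * w l) -> bsum (fun l => w l * nC (c l)) B ->
  bsum (fun l => if (`|l| <= N)%N then 0 else nC (c l)) (x * B).
Proof.
move=> w0 x0 hx hB; apply: bsum_le (bsumZ x0 hB) => // l.
case: leqP => h; first by rewrite mulr_ge0// mulr_ge0 ?nC_ge0.
by rewrite mulrA ler_peMl ?nC_ge0// hx.
Qed.

(** The factor [x] is the inverse of the smallest weight beyond [N]. Cutting off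
    before cubing costs the tail of [c] by [cube_diff], cutting off afterwards the
    tail of the cube, whose weighted sum is controlled by [cube_weighted]. *)
Lemma cube_truncation w K B0 B f c x N : inA a b f c -> (forall l, 0 <= w l) ->
  0 <= K -> (forall k l, w (k + l) <= K * (w k * w l)) -> 0 <= x ->
  (forall l : int, (N < `|l|)%N -> 1 <= x * w l) ->
  bsum (fun l => nC (c l)) B0 -> bsum (fun l => w l * nC (c l)) B ->
  bsum (fun l => nC (fcoef a b (fun y => f y ^+ 3) l -
    (if (`|l| <= N)%N then \sum_(k1 <- lowseq N) \sum_(k2 <- lowseq N) c k1 * c k2 *
    (if (`|(l - k1 - k2)%R| <= N)%N then c (l - k1 - k2) else 0) else 0)))
  (x * (3 * B * B0 ^+ 2 + K ^+ 2 * B ^+ 3)).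
Proof.
move=> hf w0 K0 hw x0 hx hB0 hB.
have ht := inA_tpoly a b c N.
have h1 : bsum (fun l => nC (if (`|l| <= N)%N then c l else 0)) B0.
  by apply: bsum_le hB0 => // l; case: ifP => // _; rewrite nC0 nC_ge0.
have h2 : bsum (fun l => nC (c l - (if (`|l| <= N)%N then c l else 0))) (x * B).
  apply: bsum_le (bsum_tail_cut w0 x0 hx hB) => // l.
  by case: ifP => _; rewrite ?subrr ?nC0 ?subr0.
have q1 := cube_diff hf ht hB0 h1 h2.
have q2 := bsum_tail_cut w0 x0 hx (cube_weighted hf w0 K0 hw hB).
apply: bsum_le (bsumD q1 q2) => [l|].
  case: ifP => _; last by rewrite subr0 lerDr nC_ge0.
  by rewrite -fcoef_tpoly_cube addr0.
by rewrite le_eqVlt; apply/orP; left; apply/eqP; ring.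
Qed.

Definition meas f : Prop :=
  measurable_fun `[a, b]%classic (fun x => complex.Re (f x)) /\
  measurable_fun `[a, b]%classic (fun x => complex.Im (f x)).

(** The equation is only given in the interior of the interval, and for functions
    that are merely square integrable. *)
Lemma fcoef_eq_oo f g l : meas f -> meas g -> (forall x, a < x < b -> f x = g x) ->
  fcoef a b f l = fcoef a b g l.
Proof.
move=> [f1 f2] [g1 g2] fg; rewrite !fcoefE; congr (_ * _).
have [e1 e2 _] := bmeas_fexp a b (- l).
have sub : (`]a, b[ `<=` `[a, b])%classic.
  by move=> x /=; rewrite !in_itv /= => /andP[h1 h2]; apply/andP; split; exact: ltW.
have mo u : measurable_fun `[a, b]%classic u -> measurable_fun `]a, b[%classic u.
  by move=> mu_; apply: measurable_funS mu_ => //; exact: measurable_itv.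
apply: complex_ext; rewrite /cintegral /= /Rintegral; congr fine.
  apply: eq_integral_itv_bounded.
  - apply: mo; under [X in measurable_fun _ X]eq_fun do rewrite cReM.
    by apply: measurable_funB; exact: measurable_funM.
  - apply: mo; under [X in measurable_fun _ X]eq_fun do rewrite cReM.
    by apply: measurable_funB; exact: measurable_funM.
  by move=> x; rewrite in_itv /= => /fg ->.
apply: eq_integral_itv_bounded.
- apply: mo; under [X in measurable_fun _ X]eq_fun do rewrite cImM.
  by apply: measurable_funD; exact: measurable_funM.
- apply: mo; under [X in measurable_fun _ X]eq_fun do rewrite cImM.
  by apply: measurable_funD; exact: measurable_funM.
by move=> x; rewrite in_itv /= => /fg ->.
Qed.

End cubic_terms.

Section time_derivatives.
Variables (R : realType) (a b Te : R) (hab : a < b) (Te0 : 0 < Te).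

Lemma near_point t d : 0 <= t <= Te -> 0 < d ->
  exists r, [/\ 0 < r < Te, r != t & `|r - t| <= d].
Proof.
move=> ht d0; pose x := Num.min d (Te / 4).
have x0 : 0 < x by rewrite lt_min d0 divr_gt0.
have xd : x <= d by rewrite /x ge_min lexx.
have xT : x <= Te / 4 by rewrite /x ge_min lexx orbT.
have [tT|tT] := leP t (Te / 2).
  exists (t + x); rewrite (_ : t + x - t = x); last by ring.
  rewrite gtr0_norm//; split => //; first by clear d0 xd; lra.
  by rewrite gt_eqF// ltrDl.
exists (t - x); rewrite (_ : t - x - t = - x); last by ring.
rewrite normrN gtr0_norm//; split => //; first by clear d0 xd; lra.
by rewrite lt_eqF// ltrBlDr ltrDl.
Qed.

Lemma itv_oo_cc (A Z t : R) : A < t < Z -> A <= t <= Z.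
Proof. by case/andP=> h1 h2; rewrite !ltW. Qed.

Lemma near_within (P : R -> Prop) t :
  (\forall r \near within `[0, Te] (dnbhs t), P r)%classic ->
  exists2 d : R, 0 < d & forall r, 0 <= r <= Te -> r != t -> `|r - t| <= d -> P r.
Proof.
move=> /nbhs_ballP[d /= d0 hd]; exists (d / 2); first by rewrite divr_gt0.
move=> r hr rt rd; apply: hd => //=.
rewrite /ball /= distrC; apply: le_lt_trans rd _.
by rewrite ltr_pdivrMr// ltr_pMr// ltr1n.
Qed.

(** A Sobolev derivative is a derivative in every weighted l1 space into which the
    Sobolev space embeds. *)
Lemma hderiv_wsum (w : int -> R) (s C : R) u u' :
  0 < C -> (forall f e, 0 < e -> (hnorm a b s f <= e%:E)%E ->
    bsum (fun l => w l * nC (fcoef a b f l)) (C * e)) ->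
  hderiv a b s Te u u' ->
  (forall t, 0 <= t <= Te -> inL2 a b (u t)) ->
  (forall t, 0 <= t <= Te -> inL2 a b (u' t)) ->
  forall t, 0 <= t <= Te -> forall e, 0 < e -> exists2 d : R, 0 < d &
    forall r, 0 <= r <= Te -> r != t -> `|r - t| <= d ->
      bsum (fun l => w l * nC (((r - t)^-1)%:C *
        (fcoef a b (u r) l - fcoef a b (u t) l) - fcoef a b (u' t) l)) e.
Proof.
move=> C0 emb hd hu hu' t ht e e0.
have e1 : 0 < e / C by rewrite divr_gt0.
have hn : (\forall r \near within `[0, Te] (dnbhs t),
   (hnorm a b s (fun x => ((r - t)^-1)%:C * (u r x - u t x) - u' t x)%R < (e / C)%:E)%E)%classic.
  apply: (hd t ht [set x : \bar R | (x < (e / C)%:E)%E]%classic).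
  by apply: open_nbhs_nbhs; split; [exact: open_ereal_lt_ereal|rewrite /= lte_fin].
have [d d0 h] := near_within hn; exists d => // r hr rt rd.
have := emb _ _ e1 (ltW (h r hr rt rd)); rewrite mulrC divfK ?gt_eqF//.
apply: bsum_le => // l; rewrite le_eqVlt; apply/orP; left; apply/eqP.
have l1 := inL2_L1 hab (hu r hr); have l2 := inL2_L1 hab (hu t ht).
have l3 := inL2_L1 hab (hu' t ht).
by rewrite fcoefB ?fcoefZ ?fcoefB//; do ?[exact: L1B|apply: L1Z].
Qed.

Lemma quotient_cderiv (F : R -> R[i]) t l :
  (forall e, 0 < e -> exists2 d : R, 0 < d &
    forall r, 0 <= r <= Te -> r != t -> `|r - t| <= d ->
      nC (((r - t)^-1)%:C * (F r - F t) - l) <= e) ->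
  cderiv 0 Te F t l.
Proof.
move=> h e /h[d d0 hd]; exists d => // r hr rd.
have [->|rt] := eqVneq r t; first by rewrite !subrr mul0r subr0 nC0 normr0 mulr0.
have -> : F r - F t - (r - t)%:C * l = (r - t)%:C * (((r - t)^-1)%:C * (F r - F t) - l).
  by rewrite mulrBr mulrA -rmorphM mulfV ?mul1r// subr_eq0.
by rewrite nCM nC_real mulrC ler_wpM2r// hd.
Qed.

Lemma cderiv_unique (F : R -> R[i]) t l l' : 0 <= t <= Te ->
  cderiv 0 Te F t l -> cderiv 0 Te F t l' -> l = l'.
Proof.
move=> ht h h'; apply/eqP; rewrite -subr_eq0; apply/eqP/nC_eq0/eqP.
rewrite eq_le nC_ge0 andbT; apply/ler_addgt0Pr => e e0; rewrite add0r.
have e2 : 0 < e / 2 by rewrite divr_gt0.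
have [d1 d10 h1] := h _ e2; have [d2 d20 h2] := h' _ e2.
have d0 : 0 < Num.min d1 d2 by rewrite lt_min d10.
have [r [/itv_oo_cc hr rt]] := near_point ht d0; rewrite le_min => /andP[r1 r2].
have {}rt : 0 < `|r - t| by rewrite normr_gt0 subr_eq0.
have := h1 r hr r1; have := h2 r hr r2.
move=> g2 g1; rewrite -(ler_pM2r rt) -(nC_real (r - t)) -nCM.
have -> : (l - l') * (r - t)%:C = (F r - F t - (r - t)%:C * l') - (F r - F t - (r - t)%:C * l).
  by ring.
rewrite nC_real (splitr e) [leRHS]mulrDl.
by apply: le_trans (nCB _ _) _; exact: lerD.
Qed.

(** An l1 Lipschitz bound passes to the derivative, although the family of
    difference quotients may converge only termwise. *)
Lemma cderiv_sum_bound (F F' : int -> R -> R[i]) (K t : R) : 0 <= t <= Te ->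
  (forall l, cderiv 0 Te (F l) t (F' l t)) ->
  (forall r, 0 <= r <= Te -> bsum (fun l => nC (F l r - F l t)) (K * `|r - t|)) ->
  bsum (fun l => nC (F' l t)) K.
Proof.
move=> ht hF hK L uL.
apply/ler_addgt0Pr => e e0; have [d d0 hd] := cderiv_sum_near L hF e0.
have [r [/itv_oo_cc hr rt rd]] := near_point ht d0.
have {}rt : 0 < `|r - t| by rewrite normr_gt0 subr_eq0.
rewrite -(ler_pM2r rt) mulr_suml mulrDl.
apply: le_trans (lerD (hK r hr L uL) (hd r hr rd)).
rewrite -big_split /=; apply: ler_sum => l _.
rewrite -(nC_real (r - t)) -nCM mulrC.
apply: le_trans (nCB (F l r - F l t) _); rewrite le_eqVlt; apply/orP; left; apply/eqP.
by congr nC; ring.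
Qed.

End time_derivatives.

(** * Dispersion relation and pointwise derivatives *)

Section dispersion_relation.
Variables (R : realType) (a b alpha beta : R).
Hypotheses (hab : a < b) (halpha : 1 < alpha <= 2) (hbeta : 0 < beta).
Local Notation del := (delta a b alpha beta).
Local Notation jap := (jap a b).

Let a20 : 0 <= alpha / 2. Proof. by have := halpha; lra. Qed.

Lemma mu_powR l : `|mu a b l| `^ alpha = (mu a b l ^+ 2) `^ (alpha / 2).
Proof.
rewrite -(real_normK (num_real (mu a b l))) -powR_mulrn// -powRrM.
by congr (_ `^ _); field.
Qed.

Lemma delta_sqr l : del l ^+ 2 = beta + `|mu a b l| `^ alpha.
Proof. by rewrite sqr_sqrtr// addr_ge0 ?powR_ge0// ltW. Qed.

Lemma delta_ge l : Num.sqrt beta <= del l.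
Proof. by rewrite ler_wsqrtr// lerDl powR_ge0. Qed.

Lemma delta_gt0 l : 0 < del l.
Proof. by apply: lt_le_trans (delta_ge l); rewrite sqrtr_gt0. Qed.

Lemma delta_le_jap l : del l ^+ 2 <= (beta + 1) * jap (alpha / 2) l.
Proof.
rewrite delta_sqr mu_powR mulrDl mul1r; apply: lerD.
  rewrite ler_peMr ?(ltW hbeta)//; apply: le_trans (_ : jap 0 l <= _); first by rewrite jap0.
  exact: jap_le.
by apply: ge0_ler_powR; rewrite ?nnegrE ?sqr_ge0 ?addr_ge0 ?sqr_ge0// lerDr.
Qed.

Definition Cdel : R := 2 `^ (alpha / 2) * (beta^-1 + 1).

Lemma Cdel_ge0 : 0 <= Cdel.
Proof. by rewrite mulr_ge0 ?powR_ge0// addr_ge0// invr_ge0 ltW. Qed.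

Lemma jap_le_delta l : jap (alpha / 2) l <= Cdel * del l ^+ 2.
Proof.
have p0 : 0 <= (mu a b l ^+ 2) `^ (alpha / 2) by exact: powR_ge0.
apply: (@le_trans _ _ (2 `^ (alpha / 2) * (1 + (mu a b l ^+ 2) `^ (alpha / 2)))).
  set x := mu a b l ^+ 2 in p0 *; have x0 : 0 <= x by exact: sqr_ge0.
  have [x1|x1] := leP x 1.
    apply: (@le_trans _ _ (2 `^ (alpha / 2))); last by rewrite ler_peMr ?powR_ge0// lerDl.
    have x2 : 1 + x <= 2 by rewrite mulr2n lerD2l.
    by apply: ge0_ler_powR; rewrite ?nnegrE ?addr_ge0 ?sqr_ge0.
  apply: (@le_trans _ _ (2 `^ (alpha / 2) * x `^ (alpha / 2))); last first.
    by rewrite ler_wpM2l ?powR_ge0// lerDr.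
  have x2 : 1 + x <= 2 * x by lra.
  have x3 : 0 <= 2 * x by rewrite mulr_ge0.
  by rewrite -powRM//; apply: ge0_ler_powR; rewrite ?nnegrE// addr_ge0 ?sqr_ge0.
rewrite /Cdel -mulrA ler_wpM2l ?powR_ge0// delta_sqr mu_powR.
set y := _ `^ _ in p0 *.
have -> : (beta^-1 + 1) * (beta + y) = 1 + y + beta + beta^-1 * y.
  by field; rewrite gt_eqF.
have : 0 <= beta^-1 * y by rewrite mulr_ge0// invr_ge0 ltW.
by move: hbeta; lra.
Qed.

Definition Ddel : R := (beta + 1) * 2 `^ (alpha / 2) * Cdel ^+ 2 + 1.

Lemma Ddel_ge1 : 1 <= Ddel.
Proof.
rewrite lerDr mulr_ge0 ?sqr_ge0// mulr_ge0 ?powR_ge0//.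
by rewrite addr_ge0// ltW.
Qed.

Lemma delta_submul k l : del (k + l) <= Ddel * (del k * del l).
Proof.
have D0 := le_trans ler01 Ddel_ge1.
have dk := ltW (delta_gt0 k); have dl := ltW (delta_gt0 l).
rewrite -ler_sqr ?nnegrE ?(ltW (delta_gt0 _)) ?mulr_ge0//.
apply: le_trans (delta_le_jap _) _.
have b1 : 0 <= beta + 1 by rewrite addr_ge0// ltW.
apply: (@le_trans _ _ ((beta + 1) * (2 `^ (alpha / 2) *
   ((Cdel * del k ^+ 2) * (Cdel * del l ^+ 2))))).
  rewrite ler_wpM2l//; apply: le_trans (jap_submul _ _ _ _ a20) _.
  rewrite ler_wpM2l ?powR_ge0//; apply: ler_pM; rewrite ?jap_ge0//; exact: jap_le_delta.
have -> : (beta + 1) * (2 `^ (alpha / 2) * ((Cdel * del k ^+ 2) * (Cdel * del l ^+ 2))) =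
  (Ddel - 1) * (del k * del l) ^+ 2 by rewrite /Ddel; ring.
rewrite [leRHS]exprMn; apply: ler_wpM2r; first by rewrite sqr_ge0.
have := Ddel_ge1; rewrite expr2; nra.
Qed.

End dispersion_relation.

Section pointwise_identification.
Variables (R : realType) (a b Te : R) (hab : a < b) (Te0 : 0 < Te).

Lemma has_deriv_inE (A Z : R) (f : R -> R) x l : has_deriv_in `[A, Z]%classic f x l ->
  forall e, 0 < e -> exists2 d, 0 < d &
    forall y, A <= y <= Z -> y != x -> `|y - x| <= d -> `|(f y - f x) / (y - x) - l| <= e.
Proof.
move=> /cvgrPdist_le h e /h /nbhs_ballP[d /= d0 hd].
exists (d / 2); first by rewrite divr_gt0.
move=> y hy yx yd; rewrite distrC; apply: hd => //=.
rewrite /ball /= distrC; apply: le_lt_trans yd _.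
by rewrite ltr_pdivrMr// ltr_pMr// ltr1n.
Qed.

Lemma has_deriv_contD (f df : R -> R) :
  (forall x, a <= x <= b -> has_deriv_in `[a, b]%classic f x (df x)) -> contD a b f.
Proof.
move=> hf x hx e e0; have [d d0 hd] := has_deriv_inE (hf x hx) ltr01.
pose K := `|df x| + 1; have K0 : 0 < K by rewrite ltr_wpDl.
exists (Num.min d (e / K)); first by rewrite lt_min d0 divr_gt0.
move=> y hy; rewrite le_min => /andP[yd ye].
have [->|yx] := eqVneq y x; first by rewrite subrr normr0 ltW.
have h := hd y hy yx yd.
have -> : f y - f x = (f y - f x) / (y - x) * (y - x) by rewrite divfK// subr_eq0.
rewrite normrM; apply: (@le_trans _ _ (K * (e / K))); last by rewrite mulrC divfK ?gt_eqF.
apply: ler_pM => //; rewrite -[X in `|X|](subrK (df x)) addrC.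
by apply: le_trans (ler_normD _ _) _; rewrite lerD2l.
Qed.

(** Convergence in the Wiener algebra is uniform in space, so the difference
    quotients at [x] converge to the value of the limit series. *)
Lemma pointwise_derivative (u : R -> R -> R) (cu : R -> int -> R[i]) g Bg t x p :
  0 <= t <= Te -> a <= x <= b ->
  (forall r, 0 <= r <= Te -> inA a b (toC (u r)) (cu r)) ->
  bsum (fun l => nC (g l)) Bg ->
  (forall e, 0 < e -> exists2 d : R, 0 < d &
    forall r, 0 <= r <= Te -> r != t -> `|r - t| <= d ->
      bsum (fun l => nC (((r - t)^-1)%:C * (cu r l - cu t l) - g l)) e) ->
  has_deriv_in `[0, Te]%classic (fun r => u r x) t p ->
  p%:C = fseries a b g x.
Proof.
move=> ht hx hu hg hq hp; apply/eqP; rewrite -subr_eq0; apply/eqP/nC_eq0/eqP.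
rewrite eq_le nC_ge0 andbT; apply: (@le_by_eps _ _ _ 2) => // e e0; rewrite add0r.
have [d1 d10 h1] := hq e e0; have [d2 d20 h2] := has_deriv_inE hp e0.
have d0 : 0 < Num.min d1 d2 by rewrite lt_min d10.
have [r [/itv_oo_cc hr rt]] := near_point Te0 ht d0; rewrite le_min => /andP[r1 r2].
have q1 := h1 r hr rt r1; have q2 := h2 r hr rt r2.
have hD := inAB (inAZ ((r - t)^-1)%:C (inAB (hu r hr) (hu t ht))) (fseries_inA hab hg).
have q3 := inA_le hD q1 hx.
have -> : p%:C - fseries a b g x =
  (((r - t)^-1)%:C * (toC (u r) x - toC (u t) x) - fseries a b g x) -
   ((u r x - u t x) / (r - t) - p)%:C.
  rewrite [((u r x - u t x) / (r - t) - p)%:C](_ : _ =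
    ((r - t)^-1)%:C * (toC (u r) x - toC (u t) x) - p%:C); first by ring.
  by rewrite /toC rmorphB rmorphM rmorphB mulrC.
have -> : 2 * e = e + e by ring.
apply: le_trans (nCB _ _) _; rewrite nC_real; exact: lerD.
Qed.

End pointwise_identification.

(** * Fourier coefficients of the exact solution *)

Section exact_solution.
Variables (R : realType) (a b alpha beta T m M : R).
Hypotheses (hab : a < b) (halpha : 1 < alpha <= 2) (hbeta : 0 < beta) (hT : 0 < T).
Hypothesis (hm : 1 < m).
Local Notation del := (delta a b alpha beta).
Local Notation jap := (jap a b).
Local Notation s := (m + alpha / 2).

Let Mp : R := `|M| + 1.
Let Mp0 : 0 < Mp. Proof. by rewrite ltr_wpDl. Qed.
Let MMp : M <= Mp. Proof. by rewrite (le_trans (ler_norm M))// lerDl. Qed.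

(* Weighted l1 bounds that follow from a Sobolev bound, see [hnorm_wsum]. The weight
   of [emb_w] gives [jap (s / 2)] once multiplied by [del ^+ 2]. *)
Let emb (w : int -> R) (q C : R) := forall f (e : R), 0 < e -> (hnorm a b q f <= e%:E)%E ->
    bsum (fun l => w l * nC (fcoef a b f l)) (C * e).

Let emb1 q : 1 <= q -> exists2 C, 0 < C & emb (fun=> 1) q C.
Proof.
move=> q1; apply: (@hnorm_wsum _ _ _ hab q 1) => // l.
rewrite expr1n mul1r; apply: le_trans (_ : jap 0 l <= _); first by rewrite jap0.
by apply: jap_le; rewrite subr_ge0.
Qed.

Let emb_del : exists2 C, 0 < C & emb del s C.
Proof.
apply: (@hnorm_wsum _ _ _ hab s (beta + 1)) => [|l|l].
- by rewrite addr_ge0// ltW.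
- exact: ltW (delta_gt0 _ _ _ hbeta l).
apply: le_trans (delta_le_jap a b halpha hbeta l) _.
rewrite ler_wpM2l//; first by rewrite addr_ge0// ltW.
by apply: jap_le; move: hm; lra.
Qed.

Let emb_w : exists2 C, 0 < C & emb (jap ((m - alpha / 2) / 2)) s C.
Proof.
apply: (@hnorm_wsum _ _ _ hab s 1) => // l; first exact: jap_ge0.
rewrite jap_half mul1r; apply: jap_le; move: halpha; lra.
Qed.

(** What the error analysis uses of the exact solution. The second time derivative
    being bounded in the same Sobolev space as the solution, the equation yields
    [alpha] more space derivatives; they pay for the passage from square sums to
    absolute sums in the last bound, which keeps the full exponent
    [m + alpha / 2]. *)
Definition coef_bounds (eps B : R) (psi psit : R -> R -> R)
    (c d NN N1 : int -> R -> R[i]) : Prop :=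
  forall t, 0 <= t <= T / eps ^+ 2 ->
  [/\ inA a b (toC (psi t)) (c ^~ t), inA a b (toC (psit t)) (d ^~ t),
      forall l, NN l t = fcoef a b (fun x => toC (psi t) x ^+ 3) l &
  [/\ forall l, cderiv 0 (T / eps ^+ 2) (c l) t (d l t),
      forall l, cderiv 0 (T / eps ^+ 2) (d l) t
        (- ((del l ^+ 2)%:C * c l t) - (eps ^+ 2)%:C * NN l t),
      forall l, cderiv 0 (T / eps ^+ 2) (NN l) t (N1 l t) &
  [/\ bsum (fun l => del l * nC (c l t)) B, bsum (fun l => nC (d l t)) B,
      bsum (fun l => nC (NN l t)) B, bsum (fun l => nC (N1 l t)) B &
      bsum (fun l => jap (s / 2) l * nC (c l t)) B]]].

(** The coefficients are differentiated in time by the Sobolev regularity, and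
    identified with pointwise derivatives by [pointwise_derivative]. The derivative
    of the nonlinearity exists because the equation expresses it by the other
    terms. *)
Lemma exact_coefs : exists2 B, 0 <= B & forall eps psi0 psi1 psi psit, 0 < eps <= 1 ->
  is_NSFKGE_solution a b alpha beta eps (T / eps ^+ 2) psi0 psi1 psi psit ->
  C2_norm_le a b s (T / eps ^+ 2) (fun t => toC (psi t)) M ->
  C2_norm_le a b m (T / eps ^+ 2) (fun t => toC (psit t)) M ->
  exists N1, coef_bounds eps B psi psit
    (fun l t => fcoef a b (toC (psi t)) l) (fun l t => fcoef a b (toC (psit t)) l)
    (fun l t => fcoef a b (fun x => toC (psi t) x ^+ 3) l) N1.
Proof.
have m1 : 1 <= m by exact: ltW.
have s1 : 1 <= s by move: halpha; lra.
have [Cs Cs0 es] := emb1 s1; have [Cm Cm0 em] := emb1 m1.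
have [Cd Cd0 ed] := emb_del; have [Cw Cw0 ew] := emb_w.
pose q := (m - alpha / 2) / 2; pose Kw := 2 `^ q : R.
have q0 : 0 <= q by rewrite divr_ge0// subr_ge0; move: halpha; lra.
have Kw0 : 0 <= Kw by exact: powR_ge0.
pose bc := Cs * Mp; pose bd := Cm * Mp; pose bw := Cw * Mp.
have bc0 : 0 <= bc by rewrite mulr_ge0// ltW.
have bd0 : 0 <= bd by rewrite mulr_ge0// ltW.
have bw0 : 0 <= bw by rewrite mulr_ge0// ltW.
pose bN := bc ^+ 3; pose bN1 := bd * (3 * bc ^+ 2).
pose bt := Cdel alpha beta * (bw + Kw ^+ 2 * bw ^+ 3).
have bN0 : 0 <= bN by rewrite exprn_ge0.
have bN10 : 0 <= bN1 by rewrite mulr_ge0// mulr_ge0// sqr_ge0.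
have bt0 : 0 <= bt.
  by rewrite mulr_ge0 ?Cdel_ge0// addr_ge0// mulr_ge0 ?sqr_ge0// exprn_ge0.
pose B := Cd * Mp + bd + bN + bN1 + bt.
have cdM : 0 <= Cd * Mp by rewrite mulr_ge0// ltW.
have [leB1 leB2 leB3 leB4] : [/\ bd <= B, bN <= B, bN1 <= B & bt <= B].
  by rewrite /B; clear -cdM bd0 bN0 bN10 bt0; split; lra.
exists B; first by rewrite !addr_ge0.
move=> eps psi0 psi1 psi psit he [H1 H2 H3 _] [u1 [u2 [du1 du2 _ bu]]] [v1 [v2 [dv1 dv2 _ bv]]].
have e2 : 0 < eps ^+ 2 by case/andP: he => e0 _; rewrite exprn_gt0.
have e21 : eps ^+ 2 <= 1 by case/andP: he => e0 e1; rewrite expr_le1// ltW.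
set Te := T / eps ^+ 2 in H1 H2 H3 du1 du2 bu dv1 dv2 bv *.
have Te0 : 0 < Te by rewrite divr_gt0.
have up q' f : (hnorm a b q' f <= M%:E)%E -> (hnorm a b q' f <= Mp%:E)%E.
  by move=> h; apply: le_trans h _; rewrite lee_fin.
have L2 q' f : (hnorm a b q' f <= M%:E)%E -> inL2 a b f by move=> /hnorm_bsum[].
have Lu0 t : 0 <= t <= Te -> inL2 a b (toC (psi t)) by move=> /bu[/L2].
have Lu1 t : 0 <= t <= Te -> inL2 a b (u1 t) by move=> /bu[_ /L2].
have Lu2 t : 0 <= t <= Te -> inL2 a b (u2 t) by move=> /bu[_ _ /L2].
have Lv0 t : 0 <= t <= Te -> inL2 a b (toC (psit t)) by move=> /bv[/L2].
have Lv1 t : 0 <= t <= Te -> inL2 a b (v1 t) by move=> /bv[_ /L2].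
have Lv2 t : 0 <= t <= Te -> inL2 a b (v2 t) by move=> /bv[_ _ /L2].
pose c l t := fcoef a b (toC (psi t)) l.
pose d l t := fcoef a b (toC (psit t)) l.
pose NN l t := fcoef a b (fun x => toC (psi t) x ^+ 3) l.
have es1 f : (hnorm a b s f <= M%:E)%E -> bsum (fun l => nC (fcoef a b f l)) bc.
  by move=> /up /(es _ _ Mp0) /bsum1_inv.
have em1 f : (hnorm a b m f <= M%:E)%E -> bsum (fun l => nC (fcoef a b f l)) bd.
  by move=> /up /(em _ _ Mp0) /bsum1_inv.
have hc t : 0 <= t <= Te -> bsum (fun l => nC (c l t)) bc by move=> /bu[/es1].
have hd t : 0 <= t <= Te -> bsum (fun l => nC (d l t)) bd by move=> /bv[/em1].
have unit1 (x y : int -> R[i]) e : bsum (fun l => 1 * nC (x l - y l)) e ->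
  bsum (fun l => nC (x l - y l)) e by apply: bsum_le => // l; rewrite mul1r.
have qu1 t : 0 <= t <= Te -> forall e, 0 < e -> exists2 d : R, 0 < d &
    forall r, 0 <= r <= Te -> r != t -> `|r - t| <= d ->
      bsum (fun l => nC (((r - t)^-1)%:C * (c l r - c l t) - fcoef a b (u1 t) l)) e.
  move=> ht e e0; have [x x0 h] := hderiv_wsum hab Cs0 es du1 Lu0 Lu1 ht e0.
  by exists x => // r hr rt rd; apply: unit1; exact: h.
have qu2 t : 0 <= t <= Te -> forall e, 0 < e -> exists2 d : R, 0 < d &
    forall r, 0 <= r <= Te -> r != t -> `|r - t| <= d ->
      bsum (fun l => nC (((r - t)^-1)%:C * (fcoef a b (u1 r) l - fcoef a b (u1 t) l)
        - fcoef a b (u2 t) l)) e.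
  move=> ht e e0; have [x x0 h] := hderiv_wsum hab Cs0 es du2 Lu1 Lu2 ht e0.
  by exists x => // r hr rt rd; apply: unit1; exact: h.
have qv1 t : 0 <= t <= Te -> forall e, 0 < e -> exists2 x : R, 0 < x &
    forall r, 0 <= r <= Te -> r != t -> `|r - t| <= x ->
      bsum (fun l => nC (((r - t)^-1)%:C * (d l r - d l t) - fcoef a b (v1 t) l)) e.
  move=> ht e e0; have [x x0 h] := hderiv_wsum hab Cm0 em dv1 Lv0 Lv1 ht e0.
  by exists x => // r hr rt rd; apply: unit1; exact: h.
have qv2 t : 0 <= t <= Te -> forall e, 0 < e -> exists2 x : R, 0 < x &
    forall r, 0 <= r <= Te -> r != t -> `|r - t| <= x ->
      bsum (fun l => nC (((r - t)^-1)%:C * (fcoef a b (v1 r) l - fcoef a b (v1 t) l)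
        - fcoef a b (v2 t) l)) e.
  move=> ht e e0; have [x x0 h] := hderiv_wsum hab Cm0 em dv2 Lv1 Lv2 ht e0.
  by exists x => // r hr rt rd; apply: unit1; exact: h.
have toderiv (F : int -> R -> R[i]) G t : (forall e, 0 < e -> exists2 x : R, 0 < x &
    forall r, 0 <= r <= Te -> r != t -> `|r - t| <= x ->
      bsum (fun l => nC (((r - t)^-1)%:C * (F l r - F l t) - G l)) e) ->
    forall l, cderiv 0 Te (F l) t (G l).
  move=> h l; apply: quotient_cderiv => // e /h[x x0 hx]; exists x => // r hr rt rd.
  exact: (bsum_term l (hx r hr rt rd)).
have Apsi t : 0 <= t <= Te -> inA a b (toC (psi t)) (c ^~ t).
  move=> ht; have [_ [psix [hx _]]] := H3 t ht.
  apply: contD_inA (hc t ht) => //; exact: has_deriv_contD hx.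
have bu1 t : 0 <= t <= Te -> bsum (fun l => nC (fcoef a b (u1 t) l)) bc.
  by move=> /bu[_ /es1].
have bv1 t : 0 <= t <= Te -> bsum (fun l => nC (fcoef a b (v1 t) l)) bd.
  by move=> /bv[_ /em1].
have Apsit0 t : 0 <= t <= Te -> inA a b (toC (psit t)) (fcoef a b (u1 t)).
  move=> ht; apply: inA_eq (fseries_inA hab (bu1 t ht)) => x hx.
  by apply/esym; apply: (pointwise_derivative hab Te0 ht hx Apsi (bu1 t ht) (qu1 t ht)); exact: H1.
have dE l t : 0 <= t <= Te -> d l t = fcoef a b (u1 t) l.
  by move=> ht; rewrite /d (inA_fcoef hab _ (Apsit0 t ht)).
have Apsit t : 0 <= t <= Te -> inA a b (toC (psit t)) (d ^~ t).
  move=> ht; have := Apsit0 t ht; congr inA; apply/funext => l.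
  by rewrite dE.
have dc l t : 0 <= t <= Te -> cderiv 0 Te (c l) t (d l t).
  by move=> ht; rewrite dE//; apply: toderiv (qu1 t ht) l.
have dd l t : 0 <= t <= Te -> cderiv 0 Te (d l) t (fcoef a b (v1 t) l).
  by move=> ht; apply: toderiv (qv1 t ht) l.
have dv l t : 0 <= t <= Te -> cderiv 0 Te (fun t => fcoef a b (v1 t) l) t (fcoef a b (v2 t) l).
  by move=> ht; apply: (toderiv (fun l t => fcoef a b (v1 t) l) _ _ (qv2 t ht)) l.
have vu2 l t : 0 <= t <= Te -> fcoef a b (v1 t) l = fcoef a b (u2 t) l.
  move=> ht; apply: (cderiv_unique Te0 ht (dd l t ht)).
  have h := toderiv (fun l t => fcoef a b (u1 t) l) _ _ (qu2 t ht) l.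
  move=> e /h[x x0 hx]; exists x => // r hr rt; rewrite !dE//; exact: hx.
have bN3 t : 0 <= t <= Te -> bsum (fun l => nC (NN l t)) bN.
  move=> ht; apply: bsum1_inv.
  have w1 (k l : int) : (fun=> 1 : R) (k + l) <= 1 * ((fun=> 1) k * (fun=> 1) l) by rewrite !mul1r.
  have := cube_weighted hab (Apsi t ht) (w := fun=> 1) (fun=> ler01) ler01 w1 (bsum1 (hc t ht)).
  by rewrite expr1n mul1r.
have clip r t : 0 <= r <= Te -> 0 <= t <= Te ->
    bsum (fun l => nC (c l r - c l t)) (bd * `|r - t|).
  wlog : r t / t <= r.
    move=> H hr ht; have [tr|rt] := leP t r; first exact: H.
    have := H t r (ltW rt) ht hr; rewrite distrC; apply: bsum_le => // l.
    by rewrite nCBC.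
  move=> tr hr ht L uL; rewrite ger0_norm ?subr_ge0//.
  have sub u : t <= u <= r -> 0 <= u <= Te.
    case/andP: hr => _ rT; case/andP: ht => t0 _ /andP[tu ur].
    by rewrite (le_trans t0 tu) (le_trans ur rT).
  case/andP: hr => _ rT; case/andP: ht => t0 _.
  apply: (mean_value_sum (F' := d) tr) => [l u /sub hu|u /sub hu]; last exact: hd.
  exact: (cderiv_sub t0 rT (dc l u hu)).
have Nlip r t : 0 <= r <= Te -> 0 <= t <= Te ->
    bsum (fun l => nC (NN l r - NN l t)) (bN1 * `|r - t|).
  move=> hr ht.
  have := cube_diff hab (Apsi r hr) (Apsi t ht) (hc r hr) (hc t ht) (clip r t hr ht).
  apply: bsum_le => //.
  by rewrite le_eqVlt; apply/orP; left; apply/eqP; rewrite /bN1; ring.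
(* The equation is only given at interior times; its coefficients are continuous
   in time, which extends it to the ends. *)
have pde0 l t : 0 < t < Te ->
    fcoef a b (v1 t) l + (del l ^+ 2)%:C * c l t + (eps ^+ 2)%:C * NN l t = 0.
  move=> ht; have ht' : 0 <= t <= Te by exact: itv_oo_cc.
  have [psitt [lap [Hd [Hlap2 Hlap] Heq]]] := H2 t ht.
  pose V := fseries a b (fcoef a b (v1 t)).
  have hV : inA a b V (fcoef a b (v1 t)) by exact: fseries_inA (bv1 t ht').
  have ptt x : a < x < b -> (psitt x)%:C = V x.
    move=> hx; have hx' : a <= x <= b by exact: itv_oo_cc.
    by apply: (pointwise_derivative hab Te0 ht' hx' Apsit (bv1 t ht') (qv1 t ht')); exact: Hd.
  have bV := inA_bmeas hV; have bp := inA_bmeas (Apsi t ht').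
  pose G x := V x + (beta%:C * toC (psi t) x + (eps ^+ 2)%:C * toC (psi t) x ^+ 3).
  have bG : bmeas a b G.
    by apply: bmeasD => //; apply: bmeasD; apply: bmeasZ => //; exact: bmeasX.
  have E : fcoef a b (toC lap) l = fcoef a b (fun x => - G x) l.
    apply: fcoef_eq_oo.
    - by case: Hlap2.
    - have bG' : bmeas a b (fun x => -1 * G x) by exact: bmeasZ.
      case: bG' => g1 g2 _.
      by split; [move: g1|move: g2]; congr measurable_fun; apply/funext => x; rewrite mulN1r.
    move=> x hx; rewrite /G -ptt//.
    have := Heq x hx => /eqP; rewrite -addrA addr_eq0 => /eqP h.
    have -> : toC lap x = - (psitt x + (beta * psi t x + eps ^+ 2 * psi t x ^+ 3))%:C.
      rewrite /toC -rmorphN; congr (_%:C).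
      by apply/eqP; rewrite -subr_eq0 opprK -(Heq x hx); apply/eqP; ring.
    have -> : toC (psi t) x ^+ 3 = (psi t x ^+ 3)%:C by rewrite /toC rmorphXn.
    by rewrite /toC; apply: complex_ext => /=; ring.
  move: E; rewrite (Hlap l) -/(c l t) fcoefN//; last exact: bmeas_L1.
  have bp3 := bmeasX 3 bp; have lp := bmeas_L1 hab bp; have lp3 := bmeas_L1 hab bp3.
  have l1 := bmeas_L1 hab (bmeasZ beta%:C bp).
  have l3 := bmeas_L1 hab (bmeasZ (eps ^+ 2)%:C bp3).
  rewrite /G (fcoefD _ (bmeas_L1 hab bV) (L1D l1 l3)) (fcoefD _ l1 l3).
  rewrite (fcoefZ _ _ lp) (fcoefZ _ _ lp3).
  rewrite (inA_fcoef hab _ hV) -/(c l t) -/(NN l t) => E.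
  rewrite (delta_sqr a b alpha hbeta) rmorphD /= mulrDl E; ring.
have pde l t : 0 <= t <= Te ->
    fcoef a b (v1 t) l + (del l ^+ 2)%:C * c l t + (eps ^+ 2)%:C * NN l t = 0.
  move=> ht; apply/nC_eq0/eqP; rewrite eq_le nC_ge0 andbT.
  pose X t := fcoef a b (v1 t) l + (del l ^+ 2)%:C * c l t.
  have dX := cderivD (dv l t ht) (cderivZ (del l ^+ 2)%:C (dc l t ht)).
  have [x x0 hx] := cderiv_lip dX; set LX := nC _ in hx.
  have LX0 : 0 <= LX by exact: nC_ge0.
  apply: (@le_by_eps _ _ _ (LX + 1 + eps ^+ 2 * bN1)).
    by rewrite !addr_ge0// mulr_ge0// ltW.
  move=> e e0; rewrite add0r.
  have z0 : 0 < Num.min x e by rewrite lt_min x0.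
  have [r [hr _]] := near_point Te0 ht z0; rewrite le_min => /andP[rx re].
  have hr' : 0 <= r <= Te by exact: itv_oo_cc.
  have h1 := hx r hr' rx; have h2 := bsum_term l (Nlip r t hr' ht).
  have -> : fcoef a b (v1 t) l + (del l ^+ 2)%:C * c l t + (eps ^+ 2)%:C * NN l t =
    - ((X r - X t) + (eps ^+ 2)%:C * (NN l r - NN l t)).
    rewrite /X -[LHS]subr0 -(pde0 l r hr); ring.
  rewrite nCN; apply: le_trans (nCD _ _) _; rewrite mulrDl; apply: lerD.
    by apply: le_trans h1 _; rewrite ler_wpM2l// addr_ge0.
  have -> : eps ^+ 2 * bN1 * e = eps ^+ 2 * (bN1 * e) by rewrite [RHS]mulrA.
  rewrite nCM nC_real gtr0_norm//; apply: ler_wpM2l; first exact: ltW.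
  by apply: le_trans h2 _; apply: ler_wpM2l.
pose N1 l t := - ((eps ^- 2)%:C * (fcoef a b (v2 t) l + (del l ^+ 2)%:C * d l t)).
have eV : (eps ^- 2)%:C * (eps ^+ 2)%:C = 1 :> R[i] by rewrite -rmorphM mulVf// gt_eqF.
have NE l t : 0 <= t <= Te -> NN l t =
    - ((eps ^- 2)%:C * (fcoef a b (v1 t) l + (del l ^+ 2)%:C * c l t)).
  move=> ht; have := pde l t ht => /eqP; rewrite addr_eq0 => /eqP ->.
  by rewrite mulrN opprK mulrA eV mul1r.
have dN l t : 0 <= t <= Te -> cderiv 0 Te (NN l) t (N1 l t).
  move=> ht; have h := cderivZ (-1) (cderivZ (eps ^- 2)%:C
    (cderivD (dv l t ht) (cderivZ (del l ^+ 2)%:C (dc l t ht)))).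
  have -> : N1 l t = -1 * ((eps ^- 2)%:C * (fcoef a b (v2 t) l + (del l ^+ 2)%:C * d l t)).
    by rewrite mulN1r.
  move=> e /h[x x0 hx]; exists x => // r hr rt.
  by rewrite (NE l r hr) (NE l t ht); move: (hx r hr rt); rewrite !mulN1r.
have hw t : 0 <= t <= Te -> bsum (fun l => jap (s / 2) l * nC (c l t)) bt.
  move=> ht.
  have w0 l : 0 <= jap q l by exact: jap_ge0.
  have h1 : bsum (fun l => jap q l * nC (fcoef a b (v1 t) l)) bw.
    have := bu t ht => -[_ _ /up /(ew _ _ Mp0)].
    by apply: bsum_le => // l; rewrite vu2.
  have h2 : bsum (fun l => jap q l * nC (c l t)) bw.
    by have := bu t ht => -[/up /(ew _ _ Mp0)].
  have h3 := cube_weighted hab (Apsi t ht) w0 Kw0 (fun k l => jap_submul a b k l q0) h2.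
  apply: bsum_le (bsumZ (Cdel_ge0 alpha hbeta) (bsumD h1 h3)) => // l.
  have -> : jap (s / 2) l = jap q l * jap (alpha / 2) l.
    by rewrite -japD; congr jap; rewrite /q; field.
  have hdc : del l ^+ 2 * nC (c l t) <= nC (fcoef a b (v1 t) l) + nC (NN l t).
    have -> : del l ^+ 2 * nC (c l t) = nC ((del l ^+ 2)%:C * c l t).
      by rewrite nCM nC_real ger0_norm ?sqr_ge0.
    have -> : (del l ^+ 2)%:C * c l t = - (fcoef a b (v1 t) l + (eps ^+ 2)%:C * NN l t).
      by have := pde l t ht => /eqP; rewrite addrAC addr_eq0 => /eqP ->; rewrite opprK.
    rewrite nCN; apply: le_trans (nCD _ _) _; rewrite lerD2l nCM nC_real gtr0_norm//.
    by rewrite ler_piMl ?nC_ge0.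
  rewrite -mulrDr mulrCA -mulrA ler_wpM2l//.
  apply: (@le_trans _ _ (Cdel alpha beta * del l ^+ 2 * nC (c l t))).
    by rewrite ler_wpM2r ?nC_ge0// (jap_le_delta a b halpha hbeta).
  by rewrite -mulrA ler_wpM2l// Cdel_ge0.
exists N1 => t ht; split; [exact: Apsi|exact: Apsit|by []|split].
- by move=> l; exact: dc.
- move=> l; have := dd l t ht; congr cderiv.
  have /eqP := pde l t ht; rewrite -addrA addr_eq0 => /eqP ->.
  by rewrite opprD.
- by move=> l; exact: dN.
split.
- have := bu t ht => -[/up /(ed _ _ Mp0) h _ _].
  by apply: bsum_le h => //; rewrite /B -!addrA lerDl !addr_ge0.
- exact: bsum_le leB1 (hd t ht).
- exact: bsum_le leB2 (bN3 t ht).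
- have := cderiv_sum_bound Te0 ht (fun l => dN l t ht) (fun r hr => Nlip r t hr ht).
  exact: bsum_le.
- exact: bsum_le leB4 (hw t ht).
Qed.

End exact_solution.

(** * Fourier coefficients of the numerical solution *)

Section numerical_solution.
Variables (R : realType) (a b alpha beta eps tau : R).
Hypotheses (hab : a < b) (hbeta : 0 < beta).
Variables (psi0 psi1 : R -> R) (c0 d1 : int -> R[i]).
Hypotheses (h0 : inA a b (toC psi0) c0) (h1 : inA a b (toC psi1) d1).
Local Notation del := (delta a b alpha beta).
Hypothesis hc0 : exists B, bsum (fun l => del l * nC (c0 l)) B.
Variable phi : nat -> R -> R[i].
Hypothesis hphi : is_semidiscrete a b alpha beta eps tau psi0 psi1 phi.

Local Notation i_ := (0 +i* 1 : R[i]).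
Let repart n x : R := complex.Re (phi n x).
Let f n l : R[i] := fcoef a b (phi n) l.
Let NN n l : R[i] := fcoef a b (fun x => toC (repart n) x ^+ 3) l.
Let kap : R[i] := (eps ^+ 2 * tau / 2)%:C.
Let el l : R[i] := expi (tau * del l).

Let delV_gt0 l : 0 < (del l)^-1. Proof. by rewrite invr_gt0 delta_gt0. Qed.

Let sb0 : 0 < Num.sqrt beta. Proof. by rewrite sqrtr_gt0. Qed.

Let delV_le l : (del l)^-1 <= (Num.sqrt beta)^-1.
Proof. by rewrite lef_pV2 ?posrel ?delta_ge//; exact: delta_gt0. Qed.

Let nC_delV l z : nC (((del l)^-1)%:C * z) = (del l)^-1 * nC z.
Proof. by rewrite nCM nC_real gtr0_norm. Qed.

Let delVK l : cancel ( *%R (del l)^-1) ( *%R (del l)).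
Proof. by apply: mulVKf; rewrite gt_eqF ?delta_gt0. Qed.

(** The weight [del] makes the series defining the numerical velocity converge. *)
Let good (g : R -> R[i]) (c : int -> R[i]) :=
  inA a b g c /\ exists B, bsum (fun l => del l * nC (c l)) B.

Let bsum_good c B : bsum (fun l => del l * nC (c l)) B ->
  bsum (fun l => nC (c l)) ((Num.sqrt beta)^-1 * B).
Proof.
move=> h; apply: bsum_le (bsumZ (ltW (_ : 0 < (Num.sqrt beta)^-1)) h) => //; last by rewrite invr_gt0.
move=> l; rewrite mulrA ler_peMl ?nC_ge0// mulrC ler_pdivlMr// mul1r.
exact: delta_ge.
Qed.

Let gnlE n x : gnl (phi n) x = toC (repart n) x ^+ 3.
Proof.
rewrite /gnl /toC /repart; case: (phi n x) => u v.
have -> : (u +i* v + conjc (u +i* v)) = (2 * u)%:C by apply: complex_ext => /=; ring.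
rewrite -!rmorphXn -rmorphM /=; congr (_%:C); rewrite exprMn; rewrite (_ : 2 ^+ 3 = 8) ?mulKf ?pnatr_eq0//; ring.
Qed.

Let fcoef_real (g : R -> R) l : conjc (fcoef a b (toC g) (- l)) = fcoef a b (toC g) l.
Proof.
rewrite -fcoef_conj; apply: fcoef_eq => x _.
by apply: complex_ext; rewrite /= ?oppr0.
Qed.

Let fseries_real c x : (forall l, conjc (c (- l)) = c l) ->
  complex.Im (fseries a b c x) = 0.
Proof.
move=> hc; rewrite fseriesE /=.
have -> : (fun N => complex.Im (tpoly a b c N x)) = (fun=> 0 : R).
  apply/funext => N; have : conjc (tpoly a b c N x) = tpoly a b c N x.
    by rewrite tpoly_conj; congr tpoly; apply/funext => l.
  by case: (tpoly a b c N x) => u v [] /= /eqP; rewrite eq_sym -addr_eq0 -mulr2n mulrn_eq0 => /eqP.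
exact: lim_cst.
Qed.

Let NN_conj n l : conjc (NN n (- l)) = NN n l.
Proof.
rewrite /NN; have E k : fcoef a b (fun x => toC (repart n) x ^+ 3) k =
    fcoef a b (toC (fun x => repart n x ^+ 3)) k.
  by apply: fcoef_eq => x _; rewrite /toC rmorphXn.
by rewrite !E fcoef_real.
Qed.

Let jV_real (g : R -> R) x : complex.Im (jnablaV a b alpha beta (toC g) x) = 0.
Proof.
apply: fseries_real => l.
have conjM (u v : R[i]) : conjc (u * v) = conjc u * conjc v by rewrite rmorphM.
rewrite conjM fcoef_real; congr (_ * _).
apply: complex_ext; rewrite /= ?oppr0//.
by rewrite /delta muN normrN.
Qed.

(** The new nonlinear term only changes the imaginary part, hence the implicit
    scheme determines the real part of the next iterate explicitly. *)
Let Gnl_Re n x : complex.Re (Gnl a b alpha beta (phi n) x) = 0.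
Proof.
rewrite /Gnl cReM [complex.Re i_]/= [complex.Im i_]/= mul0r mul1r sub0r.
have -> : gnl (phi n) = toC (fun x => repart n x ^+ 3).
  by apply/funext => y; rewrite gnlE /toC rmorphXn.
by rewrite jV_real oppr0.
Qed.

Let cn n l : R[i] := (2^-1)%:C * (f n l + conjc (f n (- l))).

Let good_re n : inA a b (phi n) (f n) -> inA a b (toC (repart n)) (cn n).
Proof.
move=> hf; have h := inAZ (2^-1)%:C (inAD hf (inA_conj hf)).
apply: inA_eq h => x _; rewrite /toC /repart; case: (phi n x) => u v.
by apply: complex_ext => /=; field.
Qed.

Let bsum_re (c : int -> R[i]) C : bsum (fun l => nC (c l)) C ->
  bsum (fun l => nC ((2^-1)%:C * (c l + conjc (c (- l))))) (2^-1 * (C + C)).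
Proof.
have q0 : 0 <= (2^-1 : R) by [].
move=> hC; have q := bsumZ q0 (bsumD hC (bsum_reindex (@oppr_inj int) hC)).
apply: bsum_le q => // l; rewrite nCM nC_real ger0_norm// ler_wpM2l//.
by apply: le_trans (nCD _ _) _; rewrite nC_conj.
Qed.

Let bsumNN n c B : inA a b (toC (repart n)) c -> bsum (fun l => nC (c l)) B ->
  bsum (fun l => nC (NN n l)) (B ^+ 3).
Proof.
move=> hA hB.
have w1 (k l : int) : (fun=> 1 : R) (k + l) <= 1 * ((fun=> 1) k * (fun=> 1) l) by rewrite !mul1r.
have := cube_weighted hab hA (w := fun=> 1) (fun=> ler01) ler01 w1 (bsum1 hB).
by rewrite expr1n mul1r => /bsum1_inv.
Qed.

Let Gnl_good n B : bsum (fun l => nC (NN n l)) B ->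
  good (Gnl a b alpha beta (phi n)) (fun l => i_ * (((del l)^-1)%:C * NN n l)).
Proof.
move=> hB.
have bV : bsum (fun l => nC (((del l)^-1)%:C * NN n l)) ((Num.sqrt beta)^-1 * B).
  apply: bsum_le (bsumZ (ltW (_ : 0 < (Num.sqrt beta)^-1)) hB) => //; last by rewrite invr_gt0.
  by move=> l; rewrite nC_delV ler_wpM2r ?nC_ge0.
split; last first.
  exists B; apply: bsum_le hB => // l.
  by rewrite nCM nC_i mul1r nC_delV delVK.
have hs := inAZ i_ (fseries_inA hab bV).
have E : (fun l => ((del l)^-1)%:C * fcoef a b (gnl (phi n)) l) =
    (fun l => ((del l)^-1)%:C * NN n l).
  apply/funext => l; rewrite /NN (_ : gnl (phi n) = fun x => toC (repart n) x ^+ 3)//.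
  by apply/funext => y; rewrite gnlE.
by rewrite -E in hs.
Qed.

Let exp_good g c : good g c -> good (expjnabla a b alpha beta tau g) (fun l => el l * c l).
Proof.
move=> [hg [B hB]].
have ne l : nC (el l * c l) = nC (c l) by rewrite nCM nC_expi mul1r.
split; last by exists B; apply: bsum_le hB => // l; rewrite ne.
have bV : bsum (fun l => nC (el l * c l)) ((Num.sqrt beta)^-1 * B).
  by apply: bsum_le (bsum_good hB) => // l; rewrite ne.
have E : (fun l => el l * fcoef a b g l) = (fun l => el l * c l).
  by apply/funext => l; rewrite (inA_fcoef hab _ hg).
by have := fseries_inA hab bV; rewrite -E.
Qed.

Let goodD g h c d : good g c -> good h d -> good (fun x => g x + h x) (fun l => c l + d l).
Proof.
move=> [hg [B hB]] [hh [C hC]]; split; first exact: inAD.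
exists (B + C); apply: bsum_le (bsumD hB hC) => // l.
by rewrite -mulrDr ler_wpM2l ?nCD// ltW// delta_gt0.
Qed.

Let goodZ k g c : good g c -> good (fun x => k * g x) (fun l => k * c l).
Proof.
move=> [hg [B hB]]; split; first exact: inAZ.
by exists (nC k * B); apply: bsum_le (bsumZ (nC_ge0 k) hB) => // l; rewrite nCM mulrCA.
Qed.

Let good_ext g c c' : (forall l, c l = c' l) -> good g c -> good g c'.
Proof. by move=> /funext ->. Qed.

Let good_f n c : good (phi n) c -> good (phi n) (f n).
Proof.
move=> hg; have [hA _] := hg; apply: good_ext hg => l.
by rewrite /f (inA_fcoef hab _ hA).
Qed.

Let good0 : good (phi 0%N) (fun l => c0 l - i_ * (((del l)^-1)%:C * d1 l)).
Proof.
have [_ e0 _] := hphi; have [[B1 hB1] _] := h1; have [B0 hB0] := hc0.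
have bV : bsum (fun l => nC (((del l)^-1)%:C * d1 l)) ((Num.sqrt beta)^-1 * B1).
  apply: bsum_le (bsumZ (ltW (_ : 0 < (Num.sqrt beta)^-1)) hB1) => //; last by rewrite invr_gt0.
  by move=> l; rewrite nC_delV ler_wpM2r ?nC_ge0.
split; last first.
  exists (B0 + B1); apply: bsum_le (bsumD hB0 hB1) => // l.
  apply: le_trans (ler_wpM2l (ltW (delta_gt0 _ _ _ hbeta l)) (nCB _ _)) _.
  by rewrite mulrDr lerD2l nCM nC_i mul1r nC_delV delVK.
have hs := inAB h0 (inAZ i_ (fseries_inA hab bV)).
apply: inA_eq hs => x hx; rewrite e0// /jnablaV /fmult.
rewrite (_ : (fun l => _ * fcoef a b (toC psi1) l) = fun l => ((del l)^-1)%:C * d1 l)//.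
by apply/funext => l; rewrite (inA_fcoef hab _ h1).
Qed.

(** The real part of the next iterate is that of an explicit expression, so its
    cube is known to have summable coefficients before the iterate itself is. *)
Let goodS n : good (phi n) (f n) -> good (phi n.+1) (fun l => el l * f n l +
  kap * (i_ * (((del l)^-1)%:C * NN n.+1 l) + el l * (i_ * (((del l)^-1)%:C * NN n l)))).
Proof.
move=> hf; have [hA [B hB]] := hf; have [_ _ eS] := hphi.
have bn := bsum_good hB.
have bcn m c C : inA a b (phi m) c -> bsum (fun l => nC (c l)) C ->
    bsum (fun l => nC (NN m l)) ((2^-1 * (C + C)) ^+ 3).
  move=> hm hC; apply: bsumNN.
    have h := inAZ (2^-1)%:C (inAD hm (inA_conj hm)).
    apply: inA_eq h => x _; rewrite /toC /repart; case: (phi m x) => u v.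
    by apply: complex_ext => /=; field.
  exact: bsum_re hC.
have gG := Gnl_good (bcn _ _ _ hA bn).
have gY := goodD (exp_good hf) (goodZ kap (exp_good gG)).
have [hY [BY hBY]] := gY.
have gGS : good (Gnl a b alpha beta (phi n.+1)) (fun l => i_ * (((del l)^-1)%:C * NN n.+1 l)).
  have hC := bsum_good hBY.
  have hre := inAZ (2^-1)%:C (inAD hY (inA_conj hY)).
  have hre' := inA_eq (g := toC (repart n.+1)) _ hre.
  apply: Gnl_good; apply: bsumNN (hre' _) _; last first.
    exact: bsum_re hC.
  pose Y x := expjnabla a b alpha beta tau (phi n) x +
    kap * expjnabla a b alpha beta tau (Gnl a b alpha beta (phi n)) x.
  move=> x hx; rewrite /toC /repart.
  have -> : complex.Re (phi n.+1 x) = complex.Re (Y x).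
    have -> : phi n.+1 x = Y x + kap * Gnl a b alpha beta (phi n.+1) x.
      by rewrite [LHS]eS// mulrDr addrAC addrA.
    by rewrite cReD cReM Gnl_Re mulr0 mul0r subr0 addr0.
  rewrite -/(Y x); move: (Y x) => [u v]; by apply: complex_ext => /=; field.
have gS := goodD gY (goodZ kap gGS).
have {gS}[h2 h3] := gS; split.
  have h x : a <= x <= b -> expjnabla a b alpha beta tau (phi n) x +
      kap * expjnabla a b alpha beta tau (Gnl a b alpha beta (phi n)) x +
      kap * Gnl a b alpha beta (phi n.+1) x = phi n.+1 x.
    by move=> hx; rewrite [RHS]eS// mulrDr addrAC addrA.
  have := inA_eq h h2; congr inA; apply/funext => l; ring.
case: h3 => B3 hB3; exists B3; apply: bsum_le hB3 => // l.
rewrite le_eqVlt; apply/orP; left; apply/eqP; congr (_ * nC _); ring.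
Qed.

Let good_all n : good (phi n) (f n).
Proof. by elim: n => [|n IH]; [exact: good_f good0|exact: good_f (goodS IH)]. Qed.

Let conjM (u v : R[i]) : conjc (u * v) = conjc u * conjc v. Proof. by rewrite rmorphM. Qed.
Let conjD (u v : R[i]) : conjc (u + v) = conjc u + conjc v. Proof. by rewrite rmorphD. Qed.
Let conj_real (r : R) : conjc r%:C = r%:C. Proof. by apply: complex_ext; rewrite /= ?oppr0. Qed.
Let conj_i : conjc i_ = - i_. Proof. by apply: complex_ext; rewrite /= ?oppr0. Qed.
Let delN l : del (- l) = del l. Proof. by rewrite /delta muN normrN. Qed.

Let coef_real (g : R -> R) c l : inA a b (toC g) c -> conjc (c (- l)) = c l.
Proof. by move=> hg; rewrite -!(inA_fcoef hab _ hg) fcoef_real. Qed.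

Let fS n l : f n.+1 l = el l * f n l + kap * (i_ * (((del l)^-1)%:C * NN n.+1 l) +
  el l * (i_ * (((del l)^-1)%:C * NN n l))).
Proof. by have [h _] := goodS (good_all n); rewrite /f (inA_fcoef hab _ h). Qed.

Let f0 l : f 0%N l = c0 l - i_ * (((del l)^-1)%:C * d1 l).
Proof. by have [h _] := good0; rewrite /f (inA_fcoef hab _ h). Qed.

(** The counterparts of [trav]: the scheme computes the coefficients of one of the
    travelling waves, and those of the other one are conjugate because the
    solution is real. *)
Definition num_trav (s : bool) n l : R[i] := if s then f n l else conjc (f n (- l)).

Definition num_c n l : R[i] := (2^-1)%:C * (num_trav true n l + num_trav false n l).

Definition num_d n l : R[i] :=
  i_ * (2^-1)%:C * ((del l)%:C * (num_trav true n l - num_trav false n l)).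

Definition num_N n l : R[i] := fcoef a b (fun x => psi_approx psi0 phi n x ^+ 3) l.

Let psi_approxE n x : a <= x <= b -> psi_approx psi0 phi n x = toC (repart n) x.
Proof.
move=> hx; rewrite /toC /repart; case: n => [|n] /=.
  have [_ e0 _] := hphi; rewrite e0// cReB cReM jV_real.
  by rewrite mul0r mulr0 subr0 subr0.
by case: (phi n.+1 x) => u v; apply: complex_ext => /=; field.
Qed.

Let num_NE n l : num_N n l = NN n l.
Proof. by apply: fcoef_eq => x hx; rewrite psi_approxE. Qed.

Lemma num_trav0 s l :
  num_trav s 0 l = c0 l - (sgnR s)%:C * i_ * ((del l)^-1)%:C * d1 l.
Proof.
case: s; rewrite /num_trav /sgnR f0; first by rewrite mul1r !mulrA.
rewrite delN -mulNr conjD (coef_real _ h0) !conjM conj_real (coef_real _ h1).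
rewrite (_ : conjc (- i_) = i_); last by apply: complex_ext; rewrite /= ?oppr0 ?opprK.
by rewrite rmorphN1 mulN1r !mulNr opprK mulrA.
Qed.

Lemma num_travS s n l : num_trav s n.+1 l =
  expi (sgnR s * (tau * del l)) * num_trav s n l +
  (sgnR s)%:C * i_ * (eps ^+ 2 * tau / 2)%:C * ((del l)^-1)%:C *
  (num_N n.+1 l + expi (sgnR s * (tau * del l)) * num_N n l).
Proof.
rewrite !num_NE; case: s; rewrite /num_trav /sgnR fS.
  rewrite !mul1r /el /kap; move: (expi _) => e; move: (NN _ _) (NN _ _) => p q.
  by move: (f n l) (i_ : R[i]) (_%:C) (_%:C) => *; ring.
rewrite mulN1r expiN -[NN n.+1 l]NN_conj -[NN n l]NN_conj /el /kap delN rmorphN1.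
move: (expi _) (NN _ _) (NN _ _) (f _ _) => e p q u.
rewrite !(conjM, conjD) !conj_real conj_i.
by move: (conjc e) (conjc p) (conjc q) (conjc u) (i_ : R[i]) (_%:C) (_%:C) => *; ring.
Qed.

Lemma num_c_inA n : inA a b (psi_approx psi0 phi n) (num_c n).
Proof.
have [h _] := good_all n; apply: inA_eq (good_re h) => x hx; by rewrite psi_approxE.
Qed.

Lemma num_d_inA n : inA a b (eta_approx a b alpha beta psi1 phi n) (num_d n).
Proof.
case: n => [|n] /=.
  have := h1; congr inA; apply/funext => l; rewrite /num_d !num_trav0 /sgnR.
  have dV : (del l)%:C * ((del l)^-1)%:C = 1 by rewrite -rmorphM mulfV ?gt_eqF ?delta_gt0.
  have i2 : i_ * i_ = -1 by apply: complex_ext => /=; ring.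
  have h2 : (2^-1)%:C * 2 = 1 :> R[i] by apply: complex_ext => /=; field.
  rewrite rmorphN1 rmorph1.
  transitivity (- (i_ * i_) * ((2^-1)%:C * 2) * ((del l)%:C * ((del l)^-1)%:C) * d1 l).
    by rewrite i2 h2 dV; ring.
  by move: (i_ : R[i]) (_%:C) (_%:C) (_%:C) => *; ring.
have [h [B hB]] := good_all n.+1.
have hD := inAB h (inA_conj h).
have hn l : fcoef a b (fun y => phi n.+1 y - conjc (phi n.+1 y)) l =
    num_trav true n.+1 l - num_trav false n.+1 l.
  by rewrite (inA_fcoef hab _ hD).
have bV : bsum (fun l => nC ((del l)%:C * fcoef a b (fun y => phi n.+1 y - conjc (phi n.+1 y)) l))
    (B + B).
  have := bsumD hB (bsum_reindex (@oppr_inj int) hB); apply: bsum_le => // l.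
  have q : nC (num_trav true n.+1 l - num_trav false n.+1 l) <= nC (f n.+1 l) + nC (f n.+1 (- l)).
    by apply: le_trans (nCB _ _) _; rewrite nC_conj.
  rewrite hn nCM nC_real gtr0_norm; last exact: delta_gt0.
  apply: le_trans (ler_wpM2l (ltW (delta_gt0 _ _ _ hbeta _)) q) _.
  by rewrite mulrDr [X in _ <= _ + X]/comp delN.
have := inAZ (i_ * (2^-1)%:C) (fseries_inA hab bV).
by congr inA; apply/funext => l; rewrite hn.
Qed.

End numerical_solution.

(** * Stability *)

Section stability.
Variables (R : realType) (eps tau T d0 Z Lc : R).
Hypotheses (tau0 : 0 < tau) (he : 0 < eps <= 1) (T0 : 0 < T) (d00 : 0 < d0).
Hypotheses (Z0 : 0 <= Z) (Lc0 : 0 <= Lc).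
Variables (del : int -> R) (c d NN : int -> R -> R[i]).
Variables (nu : bool -> nat -> int -> R[i]) (Nn : nat -> int -> R[i]).
Hypothesis del_ge : forall l, d0 <= del l.
Let Te := T / eps ^+ 2.
Local Notation i_ := ('i : R[i]).
Let sg (s : bool) : R[i] := (sgnR s)%:C.
Let W s k l : R[i] := expi (- (sgnR s * del l) * (k%:R * tau)).
Let cn n l : R[i] := (2^-1)%:C * (nu true n l + nu false n l).
Let dn n l : R[i] := i_ * (2^-1)%:C * ((del l)%:C * (nu true n l - nu false n l)).
Let D k l : R[i] := NN l (k%:R * tau) - Nn k l.

Hypothesis nu0 : forall s l, nu s 0%N l = c l 0 - sg s * i_ * ((del l)^-1)%:C * d l 0.
Hypothesis nuS : forall s n l, nu s n.+1 l =
  expi (sgnR s * (tau * del l)) * nu s n l +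
  sg s * i_ * (eps ^+ 2 * tau / 2)%:C * ((del l)^-1)%:C *
  (Nn n.+1 l + expi (sgnR s * (tau * del l)) * Nn n l).

Let defect s n l : R[i] := (del l)%:C * (chi del c d s l (n%:R * tau) - chi del c d s l 0) -
  \sum_(k < n) (tau / 2)%:C * (sg s * i_ * (eps ^+ 2)%:C *
    (W s k l * NN l (k%:R * tau) + W s k.+1 l * NN l (k.+1%:R * tau))).

Hypothesis hdef : forall s n, n%:R * tau <= Te -> bsum (fun l => nC (defect s n l)) Z.
Hypothesis hlip : forall n e, n%:R * tau <= Te -> e <= 1 ->
  bsum (fun l => nC (c l (n%:R * tau) - cn n l)) e -> bsum (fun l => nC (D n l)) (e * Lc).

Let KL := Lc / d0.
Let Ka := Z * expR (KL * T).
Hypothesis Ka1 : Ka <= d0.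
Let q := eps ^+ 2 * tau * KL.

Let del0 l : 0 < del l. Proof. exact: lt_le_trans (del_ge l). Qed.
Let dV l : (del l)%:C * ((del l)^-1)%:C = 1 :> R[i].
Proof. by rewrite -rmorphM mulfV ?gt_eqF. Qed.
Let sgsg s : sg s * sg s = 1.
Proof. by case: s; rewrite /sg /sgnR ?rmorphN1 ?rmorph1 ?mulrNN mulr1. Qed.
Let nsg s : nC (sg s) = 1.
Proof. by rewrite nC_real; case: s; rewrite /sgnR ?normrN1 ?normr1. Qed.
Let nW s k l : nC (W s k l) = 1. Proof. exact: nC_expi. Qed.
Let WV s k l : conjc (W s k l) * W s k l = 1.
Proof. by rewrite -expiN mulrC expiK. Qed.
Let i2 : i_ * i_ = -1. Proof. exact: ii. Qed.
Let e20 : 0 < eps ^+ 2. Proof. by case/andP: he => e0 _; rewrite exprn_gt0. Qed.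
Let half2 (z : R[i]) : (2^-1)%:C * (z + z) = z.
Proof. by case: z => u v; apply: complex_ext => /=; field. Qed.

Let U s n l : R[i] := \sum_(k < n) (tau / 2)%:C * (sg s * i_ * (eps ^+ 2)%:C *
    (W s k l * D k l + W s k.+1 l * D k.+1 l)).

(* In the rotating frame the scheme is a trapezoidal sum, of the same form as the
   one in the defect of the exact solution. *)
Let numerical_sum s n l : (del l)%:C * (W s n l * nu s n l - nu s 0%N l) =
  \sum_(k < n) (tau / 2)%:C * (sg s * i_ * (eps ^+ 2)%:C *
    (W s k l * Nn k l + W s k.+1 l * Nn k.+1 l)).
Proof.
elim: n => [|n IH].
  by rewrite big_ord0 /W mul0r mulr0 expi0 mul1r subrr mulr0.
rewrite big_ord_recr /= -IH nuS.
have e1 : W s n.+1 l * expi (sgnR s * (tau * del l)) = W s n l.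
  by rewrite /W -expiD; congr expi; rewrite -natr1; ring.
have -> : (eps ^+ 2 * tau / 2)%:C = (eps ^+ 2)%:C * (tau / 2)%:C :> R[i].
  by rewrite -rmorphM mulrA.
rewrite -e1.
transitivity ((del l)%:C * (W s n.+1 l * expi (sgnR s * (tau * del l)) * nu s n l - nu s 0%N l) +
  ((del l)%:C * ((del l)^-1)%:C) * ((tau / 2)%:C * (sg s * i_ * (eps ^+ 2)%:C *
   (W s n.+1 l * expi (sgnR s * (tau * del l)) * Nn n l + W s n.+1 l * Nn n.+1 l)))); last first.
  by rewrite dV mul1r.
move: (nu s n l) (nu s 0%N l) (Nn _ _) (Nn _ _) (W _ _ _) (expi _) (sg s) (i_ : R[i]) => *.
move: (_%:C) (_%:C) (_%:C) (_%:C) => *; ring.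
Qed.

Let chi0 s l : chi del c d s l 0 = nu s 0%N l.
Proof. by rewrite /chi /trav subrr mulr0 expi0 mul1r nu0. Qed.

Let travE s l t : trav del c d s l t = c l t - sg s * i_ * ((del l)^-1)%:C * d l t.
Proof. by []. Qed.

Let chiE s n l : chi del c d s l (n%:R * tau) = W s n l * trav del c d s l (n%:R * tau).
Proof. by rewrite /chi /W subr0. Qed.

Let errorE s n l : (del l)%:C * (trav del c d s l (n%:R * tau) - nu s n l) =
  conjc (W s n l) * (defect s n l + U s n l).
Proof.
have -> : defect s n l + U s n l =
    (del l)%:C * (chi del c d s l (n%:R * tau) - chi del c d s l 0) -
    (del l)%:C * (W s n l * nu s n l - nu s 0%N l).
  rewrite numerical_sum /defect -addrA; congr (_ + _).
  rewrite /U addrC -sumrB -sumrN; apply: eq_bigr => k _; rewrite /D.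
  by move: (_%:C) (_%:C) (sg s) (i_ : R[i]) (W _ _ _) (W _ _ _) (NN _ _) (NN _ _) (Nn _ _) (Nn _ _) => *; ring.
rewrite chiE chi0.
transitivity ((conjc (W s n l) * W s n l) * ((del l)%:C * (trav del c d s l (n%:R * tau) - nu s n l))).
  by rewrite WV mul1r.
by move: (conjc (W s n l)) (W s n l) (_%:C) (trav _ _ _ _ _ _) (nu _ _ _) (nu _ _ _) => *; ring.
Qed.

(* What remains of the sum of the nonlinear differences without the newest one. *)
Let V s n l : R[i] := \sum_(k < n) W s k l * D k l + \sum_(k < n.-1) W s k.+1 l * D k.+1 l.

Let UE s n l : U s n l = (tau / 2)%:C * (sg s * i_ * (eps ^+ 2)%:C) *
  (V s n l + if n is 0%N then 0 else W s n l * D n l).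
Proof.
have -> : V s n l + (if n is 0%N then 0 else W s n l * D n l) =
    \sum_(k < n) (W s k l * D k l + W s k.+1 l * D k.+1 l).
  rewrite /V big_split /= -addrA; congr (_ + _).
  by case: n => [|n]; rewrite ?big_ord0 ?addr0// big_ord_recr.
by rewrite mulr_sumr; apply: eq_bigr => k _; rewrite mulrA.
Qed.

(** In the position the newest nonlinear terms of the two travelling waves cancel,
    since they enter with opposite signs; the error is thus bounded by earlier
    errors only, and the implicit scheme needs no smallness of the time step. *)
Let c_error n l : del l * nC (c l (n%:R * tau) - cn n l) <=
  2^-1 * (nC (defect true n l) + nC (defect false n l)) +
  eps ^+ 2 * tau * \sum_(k < n) nC (D k l).
Proof.
have E : (del l)%:C * (c l (n%:R * tau) - cn n l) =
   (2^-1)%:C * (conjc (W true n l) * defect true n l + conjc (W false n l) * defect false n l) +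
   (2^-1)%:C * ((tau / 2)%:C * i_ * (eps ^+ 2)%:C) *
     (conjc (W true n l) * V true n l - conjc (W false n l) * V false n l).
  have cE : c l (n%:R * tau) = (2^-1)%:C * (trav del c d true l (n%:R * tau) + trav del c d false l (n%:R * tau)).
    rewrite -[LHS]half2 /trav /sgnR rmorphN1 rmorph1; congr (_ * _).
    by move: (c _ _) (d _ _) (_%:C) ('i : R[i]) => *; ring.
  rewrite cE /cn -mulrBr mulrCA.
  transitivity ((2^-1)%:C * ((del l)%:C * (trav del c d true l (n%:R * tau) - nu true n l) +
      (del l)%:C * (trav del c d false l (n%:R * tau) - nu false n l))).
    by move: (_%:C) (_%:C) (trav _ _ _ _ _ _) (trav _ _ _ _ _ _) (nu _ _ _) (nu _ _ _) => *; ring.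
  rewrite !errorE !UE.
  have Q s : conjc (W s n l) * (defect s n l + (tau / 2)%:C * (sg s * i_ * (eps ^+ 2)%:C) *
      (V s n l + (if n is 0%N then 0 else W s n l * D n l))) =
     conjc (W s n l) * defect s n l + (tau / 2)%:C * (sg s * i_ * (eps ^+ 2)%:C) *
      (conjc (W s n l) * V s n l + (if n is 0%N then 0 else D n l)).
    clear cE; case: n => [|n]; first by rewrite !addr0 mulrDr mulrCA.
    rewrite -[in RHS](mul1r (D _ _)) -(WV s n.+1 l).
    by move: (conjc (W s n.+1 l)) (defect _ _ _) (_%:C) (_%:C) (sg s) (i_ : R[i]) (V _ _ _) (W _ _ _) (D _ _) => *; ring.
  rewrite !Q /sg /sgnR rmorphN1 rmorph1.
  move: (conjc (W true n l)) (conjc (W false n l)) (defect _ _ _) (defect _ _ _) (V _ _ _) (V _ _ _) => *.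
  by move: (_%:C) (_%:C) (_%:C) (i_ : R[i]) (match _ with 0%N => _ | _ => _ end) => *; ring.
have -> : del l * nC (c l (n%:R * tau) - cn n l) = nC ((del l)%:C * (c l (n%:R * tau) - cn n l)).
  by rewrite nCM nC_real gtr0_norm.
rewrite E; apply: le_trans (nCD _ _) _; apply: lerD.
  rewrite nCM nC_real ger0_norm// ler_wpM2l//; apply: le_trans (nCD _ _) _.
  by rewrite !nCM !nC_conj !nW !mul1r.
have nV s : nC (conjc (W s n l) * V s n l) <= 2 * \sum_(k < n) nC (D k l).
  rewrite nCM nC_conj nW mul1r mulr2n mulrDl mul1r /V.
  apply: le_trans (nCD _ _) _; apply: lerD; apply: le_trans (nC_sum _ _ _) _.
    by apply: ler_sum => k _; rewrite nCM nW mul1r.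
  apply: (@le_trans _ _ (\sum_(k < n.-1) nC (D k.+1 l))).
    by apply: ler_sum => k _; rewrite nCM nW mul1r.
  clear E; case: n => [|n] /=; first by rewrite !big_ord0.
  by rewrite [leRHS]big_ord_recl lerDr nC_ge0.
have t2 : 0 <= tau / 2 by rewrite divr_ge0// ltW.
rewrite nCM !nCM !nC_real nC_i !ger0_norm ?(ltW e20)// mulr1.
apply: le_trans (ler_wpM2l _ (le_trans (nCB _ _) (lerD (nV true) (nV false)))) _.
  by rewrite mulr_ge0// mulr_ge0// ltW.
by rewrite le_eqVlt; apply/orP; left; apply/eqP; field.
Qed.

Let d_error n l : nC (d l (n%:R * tau) - dn n l) <=
  2^-1 * (nC (defect true n l) + nC (defect false n l)) +
  eps ^+ 2 * (tau / 2) * \sum_(k < n) (nC (D k l) + nC (D k.+1 l)).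
Proof.
have dE : d l (n%:R * tau) = i_ * (2^-1)%:C * ((del l)%:C *
    (trav del c d true l (n%:R * tau) - trav del c d false l (n%:R * tau))).
  rewrite !travE /sg /sgnR rmorphN1 rmorph1.
  transitivity (- (i_ * i_) * ((del l)%:C * ((del l)^-1)%:C) *
      ((2^-1)%:C * (d l (n%:R * tau) + d l (n%:R * tau)))).
    by rewrite i2 dV half2 opprK !mul1r.
  by move: (d _ _) (_%:C) (_%:C) (_%:C) (c _ _) ('i : R[i]) => *; ring.
have E : d l (n%:R * tau) - dn n l = i_ * (2^-1)%:C *
    (conjc (W true n l) * (defect true n l + U true n l) -
     conjc (W false n l) * (defect false n l + U false n l)).
  rewrite dE /dn -!errorE.
  by move: (i_ : R[i]) (_%:C) (_%:C) (trav _ _ _ _ _ _) (trav _ _ _ _ _ _) (nu _ _ _) (nu _ _ _) => *; ring.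
have t2 : 0 <= tau / 2 by rewrite divr_ge0// ltW.
have nU s : nC (U s n l) <= eps ^+ 2 * (tau / 2) * \sum_(k < n) (nC (D k l) + nC (D k.+1 l)).
  rewrite mulr_sumr; apply: le_trans (nC_sum _ _ _) _; apply: ler_sum => k _.
  rewrite !nCM nsg nC_i !nC_real !ger0_norm ?(ltW e20)// !mul1r mulrA [tau / 2 * _]mulrC.
  rewrite ler_wpM2l//; first by rewrite mulr_ge0// ltW.
  by apply: le_trans (nCD _ _) _; rewrite !nCM !nW !mul1r.
rewrite E !nCM nC_i mul1r nC_real ger0_norm//.
set S := eps ^+ 2 * _ * _ in nU *.
have nT s : nC (conjc (W s n l) * (defect s n l + U s n l)) <= nC (defect s n l) + S.
  rewrite nCM nC_conj nW mul1r; apply: le_trans (nCD _ _) _.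
  by rewrite lerD2l.
apply: le_trans (ler_wpM2l _ (le_trans (nCB _ _) (lerD (nT true) (nT false)))) _ => //.
by rewrite le_eqVlt; apply/orP; left; apply/eqP; field.
Qed.

Let KL0 : 0 <= KL. Proof. by rewrite divr_ge0// ltW. Qed.
Let q0 : 0 <= q. Proof. by rewrite mulr_ge0// mulr_ge0 ?(ltW e20)// ltW. Qed.

Let growth n : n%:R * tau <= Te -> Z * (1 + q) ^+ n <= Ka.
Proof.
move=> hn; rewrite ler_wpM2l//.
apply: (@le_trans _ _ (expR q ^+ n)).
  by apply: lerXn2r; rewrite ?nnegrE ?expR_ge0 ?addr_ge0// expR_ge1Dx.
rewrite -expRM_natl ler_expR /q.
have -> : n%:R * (eps ^+ 2 * tau * KL) = KL * (n%:R * tau * eps ^+ 2) by ring.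
by rewrite ler_wpM2l// -ler_pdivlMr.
Qed.

Let time_le k n : (k <= n)%N -> n%:R * tau <= Te -> k%:R * tau <= Te.
Proof. by move=> kn; apply: le_trans; rewrite ler_pM2r// ler_nat. Qed.

Let lip n a : n%:R * tau <= Te -> a <= d0 -> bsum (fun l => del l * nC (c l (n%:R * tau) - cn n l)) a ->
  bsum (fun l => nC (D n l)) (KL * a).
Proof.
move=> hn ha h; rewrite /KL mulrAC -mulrA mulrC; apply: hlip => //.
  by rewrite ler_pdivrMr// mul1r.
have dV0 : 0 <= d0^-1 by rewrite invr_ge0 ltW.
apply: bsum_le (bsumZ dV0 h) => [l|]; last by rewrite mulrC.
by rewrite mulrA ler_peMl ?nC_ge0// mulrC ler_pdivlMr// mul1r.
Qed.

Let half_defect n L : uniq L -> n%:R * tau <= Te ->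
  \sum_(l <- L) 2^-1 * (nC (defect true n l) + nC (defect false n l)) <= Z.
Proof.
move=> uL hn; rewrite -mulr_sumr big_split /=.
have h1 := hdef true hn uL; have h2 := hdef false hn uL.
apply: le_trans (ler_wpM2l _ (lerD h1 h2)) _ => //.
by rewrite le_eqVlt; apply/orP; left; apply/eqP; field.
Qed.

(** A discrete Gronwall argument. The Lipschitz bound [hlip] only holds in a fixed
    neighbourhood of the exact solution, which [Ka1] keeps the iterates in. *)
Lemma position_growth n : n%:R * tau <= Te ->
  bsum (fun l => del l * nC (c l (n%:R * tau) - cn n l)) (Z * (1 + q) ^+ n).
Proof.
elim/ltn_ind: n => n IH hn L uL.
have hD (k : 'I_n) : bsum (fun l => nC (D k l)) (KL * (Z * (1 + q) ^+ k)).
  have hk := time_le (ltnW (ltn_ord k)) hn.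
  by apply: lip => //; [apply: le_trans (growth hk) Ka1|exact: IH].
apply: le_trans; first by apply: ler_sum => l _; exact: c_error.
rewrite big_split /= -[X in _ + X <= _]mulr_sumr exchange_big /=.
apply: (@le_trans _ _ (Z + eps ^+ 2 * tau * \sum_(k < n) KL * (Z * (1 + q) ^+ k))).
  apply: lerD; first exact: half_defect.
  rewrite ler_wpM2l//; first by rewrite mulr_ge0 ?(ltW e20)// ltW.
  by apply: ler_sum => k _; exact: hD.
rewrite le_eqVlt; apply/orP; left; apply/eqP; clear -q.
elim: n => [|n IH]; first by rewrite big_ord0 mulr0 addr0 expr0 mulr1.
rewrite big_ord_recr /= mulrDr addrA IH [(1 + q) ^+ n.+1]exprS; move: (_ ^+ n) => p; rewrite /q; ring.
Qed.

Lemma position_stability n : n%:R * tau <= Te ->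
  bsum (fun l => del l * nC (c l (n%:R * tau) - cn n l)) Ka.
Proof. by move=> hn; apply: bsum_le (position_growth hn) => //; exact: growth. Qed.

Lemma velocity_stability n : n%:R * tau <= Te ->
  bsum (fun l => nC (d l (n%:R * tau) - dn n l)) (Z + T * KL * Ka).
Proof.
move=> hn L uL; apply: le_trans; first by apply: ler_sum => l _; exact: d_error.
have Ka0 : 0 <= Ka by rewrite mulr_ge0 ?expR_ge0.
have hD k : (k <= n)%N -> \sum_(l <- L) nC (D k l) <= KL * Ka.
  move=> kn; have hk := time_le kn hn.
  by apply: (lip hk Ka1 (position_stability hk)).
rewrite big_split /= -[X in _ + X <= _]mulr_sumr exchange_big /=.
apply: lerD; first exact: half_defect.
apply: (@le_trans _ _ (eps ^+ 2 * (tau / 2) * \sum_(k < n) (KL * Ka + KL * Ka))).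
  rewrite ler_wpM2l//; first by rewrite mulr_ge0 ?divr_ge0 ?(ltW e20)// ltW.
  apply: ler_sum => k _; rewrite big_split /=; apply: lerD; apply: hD => //.
  exact: ltnW.
rewrite sumr_const card_ord -[_ *+ n]mulr_natl.
have -> : eps ^+ 2 * (tau / 2) * (n%:R * (KL * Ka + KL * Ka)) = n%:R * tau * eps ^+ 2 * (KL * Ka).
  by field.
rewrite -[leRHS]mulrA ler_wpM2r//; first by rewrite mulr_ge0.
by rewrite -ler_pdivlMr.
Qed.

End stability.

(** * Resolved frequencies and the step restriction *)

Section step_restriction.
Variables (R : realType) (a b alpha beta gamma : R).
Hypotheses (hab : a < b) (halpha : 1 < alpha <= 2) (hbeta : 0 < beta).
Hypothesis (hgamma : 0 < gamma < 1).
Local Notation del := (delta a b alpha beta).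

Let ba : 0 < b - a. Proof. by rewrite subr_gt0. Qed.
Let al0 : 0 < alpha. Proof. by move: halpha; lra. Qed.
Let al20 : 0 < alpha / 2. Proof. by rewrite divr_gt0. Qed.
Let g0 : 0 < gamma. Proof. by case/andP: hgamma. Qed.
Let pi0 : 0 < pi :> R. Proof. exact: pi_gt0. Qed.
Let half_sqr (x : R) : (x `^ (alpha / 2)) ^+ 2 = x `^ alpha.
Proof. by rewrite -powR_mulrn ?powR_ge0// -powRrM; congr (_ `^ _); field. Qed.

Let root tau0 : R := Num.sqrt (beta * tau0 `^ alpha * (b - a) `^ alpha +
                             2 `^ alpha * pi `^ alpha * (1 + tau0) `^ alpha).

Let root_gt0 tau0 : 0 < tau0 -> 0 < root tau0.
Proof.
move=> t0; rewrite sqrtr_gt0 addr_gt0 ?mulr_gt0 ?powR_gt0// addr_gt0//.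
Qed.

Let mu_norm l : `|mu a b l| = 2 * pi / (b - a) * (`|l|%N)%:R.
Proof.
have p2 : 0 < 2 * pi / (b - a) by rewrite divr_gt0// mulr_gt0.
rewrite /mu mulrAC normrM [X in X * _]gtr0_norm//; congr (_ * _).
by rewrite -intr_norm -abszE.
Qed.

(** The bound is [gamma * pi / 2] divided by [del] at the frequency
    [(1 + tau0) / tau0], which lies above all resolved frequencies. The phase of an
    interaction of four of them is then at most [2 * pi * gamma]. *)
Lemma low_frequency_phase tau0 tau l : 0 < tau0 ->
  0 < tau < step_bound a b alpha beta gamma tau0 ->
  (`|l| <= Num.truncn tau0^-1)%N -> tau * del l <= gamma * pi / 2.
Proof.
move=> t0 /andP[tp]; rewrite lt_min => /andP[_ ht] hl.
have {hl} hl : (`|l|%N)%:R * tau0 <= 1 :> R.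
  rewrite -ler_pdivlMr// mul1r; apply: (@le_trans _ _ (Num.truncn tau0^-1)%:R).
    by rewrite ler_nat.
  by rewrite truncn_le invr_ge0 ltW.
pose P := (b - a) `^ (alpha / 2) * tau0 `^ (alpha / 2).
have P0 : 0 < P by rewrite mulr_gt0// powR_gt0.
have S0 := root_gt0 t0; set S := root tau0 in S0.
have key : del l * P <= S.
  have -> : del l * P = Num.sqrt ((del l * P) ^+ 2).
    by rewrite sqrtr_sqr ger0_norm// mulr_ge0 ?(ltW P0)// ltW// delta_gt0.
  rewrite /S /root; apply: ler_wsqrtr; rewrite /P !exprMn !half_sqr delta_sqr// mulrDl.
  apply: lerD; first by rewrite le_eqVlt; apply/orP; left; apply/eqP; ring.
  have n1 : 0 <= 1 + tau0 by rewrite addr_ge0// ltW.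
  have n2 : 0 <= (2 : R) by [].
  have n3 : 0 <= 2 * pi :> R by apply: mulr_ge0 => //; exact: ltW.
  have n4 : 0 <= (b - a) * tau0 by apply: mulr_ge0; exact: ltW.
  rewrite -(powRM alpha (ltW ba) (ltW t0)) -(powRM alpha (normr_ge0 _) n4).
  rewrite -(powRM alpha n2 (ltW pi0)) -(powRM alpha n3 n1).
  apply: ge0_ler_powR; rewrite ?nnegrE; [exact: ltW|exact: mulr_ge0|exact: mulr_ge0|].
  rewrite mu_norm.
  have -> : 2 * pi / (b - a) * `|l|%:R * ((b - a) * tau0) = 2 * pi * (`|l|%:R * tau0).
    by field; rewrite gt_eqF.
  by apply: ler_wpM2l => //; move: hl t0; lra.
have {}ht : tau < gamma * (pi * P / (2 * S)) by rewrite [pi * P]mulrA.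
apply: (@le_trans _ _ (gamma * (pi * P / (2 * S)) * del l)).
  by rewrite ler_wpM2r ?(ltW ht)// ltW// delta_gt0.
have -> : gamma * (pi * P / (2 * S)) * del l = gamma * pi / 2 * (del l * P / S).
  by field; rewrite gt_eqF.
have gp : 0 <= gamma * pi / 2 by apply: divr_ge0 => //; apply: mulr_ge0; exact: ltW.
by rewrite ler_piMr// ler_pdivrMr// mul1r.
Qed.

Lemma step_bound_le tau0 tau : 0 < tau0 ->
  0 < tau < step_bound a b alpha beta gamma tau0 ->
  tau <= pi * (b - a) `^ (alpha / 2) * tau0 `^ (alpha / 2).
Proof.
move=> t0 /andP[tp]; rewrite lt_min => /andP[_ ht].
have S0 := root_gt0 t0; rewrite -/(root tau0) in ht.
apply: le_trans (ltW ht) _.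
set P := pi * _ * _; have P0 : 0 < P by rewrite !mulr_gt0// powR_gt0.
have S1 : 1 <= root tau0.
  rewrite -[1]sqrtr1 /root; apply: ler_wsqrtr.
  apply: (@le_trans _ _ (2 `^ alpha * pi `^ alpha * (1 + tau0) `^ alpha)); last first.
    by rewrite lerDr !mulr_ge0 ?powR_ge0// ltW.
  have pi1 : 1 <= pi :> R by apply: le_trans (pi_ge2 R); rewrite ler1n.
  have h x : 1 <= x -> 1 <= x `^ alpha :> R.
    by move=> x1; rewrite -[leLHS](powRr0 x) ler_powR// ltW.
  rewrite -[leLHS]mulr1 -[leLHS]mulr1; do 2?apply: ler_pM => //; apply: h => //.
    by rewrite ler1n.
  by rewrite lerDl ltW.
rewrite mulrA ler_pdivrMr ?mulr_gt0//.
apply: (@le_trans _ _ P); first by rewrite ler_piMl ?(ltW P0)//; case/andP: hgamma => _ /ltW.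
by rewrite ler_peMr ?(ltW P0)//; move: S1; lra.
Qed.

(** Serves to find the smallest cut-off for a given step: the denominator in the
    restriction is bounded for [tau0 <= 1]. *)
Lemma step_bound_ge : exists2 k, 1 <= k & forall tau0 tau, 0 < tau0 <= 1 -> 0 < tau < 1 ->
  k * tau <= tau0 `^ (alpha / 2) -> tau < step_bound a b alpha beta gamma tau0.
Proof.
pose S1 := Num.sqrt (beta * (b - a) `^ alpha + 2 `^ alpha * pi `^ alpha * 2 `^ alpha).
have S10 : 0 < S1.
  by rewrite sqrtr_gt0 addr_gt0 ?mulr_gt0 ?powR_gt0.
pose q := gamma * (pi * (b - a) `^ (alpha / 2)).
have q0 : 0 < q by rewrite !mulr_gt0// powR_gt0.
exists (4 * S1 / q + 1).
  by rewrite lerDr; apply: divr_ge0; [apply: mulr_ge0 => //|]; exact: ltW.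
move=> tau0 tau /andP[t0 t1] /andP[tp tlt] h; rewrite lt_min tlt /= -/(root tau0).
have R0 := root_gt0 t0.
have RS : root tau0 <= S1.
  apply: ler_wsqrtr; apply: lerD.
    rewrite ler_wpM2r ?powR_ge0// ler_piMr ?(ltW hbeta)//.
    have : tau0 `^ alpha <= 1 `^ alpha by apply: ge0_ler_powR; rewrite ?nnegrE ?(ltW al0) ?(ltW t0) ?ler01.
    by rewrite powR1.
  rewrite ler_wpM2l ?mulr_ge0 ?powR_ge0//.
  by apply: ge0_ler_powR; rewrite ?nnegrE ?(ltW al0)//; move: t0 t1; lra.
rewrite mulrA ltr_pdivlMr ?mulr_gt0//.
have -> : gamma * (pi * (b - a) `^ (alpha / 2) * tau0 `^ (alpha / 2)) = q * tau0 `^ (alpha / 2).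
  by rewrite /q; ring.
apply: (@lt_le_trans _ _ (q * ((4 * S1 / q + 1) * tau))); last by rewrite ler_wpM2l// ltW.
have -> : q * ((4 * S1 / q + 1) * tau) = 4 * S1 * tau + q * tau by field; rewrite gt_eqF.
apply: (@le_lt_trans _ _ (2 * S1 * tau)).
  by rewrite mulrC -!mulrA ler_wpM2l// ler_wpM2r// ltW.
have qt : 0 < q * tau by rewrite mulr_gt0.
have St : 0 < S1 * tau by rewrite mulr_gt0.
by move: qt St; rewrite -!mulrA; lra.
Qed.

Lemma high_frequency_weight s tau0 l : 0 < s -> 0 < tau0 ->
  (Num.truncn tau0^-1 < `|l|)%N ->
  1 <= (b - a) `^ s * tau0 `^ s * jap a b (s / 2) l.
Proof.
move=> s0 t0 hl.
have {hl} hl : 1 <= tau0 * (`|l|%N)%:R.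
  rewrite mulrC -ler_pdivrMr// mul1r; apply: ltW.
  by apply: lt_le_trans (truncnS_gt _) _; rewrite ler_nat.
have j : `|mu a b l| `^ s <= jap a b (s / 2) l.
  rewrite /jap (_ : `|mu a b l| `^ s = (mu a b l ^+ 2) `^ (s / 2)).
    by apply: ge0_ler_powR; rewrite ?nnegrE ?sqr_ge0 ?addr_ge0 ?sqr_ge0 ?lerDr// divr_ge0// ltW.
  rewrite -(real_normK (num_real (mu a b l))) -powR_mulrn// -powRrM.
  by congr (_ `^ _); field.
apply: (@le_trans _ _ ((b - a) `^ s * tau0 `^ s * `|mu a b l| `^ s)); last first.
  by rewrite ler_wpM2l ?mulr_ge0 ?powR_ge0.
rewrite -!powRM ?mulr_ge0 ?normr_ge0 ?(ltW ba) ?(ltW t0)// mu_norm.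
have -> : (b - a) * tau0 * (2 * pi / (b - a) * `|l|%:R) = 2 * pi * (tau0 * `|l|%:R).
  by field; rewrite gt_eqF.
rewrite -[leLHS](powRr0 (2 * pi * (tau0 * `|l|%:R))) ler_powR ?(ltW s0)//.
have pi1 : 1 <= 2 * pi :> R by have := pi_ge2 R; lra.
by rewrite -[leLHS]mulr1 ler_pM.
Qed.

End step_restriction.

(** * The error bound *)

Section error_bound.
Variables (R : realType) (a b alpha beta gamma T m M : R).
Hypotheses (hab : a < b) (halpha : 1 < alpha <= 2) (hbeta : 0 < beta) (hT : 0 < T).
Hypotheses (hm : 1 < m) (hgamma : 0 < gamma < 1).
Local Notation del := (delta a b alpha beta).
Local Notation s := (m + alpha / 2).

Let al0 : 0 < alpha. Proof. by move: halpha; lra. Qed.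

Let hnorm_inA q f c B : inA a b f c -> bsum (fun l => jap a b (q / 2) l * nC (c l)) B ->
  (hnorm a b q f <= B%:E)%E.
Proof.
move=> hf hB; apply: bsum_hnorm => //.
  by apply: bmeas_L2 => //; exact: inA_bmeas hf.
by apply: bsum_le hB => // l; rewrite (inA_fcoef hab _ hf).
Qed.

Let jap_delta l : jap a b (alpha / 2 / 2) l <= (Cdel alpha beta + 1) * del l.
Proof.
have C0 := Cdel_ge0 alpha hbeta; have d0 := ltW (delta_gt0 a b alpha hbeta l).
have C1 : 0 <= Cdel alpha beta + 1 by rewrite addr_ge0.
rewrite -ler_sqr ?nnegrE ?jap_ge0 ?mulr_ge0// jap_half exprMn.
apply: le_trans (jap_le_delta a b halpha hbeta l) _.
rewrite ler_wpM2r ?sqr_ge0//; move: C0; move: (Cdel _ _) => x x0.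
by rewrite expr2; nra.
Qed.

Let d0 := Num.sqrt beta.
Let d00 : 0 < d0. Proof. by rewrite sqrtr_gt0. Qed.

Section constants.
Variable B : R.
Hypothesis B0 : 0 <= B.
Let bB := d0^-1 * B.
Let Lc := bB * bB + bB * (bB + 1) + (bB + 1) * (bB + 1).
Let E := expR (Lc / d0 * T).
Let Kq := `|Kquad gamma T B d0 (Ddel alpha beta)|.
Let K := 2 `^ (s / 2) : R.
Let Cr := (b - a) `^ s * (3 * B * bB ^+ 2 + K ^+ 2 * B ^+ 3).
Let Cs := pi * (b - a) `^ (alpha / 2).
Let Y := Kq * (Cs ^+ 2 + Cr) * E.

Let bB0 : 0 <= bB. Proof. by rewrite mulr_ge0// invr_ge0 ltW. Qed.
Let Lc0 : 0 <= Lc. Proof. by rewrite !addr_ge0// mulr_ge0// addr_ge0. Qed.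
Let E0 : 0 <= E. Proof. exact: expR_ge0. Qed.
Let Kq0 : 0 <= Kq. Proof. exact: normr_ge0. Qed.
Let Cr0 : 0 <= Cr.
Proof.
rewrite mulr_ge0 ?powR_ge0// addr_ge0//; first by rewrite mulr_ge0 ?sqr_ge0// mulr_ge0.
by rewrite mulr_ge0 ?sqr_ge0// exprn_ge0.
Qed.
Let Y0 : 0 <= Y.
Proof. by rewrite mulr_ge0// mulr_ge0// addr_ge0 ?sqr_ge0. Qed.

(** Below this cut-off the accumulated error stays at most [d0], as the Gronwall
    argument requires; the step restriction makes [tau] small with [tau0]. *)
Definition max_cutoff : R := Num.min 1 (d0 / (Y + 1)).

Lemma max_cutoff_gt0 : 0 < max_cutoff.
Proof. by rewrite lt_min ltr01 divr_gt0// ltr_wpDl. Qed.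

Lemma max_cutoff_le1 : max_cutoff <= 1.
Proof. by rewrite ge_min lexx. Qed.

Definition error_constant : R :=
  Kq * (1 + Cr) * (E * (Cdel alpha beta + 1) + 1 + T * (Lc / d0) * E).

Let X0 : 0 <= E * (Cdel alpha beta + 1) + 1 + T * (Lc / d0) * E.
Proof.
have TL : 0 <= T * (Lc / d0) by rewrite mulr_ge0 ?(ltW hT)// divr_ge0 ?(ltW d00).
have C1 : 0 <= Cdel alpha beta + 1 by rewrite addr_ge0 ?Cdel_ge0.
by apply: addr_ge0; [apply: addr_ge0 => //|]; exact: mulr_ge0.
Qed.

Lemma error_constant_ge0 : 0 <= error_constant.
Proof. by apply: mulr_ge0 => //; apply: mulr_ge0 => //; apply: addr_ge0. Qed.

Lemma scheme_error_le eps tau0 tau psi0 psi1 psi psit c d NN N1 phi n :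
  0 < eps <= 1 -> 0 < tau0 < max_cutoff ->
  0 < tau < step_bound a b alpha beta gamma tau0 ->
  coef_bounds a b alpha beta T m eps B psi psit c d NN N1 ->
  (forall x, a <= x <= b -> psi 0 x = psi0 x /\ psit 0 x = psi1 x) ->
  is_semidiscrete a b alpha beta eps tau psi0 psi1 phi -> n%:R * tau <= T / eps ^+ 2 ->
  (scheme_error a b alpha beta tau psi0 psi1 psi psit phi n <=
    (error_constant * (eps ^+ 2 * tau ^+ 2 + tau0 `^ s))%:E)%E.
Proof.
move=> he /andP[t00 t0m] hstep hcoef hinit hphi hn.
have t01 : tau0 <= 1 by apply: le_trans max_cutoff_le1; exact: ltW.
have tau_gt0 : 0 < tau by case/andP: hstep.
have e2 : 0 < eps ^+ 2 by case/andP: he => e0 _; rewrite exprn_gt0.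
have e21 : eps ^+ 2 <= 1 by case/andP: he => e0 e1; rewrite expr_le1// ltW.
have s1 : 1 <= s by move: hm al0; lra.
have s20 : 0 <= s / 2 by rewrite divr_ge0// (le_trans ler01).
pose rho := Cr * tau0 `^ s.
have rho0 : 0 <= rho by rewrite mulr_ge0 ?powR_ge0.
pose eta := eps ^+ 2 * tau ^+ 2 + rho.
have et0 : 0 <= eps ^+ 2 * tau ^+ 2 by rewrite mulr_ge0 ?sqr_ge0// ltW.
have eta0 : 0 <= eta by rewrite addr_ge0.
pose Z := Kq * eta; have Z0 : 0 <= Z by rewrite mulr_ge0.
have Te0 : 0 <= T / eps ^+ 2 by apply: divr_ge0; exact: ltW.
have t0in : (0 : R) <= 0 <= T / eps ^+ 2 by apply/andP; split.
have tin k : k%:R * tau <= T / eps ^+ 2 -> 0 <= k%:R * tau <= T / eps ^+ 2.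
  by move=> ->; rewrite andbT; apply: mulr_ge0 => //; exact: ltW.
have bc t : 0 <= t <= T / eps ^+ 2 -> bsum (fun l => nC (c l t)) bB.
  move=> /hcoef[_ _ _ [_ _ _ [h _ _ _ _]]].
  have dV : 0 <= d0^-1 by rewrite invr_ge0 ltW.
  apply: bsum_le (bsumZ dV h) => // l; rewrite mulrA ler_peMl ?nC_ge0//.
  by rewrite mulrC ler_pdivlMr// mul1r; exact: delta_ge.
have [A0 A1 _ [_ _ _ [b0 _ _ _ _]]] := hcoef 0 t0in.
have h0 : inA a b (toC psi0) (c ^~ 0).
  by apply: inA_eq A0 => x hx; rewrite /toC (hinit x hx).1.
have h1 : inA a b (toC psi1) (d ^~ 0).
  by apply: inA_eq A1 => x hx; rewrite /toC (hinit x hx).2.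
have hc0 : exists B, bsum (fun l => del l * nC (c l 0)) B by exists B.
have nA := num_c_inA hab hbeta h0 h1 hc0 hphi.
have dA := num_d_inA hab hbeta h0 h1 hc0 hphi.
have n0 := num_trav0 hab hbeta h0 h1 hc0 hphi.
have nS := num_travS hab hbeta h0 h1 hc0 hphi.
have brho t : 0 <= t <= T / eps ^+ 2 ->
    bsum (fun l => nC (NN l t - Nlow (Num.truncn tau0^-1) c l t)) rho.
  move=> ht; have [A _ hN [_ _ _ [_ _ _ _ hw]]] := hcoef t ht.
  have w0 l : 0 <= jap a b (s / 2) l by exact: jap_ge0.
  have ws k l : jap a b (s / 2) (k + l) <= K * (jap a b (s / 2) k * jap a b (s / 2) l).
    exact: jap_submul.
  have x0 : 0 <= (b - a) `^ s * tau0 `^ s by rewrite mulr_ge0 ?powR_ge0.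
  have hx l : (Num.truncn tau0^-1 < `|l|)%N -> 1 <= (b - a) `^ s * tau0 `^ s * jap a b (s / 2) l.
    by apply: high_frequency_weight => //; exact: lt_le_trans s1.
  have h := cube_truncation hab A w0 (powR_ge0 _ _) ws x0 hx (bc t ht) hw.
  apply: bsum_le h => [l|]; first by rewrite hN.
  by rewrite le_eqVlt; apply/orP; left; apply/eqP; rewrite /rho /Cr /K; ring.
have D0 : 0 <= Ddel alpha beta by apply: le_trans ler01 (Ddel_ge1 alpha hbeta).
have dge l : d0 <= del l by exact: delta_ge.
have dsub k l : del (k + l) <= Ddel alpha beta * (del k * del l) by exact: delta_submul.
have dlow l : (`|l| <= Num.truncn tau0^-1)%N -> tau * del l <= gamma * pi / 2.
  exact: low_frequency_phase.
have hdef s' k : k%:R * tau <= T / eps ^+ 2 -> _ := fun hk L uL =>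
  le_trans (@exact_trapezoid R gamma tau eps T B rho d0 (Ddel alpha beta)
    (Num.truncn tau0^-1) del c d NN N1 hgamma tau_gt0 he hT d00 D0 B0 rho0 dge dsub dlow
    (fun l t ht => let: And4 _ _ _ (And4 h _ _ _) := hcoef t ht in h l)
    (fun l t ht => let: And4 _ _ _ (And4 _ h _ _) := hcoef t ht in h l)
    (fun l t ht => let: And4 _ _ _ (And4 _ _ h _) := hcoef t ht in h l)
    (fun t ht => let: And4 _ _ _ (And4 _ _ _ (And5 h _ _ _ _)) := hcoef t ht in h)
    (fun t ht => let: And4 _ _ _ (And4 _ _ _ (And5 _ h _ _ _)) := hcoef t ht in h)
    (fun t ht => let: And4 _ _ _ (And4 _ _ _ (And5 _ _ h _ _)) := hcoef t ht in h)
    (fun t ht => let: And4 _ _ _ (And4 _ _ _ (And5 _ _ _ h _)) := hcoef t ht in h)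
    brho s' L uL k hk) (ler_wpM2r eta0 (ler_norm _)).
have hlip k e : k%:R * tau <= T / eps ^+ 2 -> e <= 1 ->
    bsum (fun l => nC (c l (k%:R * tau) - num_c a b phi k l)) e ->
    bsum (fun l => nC (NN l (k%:R * tau) - num_N a b psi0 phi k l)) (e * Lc).
  move=> hk e1 he'; have ht := tin k hk; have [A _ hN _] := hcoef _ ht.
  have bn : bsum (fun l => nC (num_c a b phi k l)) (bB + 1).
    apply: bsum_le (bsumD (bc _ ht) he') => [l|]; last by rewrite lerD2l.
    have {1}-> : num_c a b phi k l = c l (k%:R * tau) - (c l (k%:R * tau) - num_c a b phi k l).
      by rewrite opprB addrC subrK.
    exact: nCB.
  apply: bsum_le (cube_diff hab A (nA k) (bc _ ht) bn he') => // l.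
  by rewrite hN.
have Ka1 : Z * E <= d0.
  have eta_le : eta <= (Cs ^+ 2 + Cr) * tau0.
    rewrite mulrDl; apply: lerD.
      apply: (@le_trans _ _ (tau ^+ 2)); first by rewrite ler_piMl ?sqr_ge0.
      have tl := step_bound_le hab halpha hbeta hgamma t00 hstep.
      apply: (@le_trans _ _ ((Cs * tau0 `^ (alpha / 2)) ^+ 2)).
        by rewrite ler_sqr ?nnegrE ?(ltW tau_gt0)// (le_trans (ltW tau_gt0)).
      rewrite exprMn ler_wpM2l ?sqr_ge0// -powR_mulrn ?powR_ge0// -powRrM divfK//.
      by apply: ge1r_powR; rewrite ?t00//; move: halpha => /andP[/ltW].
    rewrite ler_wpM2l//; apply: ge1r_powR => //; by rewrite t00.
  apply: (@le_trans _ _ (Y * tau0)).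
    have -> : Y * tau0 = Kq * ((Cs ^+ 2 + Cr) * tau0) * E by rewrite /Y; ring.
    by rewrite ler_wpM2r// ler_wpM2l.
  apply: (@le_trans _ _ (Y * (d0 / (Y + 1)))).
    rewrite ler_wpM2l//; apply: le_trans (ltW t0m) _; by rewrite ge_min lexx orbT.
  have Y1 : 0 < Y + 1 by rewrite ltr_wpDl.
  rewrite mulrCA ler_piMr ?(ltW d00)// ler_pdivrMr// mul1r lerDl; exact: ler01.
have pos := @position_stability R eps tau T d0 Z Lc tau_gt0 he d00 Z0 Lc0 del c d NN
  (num_trav a b phi) (num_N a b psi0 phi) dge n0 nS hdef hlip Ka1 n hn.
have vel := @velocity_stability R eps tau T d0 Z Lc tau_gt0 he d00 Z0 Lc0 del c d NN
  (num_trav a b phi) (num_N a b psi0 phi) dge n0 nS hdef hlip Ka1 n hn.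
have [An Bn _ _] := hcoef _ (tin n hn).
have C1 : 0 <= Cdel alpha beta + 1 by rewrite addr_ge0 ?Cdel_ge0.
have epos : (hnorm a b (alpha / 2) (fun x => toC (psi (n%:R * tau)) x - psi_approx psi0 phi n x)%R <=
    ((Cdel alpha beta + 1) * (Z * E))%:E)%E.
  apply: hnorm_inA (inAB An (nA n)) _; apply: bsum_le (bsumZ C1 pos) => // l.
  by rewrite mulrA ler_wpM2r ?nC_ge0.
have evel : (hnorm a b 0 (fun x => toC (psit (n%:R * tau)) x -
    eta_approx a b alpha beta psi1 phi n x)%R <= (Z + T * (Lc / d0) * (Z * E))%:E)%E.
  apply: hnorm_inA (inAB Bn (dA n)) _; apply: bsum_le vel => // l.
  by rewrite mul0r jap0 mul1r.
apply: le_trans (leeD epos evel) _; rewrite -EFinD lee_fin.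
have -> : (Cdel alpha beta + 1) * (Z * E) + (Z + T * (Lc / d0) * (Z * E)) =
    Kq * (E * (Cdel alpha beta + 1) + 1 + T * (Lc / d0) * E) * eta by rewrite /Z; ring.
rewrite /error_constant; move: X0; set X := E * _ + _ + _ => X_ge0.
have -> : Kq * (1 + Cr) * X * (eps ^+ 2 * tau ^+ 2 + tau0 `^ s) =
    Kq * X * ((1 + Cr) * (eps ^+ 2 * tau ^+ 2 + tau0 `^ s)) by ring.
rewrite ler_wpM2l ?mulr_ge0// /eta /rho mulrDl mul1r mulrDr.
have := mulr_ge0 Cr0 et0; have := powR_ge0 tau0 s; lra.
Qed.

End constants.
End error_bound.

(** The step restriction allows the cut-off [tau0] to be as small as
    [tau `^ (2 / alpha)], for which [tau0 `^ (m + alpha / 2)] is of order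
    [tau `^ (2 * m / alpha + 1)]. The exponent exceeds 2 by at least [2 / kappa], and
    a step of size [eps `^ kappa] turns this excess into the factor [eps ^+ 2]. *)
Lemma optimal_cutoff (R : realType) (alpha m kappa k tm : R) :
  0 < alpha -> 1 <= k -> 0 < tm <= 1 -> 0 < kappa -> alpha / 2 + alpha / kappa <= m ->
  exists2 tau1 : R, 0 < tau1 <= 1 & forall eps tau : R, 0 < eps <= 1 ->
    0 < tau < tau1 * eps `^ kappa ->
    let tau0 := (k * tau) `^ (2 / alpha) in
    [/\ 0 < tau0 < tm, tau0 `^ (alpha / 2) = k * tau &
        tau0 `^ (m + alpha / 2) <= eps ^+ 2 * tau ^+ 2].
Proof.
move=> al0 k1 /andP[tm0 tm1] kap0 hm.
have k0 : 0 < k by exact: lt_le_trans k1.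
have kV0 : 0 < k^-1 by rewrite invr_gt0.
pose tau1 := Num.min 1 (Num.min (k^-1 * tm `^ (alpha / 2)) (k^-1 * k^-1 `^ kappa)).
have tau10 : 0 < tau1 by rewrite !lt_min ltr01 !mulr_gt0 ?powR_gt0.
exists tau1; first by rewrite tau10 ge_min lexx.
move=> eps tau /andP[e0 e1] /andP[t0 tlt] tau0.
have kt0 : 0 < k * tau by rewrite mulr_gt0.
have half : tau0 `^ (alpha / 2) = k * tau.
  rewrite /tau0 -powRrM (_ : 2 / alpha * (alpha / 2) = 1) ?powRr1 ?(ltW kt0)//.
  by field; rewrite gt_eqF.
have ek : eps `^ kappa <= 1.
  have : eps `^ kappa <= 1 `^ kappa by apply: ge0_ler_powR; rewrite ?nnegrE ?(ltW kap0) ?(ltW e0) ?ler01.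
  by rewrite powR1.
have ek0 : 0 <= eps `^ kappa by exact: powR_ge0.
have tt1 : tau < tau1 by apply: lt_le_trans tlt _; rewrite ler_piMr// ltW.
have b1 : k * tau < tm `^ (alpha / 2).
  rewrite mulrC -ltr_pdivlMr// mulrC; apply: lt_le_trans tt1 _.
  by rewrite /tau1 !ge_min lexx /= orbT.
have b2 : k * tau <= (k^-1 * eps) `^ kappa.
  rewrite powRM ?(ltW kV0) ?(ltW e0)// mulrC -ler_pdivlMr// mulrC mulrA.
  apply: le_trans (ltW tlt) _; rewrite ler_wpM2r//.
  by rewrite /tau1 !ge_min lexx !orbT.
have kt1 : k * tau <= 1.
  apply: le_trans (ltW b1) _.
  have : tm `^ (alpha / 2) <= 1 `^ (alpha / 2).
    by apply: ge0_ler_powR; rewrite ?nnegrE ?(ltW tm0) ?ler01// divr_ge0// ltW.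
  by rewrite powR1.
split=> //.
  rewrite powR_gt0//=.
  have -> : tm = (tm `^ (alpha / 2)) `^ (2 / alpha).
    rewrite -powRrM (_ : alpha / 2 * (2 / alpha) = 1) ?powRr1 ?(ltW tm0)//.
    by field; rewrite gt_eqF.
  apply: gt0_ltr_powR; rewrite ?nnegrE ?(ltW kt0) ?powR_ge0// divr_gt0//.
rewrite /tau0 -powRrM.
apply: (@le_trans _ _ ((k * tau) `^ (2 + 2 / kappa))).
  apply: ger_powR; first by rewrite kt0.
  rewrite -subr_ge0.
  have -> : 2 / alpha * (m + alpha / 2) - (2 + 2 / kappa) =
      2 / alpha * (m - (alpha / 2 + alpha / kappa)).
    by field; rewrite !gt_eqF.
  by rewrite mulr_ge0 ?subr_ge0// divr_ge0// ltW.
rewrite powRD; last by rewrite (gt_eqF kt0) implybT.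
rewrite [_ `^ 2]powR_mulrn ?(ltW kt0)//.
apply: (@le_trans _ _ ((k * tau) ^+ 2 * (k^-1 * eps) ^+ 2)).
  rewrite ler_wpM2l ?sqr_ge0//.
  have q0 : 0 <= k^-1 * eps by rewrite mulr_ge0// ltW.
  rewrite -[leRHS]powR_mulrn//.
  have -> : (k^-1 * eps) `^ 2%:R = ((k^-1 * eps) `^ kappa) `^ (2 / kappa).
    by rewrite -powRrM; congr (_ `^ _); field; rewrite gt_eqF.
  by apply: ge0_ler_powR; rewrite ?nnegrE ?(ltW kt0) ?powR_ge0// divr_ge0// ltW.
rewrite le_eqVlt; apply/orP; left; apply/eqP; field; by rewrite gt_eqF.
Qed.

Unset Implicit Arguments.
Set Strict Implicit.
Set Printing Implicit Defensive.
Local Close Scope complex_scope.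

Theorem theorem1 (R : realType) (a b alpha beta T : R)
    (hab : a < b) (halpha : 1 < alpha <= 2) (hbeta : 0 < beta) (hT : 0 < T)
    (psi0 psi1 : R -> R) (psi psit : R -> R -> R -> R)
    (hsol : forall eps : R, 0 < eps <= 1 ->
       is_NSFKGE_solution a b alpha beta eps (T / eps ^+ 2) psi0 psi1
         (psi eps) (psit eps))
    (m : R) (hm : 1 < m)
    (hreg : exists M : R, forall eps : R, 0 < eps <= 1 ->
       C2_norm_le a b (m + alpha / 2) (T / eps ^+ 2)
         (fun t => toC (psi eps t)) M /\
       C2_norm_le a b m (T / eps ^+ 2) (fun t => toC (psit eps t)) M)
    (gamma : R) (hgamma : 0 < gamma < 1) :
  exists C tau_max : R,
    [/\ 0 < C, 0 < tau_max <= 1,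
        forall tau0 eps tau : R,
          0 < tau0 < tau_max -> 0 < eps <= 1 ->
          0 < tau < step_bound a b alpha beta gamma tau0 ->
          forall phi, is_semidiscrete a b alpha beta eps tau psi0 psi1 phi ->
          forall n : nat, n%:R * tau <= T / eps ^+ 2 ->
            (scheme_error a b alpha beta tau psi0 psi1 (psi eps) (psit eps) phi n
             <= (C * (eps ^+ 2 * tau ^+ 2 + tau0 `^ (m + alpha / 2)))%:E)%E
      & forall kappa : R, 0 < kappa -> alpha / 2 + alpha / kappa <= m ->
          exists2 tau1 : R, 0 < tau1 &
            forall eps tau : R, 0 < eps <= 1 -> 0 < tau < tau1 * eps `^ kappa ->
              (exists tau0 : R,
                 [/\ 0 < tau0 < tau_max,
                     tau < step_bound a b alpha beta gamma tau0 &
                     tau0 `^ (m + alpha / 2) <= eps ^+ 2 * tau ^+ 2]) /\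
              forall phi,
                is_semidiscrete a b alpha beta eps tau psi0 psi1 phi ->
              forall n : nat, n%:R * tau <= T / eps ^+ 2 ->
                (scheme_error a b alpha beta tau psi0 psi1
                   (psi eps) (psit eps) phi n
                 <= (C * (eps ^+ 2 * tau ^+ 2))%:E)%E].
Proof.
have [M hM] := hreg; have al0 : 0 < alpha by move: halpha; lra.
have [B B0 hB] := @exact_coefs R a b alpha beta T m M hab halpha hbeta hT hm.
pose C0 := error_constant a b alpha beta gamma T m B.
pose tm := max_cutoff a b alpha beta gamma T m B.
have C00 : 0 <= C0 by exact: error_constant_ge0.
have tm01 : 0 < tm <= 1 by rewrite max_cutoff_gt0 ?max_cutoff_le1.
have main tau0 eps tau : 0 < tau0 < tm -> 0 < eps <= 1 ->
    0 < tau < step_bound a b alpha beta gamma tau0 ->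
    forall phi, is_semidiscrete a b alpha beta eps tau psi0 psi1 phi ->
    forall n : nat, n%:R * tau <= T / eps ^+ 2 ->
      (scheme_error a b alpha beta tau psi0 psi1 (psi eps) (psit eps) phi n
       <= (C0 * (eps ^+ 2 * tau ^+ 2 + tau0 `^ (m + alpha / 2)))%:E)%E.
  move=> ht0 he ht phi hphi n hn; have [H1 H2] := hM eps he.
  have [N1 hc] := hB eps psi0 psi1 (psi eps) (psit eps) he (hsol eps he) H1 H2.
  have [_ _ _ hi] := hsol eps he.
  exact: (@scheme_error_le R a b alpha beta gamma T m hab halpha hbeta hT hm hgamma B B0
    eps tau0 tau psi0 psi1 (psi eps) (psit eps) _ _ _ N1 phi n he ht0 ht hc hi hphi hn).
(* the factor 2 is for the last part, where the remainder doubles the main term *)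
exists (2 * C0 + 1), tm; split => //.
- by rewrite ltr_wpDl// mulr_ge0.
- move=> tau0 eps tau ht0 he ht phi hphi n hn.
  apply: le_trans (main tau0 eps tau ht0 he ht phi hphi n hn) _; rewrite lee_fin.
  rewrite ler_wpM2r//; last by move: C00; lra.
  by rewrite addr_ge0 ?powR_ge0// mulr_ge0 ?sqr_ge0.
move=> kappa kap0 hk.
have [k k1 hstep] := @step_bound_ge R a b alpha beta gamma hab halpha hbeta hgamma.
have [tau1 /andP[tau10 tau11] hopt] := @optimal_cutoff R alpha m kappa k tm al0 k1 tm01 kap0 hk.
exists tau1 => // eps tau he ht; have [h1 h2 h3] := hopt eps tau he ht.
set tau0 := (k * tau) `^ (2 / alpha) in h1 h2 h3.
have [t0 tlt] := andP ht.
have tl1 : tau < 1.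
  apply: lt_le_trans tlt _; apply: le_trans tau11; rewrite ler_piMr ?(ltW tau10)//.
  have [e0 e1] := andP he.
  have : eps `^ kappa <= 1 `^ kappa by apply: ge0_ler_powR; rewrite ?nnegrE ?(ltW kap0) ?(ltW e0) ?ler01.
  by rewrite powR1.
have hs : tau < step_bound a b alpha beta gamma tau0.
  apply: hstep; rewrite ?h2 ?lexx ?t0 ?tl1//.
  case/andP: h1 => -> /ltW /le_trans; apply; by case/andP: tm01.
split; first by exists tau0.
move=> phi hphi n hn.
have hst : 0 < tau < step_bound a b alpha beta gamma tau0 by rewrite t0 hs.
apply: le_trans (main tau0 eps tau h1 he hst phi hphi n hn) _; rewrite lee_fin.
apply: (@le_trans _ _ (C0 * (eps ^+ 2 * tau ^+ 2 + eps ^+ 2 * tau ^+ 2))).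
  by rewrite ler_wpM2l// lerD2l.
have : 0 <= eps ^+ 2 * tau ^+ 2 by rewrite mulr_ge0 ?sqr_ge0.
by move: (eps ^+ 2 * _) => x x0; rewrite mulrDl mul1r; lra.
Qed.
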